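(* Let $\Gamma$ be a finite simple graph, with complement $\overline{\Gamma}$. Then $\Gamma$ is isomorphic to the prime graph of a pseudo $\mathrm{PSL}(2,17)$-solvable group $G$ if and only if one of the following holds: (1) $\overline{\Gamma}$ is triangle-free and $3$-colorable. (2) $\overline{\Gamma}$ has exactly one triangle $\{a,b,c\}$, where (for a suitable naming of its vertices) the vertices $a,b$ are not adjacent in $\overline{\Gamma}$ to any vertices outside $\{a,b,c\}$, and $\overline{\Gamma}$ has a $3$-coloring for which all the neighbors of $c$ other than $a$ and $b$ have the same color.
   Context: All groups are finite and all graphs are simple. For a finite group $G$, the prime graph $\Gamma(G)$ has as vertices the prime divisors of $|G|$; two distinct vertices $p,q$ are adjacent if and only if $G$ contains an element of order $pq$. A group $G$ is pseudo $\mathrm{PSL}(2,17)$-solvable if each of its composition factors is abelian or isomorphic to $\mathrm{PSL}(2,17)$ (in particular solvable groups are allowed). A $3$-coloring is a proper vertex coloring using at most three colors. *)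

(* Defs.v *)
From HB Require Import structures.
From mathcomp Require Import all_boot all_order all_algebra all_fingroup all_solvable.

Set Implicit Arguments.
Unset Strict Implicit.
Unset Printing Implicit Defensive.

Import GroupScope.

Section Graphs.

Variables (T : finType) (e : rel T).

Definition simple_graph := symmetric e /\ irreflexive e.

Definition compl_graph : rel T := fun x y => (x != y) && ~~ e x y.

(* In an irreflexive relation the three vertices are automatically distinct. *)
Definition triangle (x y z : T) := [&& e x y, e y z & e x z].

Definition triangle_free := forall x y z : T, ~~ triangle x y z.

(* Proper colorings with at most three colors: col need not be surjective. *)
Definition proper_3coloring (col : T -> 'I_3) :=
  forall x y : T, e x y -> col x != col y.

Definition three_colorable := exists col : T -> 'I_3, proper_3coloring col.

Definition unique_triangle (a b c : T) :=
  triangle a b c /\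
  forall x y z : T, triangle x y z -> [set x; y; z] = [set a; b; c].

End Graphs.

Definition graph_isomorphic (T1 T2 : finType) (e1 : rel T1) (e2 : rel T2) :=
  exists f : T1 -> T2, bijective f /\ forall x y : T1, e2 (f x) (f y) = e1 x y.

Definition prime_vertex (gT : finGroupType) (G : {group gT}) : finType :=
  seq_sub (primes #|G|).

Definition prime_graph (gT : finGroupType) (G : {group gT}) :
    rel (prime_vertex G) :=
  fun p q => (p != q) && [exists g in G, #[g] == (val p * val q)%N].

Section SpecialLinear.

Variables (n p : nat).

Definition SLset : {set {'GL_n(p)}} :=
  [set u : {'GL_n(p)} | (\det (GLval u) == 1)%R].

Lemma SLset_group_set : group_set SLset.
Proof.
apply/group_setP; split=> [|u v]; first by rewrite inE GL_1E det1.
by rewrite !inE GL_ME det_mulmx => /eqP-> /eqP->; rewrite GRing.mulr1.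
Qed.

Canonical SL : {group {'GL_n(p)}} := Group SLset_group_set.

Definition PSL : {group coset_of 'Z(SL)} := (SL / 'Z(SL))%G.

End SpecialLinear.

(* By Jordan-Hoelder the factors do not depend on the composition series s,
   up to isomorphism and reordering. *)
Definition pseudo_solvable (hT : finGroupType) (S : {group hT})
    (gT : finGroupType) (G : {group gT}) :=
  forall s : seq {group gT}, comps G s ->
    all (fun K : section gT => abelian K || (K \isog S))
        (pairmap (@mkSec gT) G s).

(* Main.v *)
(* Write p ~ q if the primes p and q are distinct and not adjacent in the prime
   graph.

   In a solvable group, p ~ q is oriented according to which of the two primes
   acts on a Sylow subgroup for the other one. This Frobenius digraph has neither
   a walk of length 3 nor a transitive triangle, so that the maximal length of a
   walk starting at p is a proper 3-coloring, and ~ is triangle-free. A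
   nonsolvable G contains K with the same primes such that K / N = PSL(2,17) for
   a solvable N. The Frobenius digraph of N orients ~ on the primes of K other
   than 2, 3 and 17. If P is a Sylow p-subgroup of N and t ~ p acts on P in N,
   then t ~ q for no q in {2, 3, 17}: hence a prime outside {2, 3, 17} related to
   2, 3 or 17 has no outgoing arrow in N. Moreover p ~ 2 excludes 2 ~ 3 and
   2 ~ 17 because a Klein four-group does not act fixed point freely, and p ~ 3
   is excluded if {2, 3, 17} is a triangle, because PSL(2,17) is generated by two
   elements of order 3.

   Conversely, two color classes of the complement are realized by a metacyclic
   group H of squarefree order, in which a acts nontrivially on b if and only if
   a ~ b is wanted; in the second case take H x PSL(2,17), with 2, 3, 17 for the
   vertices of the triangle. For every vertex of the third color, a new prime r
   is added by means of a module over F_r on which the elements of prime order p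
   have no fixed point exactly for the wanted p ~ r. For PSL(2,17) such modules
   exist for the empty set and for {17}; they consist of functions on the
   group. *)

Require Import Defs.
From mathcomp Require Import all_boot all_order all_algebra all_fingroup all_solvable all_field all_character.
From mathcomp Require Import ring.

Set Implicit Arguments.
Unset Strict Implicit.
Unset Printing Implicit Defensive.

Import GroupScope.

(** * Non-adjacent primes *)

(** The relation ~ can only grow when [G] is replaced by a subgroup with the same primes, so a
    coloring and a list of triangles for [K] serve for [G]; this is what permits shrinking the
    unwanted chief factors. The common color of the neighbors of [c] comes from the walk coloring:
    an outside prime related to 2, 3 or 17 has no outgoing arrow, hence color 0. Two colors then
    remain for 2, 3, 17, which suffice unless these form a triangle; in that case 3 can take color
    0, having no outside neighbor. The exclusion of p ~ 3 is a trace argument: fixed point free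
    elements of order 3 satisfy 1 + A + A^2 = 0 on an abelian group, so the trace of a product of
    two of them commutes with both; an element of order 17 conjugate to its square then has the same
    trace as its square, and acts trivially. On the constructive side, fixed point freeness is a
    linear condition on functions, so one nonzero function satisfying it yields a module. For
    PSL(2,17), invariance under the isometries of a binary quadratic form leaves a function of one
    variable in F, and the condition at 17 becomes fewer equations than unknowns. *)

Definition nadj (gT : finGroupType) (G : {set gT}) (p q : nat) :=
  [forall g in G, #[g] != (p * q)%N].

Section NonAdjacency.

Variable gT : finGroupType.
Implicit Types (G H K N P Q V : {group gT}) (p q r : nat).

Lemma nadjPn G p q :
  reflect (exists2 g, g \in G & #[g] = (p * q)%N) (~~ nadj G p q).
Proof.
rewrite negb_forall_in; apply: (iffP exists_inP) => [] [g Gg];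
  by [rewrite negbK => /eqP; exists g | exists g; rewrite // negbK; apply/eqP].
Qed.

Lemma nadjC G p q : nadj G p q = nadj G q p.
Proof. by rewrite /nadj mulnC. Qed.

Lemma nadjS G H p q : H \subset G -> nadj G p q -> nadj H p q.
Proof.
by move=> sHG /forall_inP nG; apply/forall_inP=> x /(subsetP sHG)/nG.
Qed.

Lemma exists_order_pow (x : gT) m : m %| #[x] -> exists k, #[x ^+ k] = m.
Proof.
case/dvdnP=> d ox; exists d.
rewrite orderXdiv ox ?dvdn_mulr // mulKn // lt0n.
by apply: contraTneq (order_gt0 x) => d0; rewrite ox d0.
Qed.

Lemma p_elt_order_pow p (x : gT) : prime p -> p.-elt x -> x != 1 ->
  exists k, #[x ^+ k] = p.
Proof.
move=> pr_p px ntx; apply: exists_order_pow.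
have /pgroup_pdiv[] // : p.-group <[x]> by [].
by rewrite cycle_eq1.
Qed.

Lemma order_p_elt p (x : gT) : prime p -> #[x] = p -> p.-elt x.
Proof. by move=> pr_p ox; rewrite /p_elt ox pnat_id. Qed.

Lemma order_prime_neq1 p (x : gT) : prime p -> #[x] = p -> x != 1.
Proof. by move=> pr_p ox; rewrite -order_gt1 ox prime_gt1. Qed.

(** Suitable powers of [x] and [y] have orders [p] and [q] and commute, so their product would have
    order [p * q]. *)
Lemma nadj_comm G p q x y : prime p -> prime q -> p != q -> nadj G p q ->
  x \in G -> y \in G -> p.-elt x -> q.-elt y -> commute x y -> x != 1 ->
  y = 1.
Proof.
move=> pr_p pr_q neq_pq nG Gx Gy px qy cxy ntx.
apply: contraTeq nG => nty; apply/nadjPn.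
have [k ok] := p_elt_order_pow pr_p px ntx.
have [l ol] := p_elt_order_pow pr_q qy nty.
exists (x ^+ k * y ^+ l); first by rewrite groupM ?groupX.
rewrite orderM ?ok ?ol ?prime_coprime ?dvdn_prime2 //.
exact/commuteX2.
Qed.

Lemma nadj_TIcent1 G Q p q x : prime p -> prime q -> p != q -> nadj G p q ->
  x \in G -> Q \subset G -> p.-elt x -> q.-group Q -> x != 1 -> 'C_Q[x] = 1.
Proof.
move=> pr_p pr_q neq_pq nG Gx sQG px qQ ntx; apply/trivgP/subsetP=> y.
case/setIP=> Qy /cent1P cxy; apply/set1P.
apply: (nadj_comm pr_p pr_q neq_pq nG Gx (subsetP sQG y Qy)) => //.
exact: mem_p_elt Qy.
Qed.

Lemma nadj_cent G P Q p q : prime p -> prime q -> p != q -> nadj G p q ->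
  P \subset G -> Q \subset G -> p.-group P -> q.-group Q ->
  P \subset 'C(Q) -> P :!=: 1 -> Q :=: 1.
Proof.
move=> pr_p pr_q neq_pq nG sPG sQG pP qQ cPQ /trivgPn[x Px ntx].
have /setIidPl <- : Q \subset 'C[x] by rewrite sub_cent1 (subsetP cPQ).
apply: (nadj_TIcent1 pr_p pr_q neq_pq nG) => //; first exact: (subsetP sPG).
exact: mem_p_elt Px.
Qed.

End NonAdjacency.

(** If [f x] has order [p * q], then [p * q] divides the order of [x], and a power of [x] has order
    [p * q]. *)
Lemma nadj_morphim (aT rT : finGroupType) (D G : {group aT})
    (f : {morphism D >-> rT}) p q :
  G \subset D -> nadj G p q -> nadj (f @* G) p q.
Proof.
move=> sGD; apply: contraTT => /nadjPn[_ /morphimP[x Dx Gx ->] ofx].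
have: (p * q %| #[x])%N by rewrite -ofx morph_order.
by case/exists_order_pow=> k ok; apply/nadjPn; exists (x ^+ k); rewrite ?groupX.
Qed.

Lemma nadj_quotient (gT : finGroupType) (G N : {group gT}) p q :
  G \subset 'N(N) -> nadj G p q -> nadj (G / N) p q.
Proof. exact: nadj_morphim. Qed.

(** * Coprime and fixed point free actions *)

Section CoprimeActions.

Import FiniteModule.

Variable gT : finGroupType.
Implicit Types (A G H K N P Q V E S D : {group gT}) (p q r t : nat).

(* If the abelian group E acts without fixed points on S, a minimal
   E-invariant subgroup of S is a faithful irreducible module, so Schur's
   lemma makes E cyclic. *)
Lemma abelian_fpf_cyclic E S q : q.-group S -> S :!=: 1 ->
  abelian E -> E \subset 'N(S) ->
  (forall e, e \in E -> e != 1 -> 'C_S[e] = 1) -> cyclic E.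
Proof.
move=> qS ntS abE nSE fpf.
have [M minM sMS] := minnormal_exists ntS nSE.
have [nME ntM abM] := minnormal_solvable minM sMS (pgroup_sol qS).
have qM : q.-group M := pgroupS sMS qS.
have [pr_q _ _] := pgroup_pdiv qM ntM.
have {}abM : q.-abelem M.
  case/is_abelemP: abM => r pr_r abM; suff -> : q = r by [].
  have [_ qdM _] := pgroup_pdiv qM ntM.
  by apply/eqP; move/abelem_pgroup/pgroupP: abM => /(_ q pr_q qdM).
have irrM := abelem_mx_irrP abM ntM nME minM.
apply: (mx_faithful_irr_abelian_cyclic (rG := abelem_repr abM ntM nME)) => //.
rewrite /mx_faithful rker_abelem; apply/subsetP=> e /setIP[Ee cMe].
rewrite inE; apply: contraR (ntM) => nte.
rewrite -subG1 -(fpf e Ee nte) subsetI sMS.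
by apply/subsetP=> y My; apply/cent1P/commute_sym; apply: (centP cMe).
Qed.

Lemma nadj_abelian_cyclic G E S t q : prime t -> prime q -> t != q ->
  nadj G t q -> E \subset G -> S \subset G -> t.-group E -> q.-group S ->
  S :!=: 1 -> E \subset 'N(S) -> abelian E -> cyclic E.
Proof.
move=> pr_t pr_q neq nG sEG sSG tE qS ntS nSE abE.
apply: (abelian_fpf_cyclic qS ntS abE nSE) => e Ee nte.
by apply: (nadj_TIcent1 pr_t pr_q neq nG) => //; [apply: (subsetP sEG) | apply: mem_p_elt Ee].
Qed.

(** Applying [y] permutes the summands cyclically, so the sum is a fixed point of [y]. *)
Lemma actr_cycle_sum0 V (abV : abelian V) y q (v : fmod_of abV) : 0 < q ->
  y ^+ q = 1 -> y \in 'N(V) -> 'C_V[y] = 1 ->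
  (\sum_(i < q) v ^@ (y ^+ i) = 0)%R.
Proof.
move=> q0 yq nVy fpfy; set u := (\sum_(i < q) _)%R.
have fixu : (u ^@ y = u)%R.
  rewrite actr_sum /u; case: q q0 yq {u} => // n _ yq.
  rewrite big_ord_recr big_ord_recl /= GRing.addrC.
  rewrite -actrM ?groupX // -expgSr yq expg0; congr (_ + _)%R.
  by apply: eq_bigr => i _; rewrite -actrM ?groupX // -expgSr.
apply: val_inj; apply/set1gP; rewrite /= -fpfy inE fmodP.
by apply/cent1P/commgP/conjg_fixP; rewrite -fmvalJ // fixu.
Qed.

(* The sum of the translates of v over a subgroup acting without fixed points
   vanishes. Summing this over all conjugates of <x> in K<x> expresses |K| v
   as minus a sum of traces over K. *)
Lemma frobenius_cent_abelian V K x q : prime q -> x ^+ q = 1 -> abelian V ->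
  K \subset 'N(V) -> x \in 'N(V) -> x \in 'N(K) -> 'C_K[x] = 1 ->
  'C_V[x] = 1 -> coprime #|V| #|K| -> K \subset 'C(V).
Proof.
move=> pr_q xq abV nVK nVx nKx fpfK fpfV coVK.
pose fm := fmod_of abV.
have nVxi i : x ^+ i \in 'N(V) by rewrite groupX.
have fpfi (i : 'I_q) : i != 0%N :> nat -> 'C_K[x ^+ i] = 1.
  move=> nzi; apply/trivgP; rewrite -fpfK setIS //.
  have coqi : coprime #[x] i.
    apply: (@coprime_dvdl _ q); first by rewrite order_dvdn xq.
    by rewrite prime_coprime // gtnNdvd ?lt0n.
  apply/subsetP=> k /cent1P cxk; apply/cent1P.
  rewrite -(expgK coqi (cycle_id x)); exact/commuteX.
have keyE (v : fm) : (v *+ #|K| = - \sum_(i < q | i != 0%N :> nat)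
    \sum_(k in K) v ^@ (x ^+ i) ^@ k)%R.
  apply/eqP; rewrite -GRing.addr_eq0; apply/eqP.
  transitivity (\sum_(k in K) \sum_(i < q) v ^@ ((x ^ k) ^+ i))%R; last first.
    apply: big1 => k Kk; apply: actr_cycle_sum0; first exact: prime_gt0.
    - by rewrite -conjXg xq conj1g.
    - by rewrite memJ_norm // (subsetP (normG _)) // (subsetP nVK).
    have /normP {1}<- := subsetP nVK k Kk.
      by rewrite cent1J -conjIg fpfV conjs1g.
  rewrite [RHS]exchange_big /= [RHS](bigID [pred i : 'I_q | val i == 0%N]) /=.
  congr (_ + _)%R.
    have q0 : 0 < q by apply: prime_gt0.
    rewrite (big_pred1 (Ordinal q0)) => [|i] //.
    by rewrite (eq_bigr (fun _ => v)) ?GRing.sumr_const // => k _; rewrite expg0 actr1.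
  apply: eq_bigr => i nzi.
  (* [(x ^ k) ^+ i] equals [x ^+ i * h k], and [h] permutes [K] because [x ^+ i] has no fixed point
     there; so the sum over [k] becomes a sum of translates over all of [K]. *)
  pose h k := [~ x ^+ i, k].
  have hK : {in K, forall k, h k \in K}.
    move=> k Kk; rewrite /h commgEr groupM // memJ_norm ?groupV //.
    by rewrite groupX.
  have injh : {in K &, injective h}.
    move=> k l Kk Kl; rewrite /h /commg => /mulgI eqc.
    apply/eqP; rewrite eq_mulgV1; apply/eqP/set1gP.
    rewrite -(fpfi i nzi) inE groupM ?groupV //=.
    by apply/cent1P/commute_sym/commgP/conjg_fixP; rewrite conjgM eqc conjgK.
  have imh : h @: K = K.
    apply/eqP; rewrite eqEcard card_in_imset // leqnn andbT.
    by apply/subsetP=> _ /imsetP[k Kk ->]; apply: hK.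
  rewrite -[in LHS]imh big_imset //=; apply: eq_bigr => k Kk.
  rewrite -actrM // ?(subsetP nVK) ?hK //.
  by rewrite -conjXg /h commgEl mulKVg.
apply/subsetP=> k Kk; apply/centP=> y Vy; apply/commgP.
have nVk := subsetP nVK k Kk.
(* The right-hand side of [keyE] is built from sums over [K], hence is fixed by [k]. As [#|K|] is
   prime to [#|V|], each element of [V] is a power of its [#|K|]-th power. *)
have fixN : ((fmod abV y *+ #|K|) ^@ k = fmod abV y *+ #|K|)%R.
  rewrite keyE actNr actr_sum; congr (- _)%R; apply: eq_bigr => i _.
  rewrite actr_sum [RHS](reindex_inj (mulIg k)) /=.
  apply: eq_big => [l | l Kl]; first by rewrite groupMr.
  by rewrite actrM // (subsetP nVK).
have {}fixN : (y ^+ #|K|) ^ k = y ^+ #|K|.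
  by have := congr1 val fixN; rewrite fmvalJ // !fmvalZ fmodK.
apply/commgP/commute_sym/commgP/conjg_fixP.
by rewrite -{1}(expgK coVK Vy) conjXg fixN (expgK coVK Vy).
Qed.

End CoprimeActions.

Section FrobeniusAction.

Variable gT : finGroupType.
Implicit Types (A G H K N P Q V E S D : {group gT}) (p q r t : nat).

(** By coprimality ['C_P(A)] maps onto the fixed points in [P / 'Phi(P)], here everything. So
    ['C_P(A)] and ['Phi(P)] generate [P], and the Frattini subgroup consists of non-generators. *)
Lemma coprime_cent_Phi P A p : p.-group P -> coprime #|P| #|A| ->
  A \subset 'N(P) -> A / 'Phi(P) \subset 'C(P / 'Phi(P)) -> A \subset 'C(P).
Proof.
move=> pP coPA nPA cAPhi; have solP := pgroup_sol pP.
have nPhiA : A \subset 'N('Phi(P)) := char_norm_trans (Phi_char P) nPA.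
have defC : 'C_P(A) / 'Phi(P) = P / 'Phi(P).
  rewrite coprime_quotient_cent ?Phi_sub //; apply/setIidPl.
  by rewrite centsC.
rewrite centsC; apply/setIidPl/eqP; rewrite eqEsubset subsetIl /=.
rewrite -{1}(Phi_nongen (X := 'C_P(A)) (G := P)) ?genGid //.
have sP : P \subset 'Phi(P) * 'C_P(A).
  by rewrite -quotientSK ?normal_norm ?Phi_normal // defC.
apply/eqP; rewrite eqEsubset join_subG Phi_sub subsetIl /=.
by rewrite (subset_trans sP) // mul_subG ?joing_subl ?joing_subr.
Qed.

(** Reduction to the abelian group [P / 'Phi(P)]. Coprimality lifts fixed points from the quotient
    to [P]; if [k] in [K] commutes with [x] modulo ['Phi(P)], their commutator lies in
    [K :&: 'Phi(P) = 1]. *)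
Lemma frobenius_cent_pgroup P K x p q : prime q -> x ^+ q = 1 -> p.-group P ->
  K \subset 'N(P) -> x \in 'N(P) -> x \in 'N(K) -> 'C_K[x] = 1 ->
  'C_P[x] = 1 -> coprime #|P| #|K| -> coprime #|P| #[x] -> K \subset 'C(P).
Proof.
move=> pr_q xq pP nPK nPx nKx fpfK fpfP coPK coPx.
apply: (coprime_cent_Phi pP coPK nPK).
have chPhi := char_norm_trans (Phi_char P).
have nPhiK := chPhi _ nPK; have nPhix : x \in 'N('Phi(P)).
  by rewrite -cycle_subG chPhi ?cycle_subG.
have tiKPhi : K :&: 'Phi(P) = 1.
  by rewrite setIC coprime_TIg // (coprimeSg (Phi_sub P)).
apply: (@frobenius_cent_abelian _ (P / 'Phi(P)) (K / 'Phi(P)) (coset 'Phi(P) x) q pr_q).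
- by rewrite -morphX // xq morph1.
- exact: abelem_abelian (Phi_quotient_abelem pP).
- exact: quotient_norms.
- by rewrite -cycle_subG -quotient_cycle // quotient_norms ?cycle_subG.
- by rewrite -cycle_subG -quotient_cycle // quotient_norms ?cycle_subG.
- apply/trivgP/subsetP=> _ /setIP[/morphimP[k nk Kk ->] /cent1P cxk].
  suffices /set1gP -> : k \in [1 gT] by rewrite morph1 set11.
  rewrite -fpfK inE Kk; apply/cent1P/commute_sym/commgP/eqP/set1gP.
  rewrite -tiKPhi inE; apply/andP; split.
    by rewrite commgEr groupM // memJ_norm ?groupV.
  apply: coset_idr; rewrite ?groupR // morphR //; apply/eqP/commgP.
  exact: commute_sym.
- rewrite -cent_cycle -quotient_cycle // -coprime_quotient_cent ?Phi_sub //.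
  + by rewrite cent_cycle fpfP quotient1.
  + by rewrite cycle_subG.
  + exact: pgroup_sol pP.
by rewrite coprime_morphl // coprime_morphr.
Qed.

End FrobeniusAction.

(** The action of [G] on [Z] has abelian image, since a cyclic group has an abelian automorphism
    group. *)
Lemma der1_sub_cent_cyclic (gT : finGroupType) (G Z : {group gT}) :
  cyclic Z -> G \subset 'N(Z) -> G^`(1) \subset 'C(Z).
Proof.
move=> cycZ nZG; rewrite -ker_conj_aut.
have abA : abelian (conj_aut Z @* G).
  exact: abelianS (Aut_conj_aut Z G) (Aut_cyclic_abelian cycZ).
rewrite kerE -sub_morphim_pre ?(subset_trans (der_sub 1 G)) //.
by rewrite morphim_der // subG1; apply/eqP/derG1P.
Qed.

Section Rank1.

Variable gT : finGroupType.
Implicit Types (A G H K N P Q V E S D X : {group gT}) (p q r t : nat).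

(** For odd [t], a [t]-group of rank one is cyclic. For [t = 2], where quaternion groups would
    interfere, the cyclic centre of a nontrivial [D] has a single involution; [z] fixes it, against
    [nadj G r t]. *)
Lemma rank1_cyclic G D r t z : prime t -> prime r -> r != t -> D \subset G ->
  t.-group D -> (forall E, E \subset D -> abelian E -> cyclic E) ->
  z \in G -> r.-elt z -> z != 1 -> z \in 'N(D) -> nadj G r t -> cyclic D.
Proof.
move=> pr_t pr_r neq_rt sDG tD rk1 Gz rz ntz nDz nG.
have [-> | ntD] := eqVneq (D : {set gT}) 1; first exact: cyclic1.
have odd_t : odd t.
  case: (even_prime pr_t) => // t2.
  have ntZ : 'Z(D) != 1 by rewrite center_nil_eq1 // (pgroup_nil tD).
  have tZ : t.-group 'Z(D) := pgroupS (center_sub D) tD.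
  have cycZ : cyclic 'Z(D) by rewrite rk1 ?center_sub ?center_abelian.
  have oW := Ohm1_cyclic_pgroup_prime cycZ tZ ntZ.
  set W := 'Ohm_1('Z(D)) in oW.
  have ntW : W != 1 by rewrite -cardG_gt1 oW t2.
  have [w Ww ntw] := trivgPn _ ntW.
  have nWz : z \in 'N(W).
    have := char_norm_trans (char_trans (Ohm_char 1 'Z(D)) (center_char D)).
    by move/(_ <[z]>); rewrite !cycle_subG; apply.
  have defW : W :=: [set 1; w].
    apply/eqP; rewrite eq_sym eqEcard oW t2 cards2 eq_sym ntw /= andbT.
    by apply/subsetP=> u /set2P[] ->.
  have wz : w ^ z = w.
    have : w ^ z \in W by rewrite memJ_norm.
    by rewrite defW !inE conjg_eq1 (negPf ntw) => /eqP.
  have Dw : w \in D by rewrite (subsetP (center_sub D)) // (subsetP (Ohm_sub 1 _)).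
  case/eqP: ntw; apply: (nadj_comm pr_r pr_t neq_rt nG Gz) => //.
  - exact: (subsetP sDG).
  - exact: mem_p_elt Dw.
  - by apply/commute_sym/commgP/conjg_fixP.
rewrite (odd_pgroup_rank1_cyclic tD); last first.
  by case: (pgroup_pdiv tD ntD) => _ _ [m ->]; rewrite oddX odd_t orbT.
have [E /pnElemP[sED abE <-]] := p_rank_witness t D.
by rewrite -(abelem_cyclic abE) rk1 ?abelem_abelian // (abelem_abelian abE).
Qed.

(** [E] is isomorphic to a Sylow [t]-subgroup of its preimage, because [A] is a [q]-group; this
    Sylow subgroup acts on [A] without fixed points. *)
Lemma abelian_quotient_cyclic G A (E : {group coset_of A}) t q : prime t ->
  prime q -> t != q -> nadj G t q -> A <| G -> q.-group A -> A :!=: 1 ->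
  E \subset G / A -> t.-group E -> abelian E -> cyclic E.
Proof.
move=> pr_t pr_q neq nG /andP[sAG nAG] qA ntA sEG tE abE.
pose X := (coset A @*^-1 E)%G.
have sXG : X \subset G by rewrite sub_cosetpre_quo // /normal sAG.
have nAX : X \subset 'N(A) := subset_trans sXG nAG.
have [E1 sylE1] := Sylow_exists t X.
have [sE1X tE1 _] := and3P sylE1.
have defE : E1 / A = E.
  have : t.-Sylow(X / A) (E1 / A) by rewrite quotient_pHall // (subset_trans sE1X).
  by rewrite cosetpreK => /pHall_id; apply.
have nAE1 : E1 \subset 'N(A) := subset_trans sE1X nAX.
have tiAE1 : A :&: E1 = 1.
  by rewrite coprime_TIg // (pnat_coprime qA) // (pi_pnat tE1) // inE.
have isoE := quotient_isog nAE1 tiAE1.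
rewrite -defE quotient_cyclic //.
apply: (nadj_abelian_cyclic pr_t pr_q neq nG _ sAG tE1 qA ntA nAE1).
  exact: subset_trans sXG.
by rewrite (isog_abelian isoE) /= defE.
Qed.

End Rank1.

(** * The Frobenius digraph of a solvable group *)

Section FrobeniusDigraph.

Variable gT : finGroupType.
Implicit Types (A G H K N P Q R V E S D X Y : {group gT}) (p q r s t : nat).

(* For a solvable G, p --> q means that the Hall {p,q}-subgroup is Frobenius or
   2-Frobenius and some p-elements act without fixed points on a Sylow
   q-subgroup. *)
Definition arrow (G : {set gT}) p q :=
  [&& prime p, prime q, p != q, nadj G p q
    & [exists Q : {group gT}, [&& q.-Sylow(G) Q, Q :!=: 1 & p %| #|'N_G(Q)|]]].

Lemma arrowP G p q : arrow G p q ->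
  [/\ prime p, prime q, p != q, nadj G p q & forall Q, q.-Sylow(G) Q ->
    Q :!=: 1 /\ exists y, [/\ y \in G, y \in 'N(Q) & #[y] = p]].
Proof.
case/and5P=> pr_p pr_q neq nG /existsP[Q1 /and3P[sylQ1 ntQ1 pN]].
split=> // Q sylQ; have [x Gx ->] := Sylow_trans sylQ1 sylQ.
split; first by rewrite -cardG_gt1 cardJg cardG_gt1.
have [y /setIP[Gy nQy] oy] := Cauchy pr_p pN.
by exists (y ^ x); rewrite groupJ // normJ memJ_conjg nQy orderJ.
Qed.

Lemma arrowI G Q p q y : prime p -> prime q -> p != q -> nadj G p q ->
  q.-Sylow(G) Q -> Q :!=: 1 -> y \in G -> y \in 'N(Q) -> #[y] = p ->
  arrow G p q.
Proof.
move=> pr_p pr_q neq nG sylQ ntQ Gy nQy oy.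
apply/and5P; split=> //; apply/existsP; exists Q; rewrite sylQ ntQ /=.
by rewrite -oy order_dvdG // inE Gy.
Qed.

(** By Hall's theorem the [pi]-group [Q <*> <[y]>] has a conjugate inside [H]. *)
Lemma arrow_Hall G H (pi : nat_pred) p q : solvable G -> pi.-Hall(G) H ->
  p \in pi -> q \in pi -> arrow G p q -> arrow H p q.
Proof.
move=> solG hallH pi_p pi_q /arrowP[pr_p pr_q neq nG arr].
have [Q sylQ] := Sylow_exists q G; have [ntQ [y [Gy nQy oy]]] := arr Q sylQ.
have [sHG _ _] := and3P hallH; have [sQG qQ _] := and3P sylQ.
have piQy : pi.-group (Q <*> <[y]>).
  rewrite norm_joinEr ?cycle_subG // pgroupM (pi_pgroup qQ) //=.
  by rewrite (pi_pgroup (order_p_elt pr_p oy)).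
have [|x Gx] := Hall_Jsub solG hallH _ piQy.
  by rewrite join_subG sQG cycle_subG.
rewrite conjYg -cycleJ join_subG cycle_subG => /andP[sQxH Hyx].
apply: (@arrowI H (Q :^ x)%G p q (y ^ x)) => //; first exact: nadjS nG.
- by apply: (pHall_subl sQxH sHG); rewrite pHallJ.
- by rewrite -cardG_gt1 cardJg cardG_gt1.
- by rewrite normJ memJ_conjg.
by rewrite orderJ.
Qed.

Lemma Hall_arrow G H (pi : nat_pred) p q : pi.-Hall(G) H -> q \in pi ->
  nadj G p q -> arrow H p q -> arrow G p q.
Proof.
move=> hallH pi_q nG /arrowP[pr_p pr_q neq _ arr].
have [Q sylQ] := Sylow_exists q H; have [ntQ [y [Hy nQy oy]]] := arr Q sylQ.
have [sHG _ _] := and3P hallH.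
apply: (@arrowI G Q p q y) => //; last exact: (subsetP sHG).
exact: subHall_Sylow hallH pi_q sylQ.
Qed.

Lemma Fitting_pcore_neq1 (hT : finGroupType) (G : {group hT}) : solvable G ->
  G :!=: 1 -> exists2 t, t \in \pi(G) & 'O_t(G) != 1.
Proof.
move=> solG ntG; have ntF : 'F(G) != 1 by rewrite trivg_Fitting.
have pr_t : prime (pdiv #|'F(G)|) by rewrite pdiv_prime ?cardG_gt1.
have tF := pdiv_dvd #|'F(G)|; set t := pdiv _ in pr_t tF.
exists t.
  by rewrite mem_primes pr_t cardG_gt0 (dvdn_trans tF) ?cardSg ?Fitting_sub.
rewrite -p_core_Fitting; apply: contraTneq tF => O1.
have := nilpotent_pcore_Hall t (Fitting_nil G).
by rewrite O1 /pHall sub1G pgroup1 indexg1 -p'natE.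
Qed.

(** Otherwise a minimal normal subgroup of [G / Z] inside [C / Z], where [Z = C :&: 'F(G)], lifts to
    a normal subgroup [D] of [G] inside [C]. Its derived subgroup lies in [Z], which is central in
    [C], so [D] is nilpotent and contained in ['F(G)], hence in [Z]. *)
Lemma cent_sub_Fitting (hT : finGroupType) (G : {group hT}) : solvable G ->
  'C_G('F(G)) \subset 'F(G).
Proof.
move=> solG; pose C := 'C_G('F(G))%G; pose Z := (C :&: 'F(G))%G.
have nsCG : C <| G.
  by rewrite /normal subsetIl normsI ?normG ?norms_cent ?gFnorm.
have nsZG : Z <| G by rewrite normalI ?Fitting_normal.
apply: contraT => nsCF.
have ntCZ : (C / Z)%G :!=: 1.
  apply: contraNneq nsCF; rewrite /= -/C => /trivgP; rewrite quotient_sub1.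
    by move/subset_trans; apply; apply: subsetIr.
  by rewrite (subset_trans (normal_sub nsCG)) ?normal_norm.
have nZG := quotient_normal Z nsCG.
have [M minM sMC] := minnormal_exists ntCZ (normal_norm nZG).
have solC : solvable (C / Z) by rewrite quotient_sol ?(solvableS (subsetIl _ _)).
have [nMG ntM abM] := minnormal_solvable minM sMC solC.
have sMG : M \subset G / Z := subset_trans sMC (normal_sub nZG).
pose D := (coset Z @*^-1 M)%G.
have nsDG : D <| G.
  by rewrite -(quotientGK nsZG) cosetpre_normal /normal sMG.
have sZC : Z \subset C by apply: subsetIl.
have sDC : D \subset C.
  by rewrite -(quotientGK (normalS sZC (normal_sub nsCG) nsZG)) morphpreS.
have nZD : D \subset 'N(Z) by rewrite (subset_trans (normal_sub nsDG)) ?normal_norm.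
have sD'Z : [~: D, D] \subset Z.
  rewrite -derg1 der1_min // cosetpreK.
  by case/is_abelemP: abM => q _ /abelem_abelian.
have nilD : nilpotent D.
  apply/lcnP; exists 2; rewrite (lcnSn 1) (lcnSn 0) lcn1; apply/commG1P.
  rewrite (subset_trans sD'Z) // (subset_trans (subsetIr C 'F(G))) // centsC.
  by rewrite (subset_trans sDC) // subsetIr.
case/negP: ntM; rewrite -subG1 -(cosetpreK M) quotient_sub1 //.
by rewrite subsetI sDC Fitting_max.
Qed.

Lemma Fitting_eq_pcore_pi (hT : finGroupType) (G : {group hT}) p :
  solvable G -> (forall t, t \in \pi(G) -> t != p -> 'O_t(G) = 1) ->
  'C_G('O_p(G)) \subset 'O_p(G).
Proof.
move=> solG triv; suffices <- : 'F(G) = 'O_p(G) by apply: cent_sub_Fitting.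
apply/eqP; rewrite eqEsubset -{2}p_core_Fitting pcore_sub andbT FittingEgen.
rewrite gen_subG; apply/bigcupsP=> t pi_t.
by have [-> // | neq] := eqVneq (t : nat) p; rewrite triv ?sub1G.
Qed.

Lemma pcore_quotient_Sylow X p q : solvable X -> {subset \pi(X) <= pred2 p q} ->
  prime p -> prime q -> p != q -> nadj X p q -> 'O_q(X) != 1 ->
  ~~ q.-Sylow(X) 'O_q(X) -> p.-Sylow(X / 'O_q(X)) 'O_p(X / 'O_q(X)).
Proof.
move=> solX piX pr_p pr_q neq nX ntA nsylA.
set A := 'O_q(X) in ntA nsylA *; pose Y := (X / A)%G; pose Pb := 'O_p(Y)%G.
have qA : q.-group A := pcore_pgroup q X; have nsAX : A <| X := pcore_normal q X.
have solY : solvable Y := quotient_sol A solX.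
have Oq1 : 'O_q(Y) = 1 := trivg_pcore_quotient q X.
have sCP : 'C_Y(Pb) \subset Pb.
  apply: Fitting_eq_pcore_pi => // t tY neq_t.
  have /piX/pred2P[] : t \in \pi(X).
    move: tY; rewrite !mem_primes !cardG_gt0 /= => /andP[-> /dvdn_trans-> //].
    exact: dvdn_quotient.
    by move=> tp; rewrite tp eqxx in neq_t.
  by move->.
have nY : nadj Y p q by rewrite nadj_quotient ?normal_norm.
have qY : q %| #|Y|.
  apply: contraR nsylA => qY.
  by rewrite /pHall normal_sub // qA -card_quotient ?normal_norm // p'natE.
have [z Yz oz] := Cauchy pr_q qY.
have cycPb : cyclic Pb.
  apply: (@rank1_cyclic _ Y Pb q p z) => //.
  - by rewrite eq_sym.
  - exact: pcore_sub.
  - exact: pcore_pgroup.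
  - move=> E sE; apply: (@abelian_quotient_cyclic _ X [group of A] E p q) => //.
      by rewrite (subset_trans sE) ?pcore_sub.
    exact: pgroupS (pcore_pgroup p Y).
  - exact: order_p_elt.
  - exact: order_prime_neq1 oz.
  - exact: (subsetP (normal_norm (pcore_normal p Y))).
  by rewrite nadjC.
have sY'P : Y^`(1) \subset Pb.
  rewrite (subset_trans _ sCP) // subsetI der_sub der1_sub_cent_cyclic //.
  exact: gFnorm.
have [P1 sylP1] := Sylow_exists p Y.
have sPP1 : Pb \subset P1 := pcore_sub_Hall sylP1.
have nsP1 : P1 <| Y.
  by rewrite sub_der1_normal ?(pHall_sub sylP1) // (subset_trans sY'P).
by rewrite (normal_Hall_pcore sylP1 nsP1).
Qed.

Lemma TI_comm_normal (hT : finGroupType) (A B : {group hT}) x p q :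
  p != q -> x \in A -> x \in 'N(B) -> B \subset 'N(A) ->
  p.-group A -> q.-group B -> B \subset 'C[x].
Proof.
move=> neq Ax nBx nAB pA qB.
have tiAB : A :&: B = 1.
  by rewrite coprime_TIg // (pnat_coprime pA) // (pi_pnat qB) // !inE eq_sym.
apply/subsetP=> y By; apply/cent1P/commute_sym/commgP/eqP/set1gP.
rewrite -tiAB inE; apply/andP; split.
  by rewrite commgEl groupM ?groupV // memJ_norm // (subsetP nAB).
by rewrite commgEr groupM // memJ_norm ?groupV.
Qed.

(* The Hall {p,q}-subgroups of G are Frobenius or 2-Frobenius groups. *)
Lemma arrow_total_half X p q : solvable X -> {subset \pi(X) <= pred2 p q} ->
  p \in \pi(X) -> q \in \pi(X) -> p != q -> nadj X p q -> 'O_q(X) != 1 ->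
  arrow X p q || arrow X q p.
Proof.
move=> solX piX pX qX neq nX ntA.
have [pr_p p_dv] : prime p /\ p %| #|X| by move: pX; rewrite mem_primes => /and3P[].
have [pr_q q_dv] : prime q /\ q %| #|X| by move: qX; rewrite mem_primes => /and3P[].
have nsAX := pcore_normal q X.
have [sylA | nsylA] := boolP (q.-Sylow(X) 'O_q(X)).
  have [y Xy oy] := Cauchy pr_p p_dv; apply/orP; left.
  apply: (arrowI pr_p pr_q neq nX sylA ntA Xy _ oy).
  exact: (subsetP (normal_norm nsAX)).
have sylPb := pcore_quotient_Sylow solX piX pr_p pr_q neq nX ntA nsylA.
have [P sylP] := Sylow_exists p X.
have ntP : P :!=: 1.
  by rewrite -cardG_gt1 (card_Hall sylP) p_part_gt1.
have nAP : P \subset 'N('O_q(X)) := subset_trans (pHall_sub sylP) (normal_norm nsAX).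
have defP : P / 'O_q(X) = 'O_p(X / 'O_q(X)).
  have sylPq := quotient_pHall nAP sylP.
  apply/eqP; rewrite eqEcard (card_Hall sylPq) (card_Hall sylPb) leqnn andbT.
  rewrite (sub_normal_Hall sylPb) ?pcore_normal ?quotientS ?(pHall_sub sylP) //.
  exact: pHall_pgroup sylPq.
have nsAPX : 'O_q(X) <*> P <| X.
  rewrite norm_joinEr // -quotientK // defP.
  by have := pcore_normal p (X / 'O_q(X)); rewrite -cosetpre_normal quotientGK.
have sylP' : p.-Sylow('O_q(X) <*> P) P.
  by apply: pHall_subl sylP; rewrite ?joing_subr ?normal_sub.
have frat := Frattini_arg nsAPX sylP'.
(* By the Frattini argument ['N_X(P)] covers [X / 'O_q(X)], whose order is still divisible by [q];
   so [q] acts on [P], which gives the arrow from [q] to [p]. *)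
have qN : q %| #|'N_X(P)|.
  have defX : 'N_X(P) / 'O_q(X) = X / 'O_q(X).
    apply/eqP; rewrite eqEsubset quotientS ?subsetIl //=.
    rewrite quotientSK ?normal_norm // -{1}frat /= norm_joinEr // -mulgA.
    by rewrite mulgS // mulSGid // subsetI (pHall_sub sylP) normG.
  apply: dvdn_trans (dvdn_quotient _ 'O_q(X)); rewrite /= defX.
  apply: contraR nsylA => qX'; rewrite /pHall pcore_sub pcore_pgroup /=.
  by rewrite -card_quotient ?normal_norm // p'natE.
have [z /setIP[Xz nPz] oz] := Cauchy pr_q qN; apply/orP; right.
by apply: (arrowI pr_q pr_p _ _ sylP ntP Xz nPz oz); rewrite 1?eq_sym // nadjC.
Qed.

Lemma pi_Hall G H (pi : nat_pred) t : pi.-Hall(G) H -> t \in pi ->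
  t \in \pi(G) -> t \in \pi(H).
Proof.
move=> hallH pi_t; rewrite !mem_primes !cardG_gt0 /= => /andP[pr_t tG].
rewrite pr_t (card_Hall hallH).
by rewrite -(part_pnat_id (pi_pnat (pnat_id pr_t) pi_t)) partn_dvd.
Qed.

Lemma coprime_normal_cent A H G : A <| G -> H <| G -> coprime #|A| #|H| ->
  A \subset 'C(H).
Proof.
move=> /andP[sAG nAG] /andP[sHG nHG] coAH; apply/commG1P/trivgP.
rewrite -(coprime_TIg coAH) subsetI commg_subl commg_subr.
by rewrite (subset_trans sHG) ?(subset_trans sAG).
Qed.

Lemma coprime_pcore G p q : p != q -> coprime #|'O_p(G)| #|'O_q(G)|.
Proof.
move=> neq; rewrite (pnat_coprime (pcore_pgroup p G)) //.
by rewrite (pi_pnat (pcore_pgroup q G)) // !inE eq_sym.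
Qed.

Lemma arrow_total G p q : solvable G -> p \in \pi(G) -> q \in \pi(G) ->
  p != q -> nadj G p q -> arrow G p q || arrow G q p.
Proof.
move=> solG pG qG neq nG.
have [X hallX] := Hall_exists (pred2 p q) solG.
have [sXG piX _] := and3P hallX.
have solX := solvableS sXG solG; have nX := nadjS sXG nG.
have piXG t : t \in pred2 p q -> t \in \pi(G) -> t \in \pi(X).
  exact: pi_Hall.
have pq_p : p \in pred2 p q by rewrite inE eqxx.
have pq_q : q \in pred2 p q by rewrite !inE eqxx orbT.
have pX := piXG p pq_p pG; have qX := piXG q pq_q qG.
have sub : {subset \pi(X) <= pred2 p q} by move=> t; apply: (pnatPpi piX).
have liftp := Hall_arrow hallX pq_p; have liftq := Hall_arrow hallX pq_q.
suffices : arrow X p q || arrow X q p.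
  by case/orP=> arr; [rewrite liftq | rewrite liftp ?orbT // nadjC].
have ntX : X :!=: 1.
  apply: contraTneq pX => ->; rewrite mem_primes /= cards1 dvdn1.
  by apply/negP=> /andP[pr_p /eqP p1]; rewrite p1 in pr_p.
have [t tX ntO] := Fitting_pcore_neq1 solX ntX.
have /pred2P[tp | tq] := sub t tX.
  rewrite orbC; apply: arrow_total_half; rewrite -?tp // 1?eq_sym ?tp // 1?nadjC //.
  by move=> u /sub; rewrite !inE orbC.
by apply: arrow_total_half; rewrite -?tq // ?tq.
Qed.

(** If ['O_r(X)] were not a Sylow subgroup, the image of [x] would lie in the normal Sylow
    [q]-subgroup of [X / 'O_r(X)] and so centralise [R / 'O_r(X)]. Coprime action lifts these fixed
    points to [R], where [x] has none. *)
Lemma arrow_pcore1_Sylow X q r : solvable X -> {subset \pi(X) <= pred2 q r} ->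
  arrow X q r -> 'O_q(X) = 1 -> r.-Sylow(X) 'O_r(X).
Proof.
move=> solX piX /arrowP[pr_q pr_r neq nX arr] Oq1.
have [R sylR] := Sylow_exists r X; have [ntR [x [Xx nRx ox]]] := arr R sylR.
have [sRX rR _] := and3P sylR.
have ntX : X :!=: 1 by apply: contraNneq ntR => X1; rewrite -subG1 -X1.
have ntO : 'O_r(X) != 1.
  have [t tX ntO] := Fitting_pcore_neq1 solX ntX.
  by have /pred2P[tq | <- //] := piX t tX; rewrite tq Oq1 eqxx in ntO.
apply: contraT => nsyl.
have sylQ := pcore_quotient_Sylow solX piX pr_q pr_r neq nX ntO nsyl.
set R0 := 'O_r(X) in ntO nsyl sylQ.
have nsR0 : R0 <| X := pcore_normal r X.
have sR0R : R0 \subset R := pcore_sub_Hall sylR.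
have nR0X := normal_norm nsR0.
have nR0x : x \in 'N(R0) := subsetP nR0X x Xx.
have cxR : R / R0 \subset 'C[coset R0 x].
  apply: (@TI_comm_normal _ 'O_q(X / R0)%G (R / R0)%G (coset R0 x) q r) => //.
  - rewrite (mem_normal_Hall sylQ) ?pcore_normal ?mem_quotient //.
    by rewrite morph_p_elt // order_p_elt.
  - by rewrite -cycle_subG -quotient_cycle // quotient_norms ?cycle_subG.
  - by rewrite (subset_trans (quotientS _ sRX)) ?gFnorm.
  - exact: pcore_pgroup.
  exact: quotient_pgroup.
have coRx : coprime #|R| #|<[x]>|.
  by rewrite (pnat_coprime rR) // -orderE ox (pi_pnat (pnat_id pr_q)) // !inE.
have : 'C_R(<[x]>) / R0 = R / R0.
  rewrite coprime_quotient_cent ?cycle_subG ?(pgroup_sol rR) //.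
  by apply/setIidPl; rewrite quotient_cycle // cent_cycle.
rewrite cent_cycle (nadj_TIcent1 pr_q pr_r neq nX Xx sRX) ?order_p_elt //; last first.
  exact: order_prime_neq1 ox.
rewrite quotient1 => /esym/trivgP; rewrite /= quotient_sub1; last exact: subset_trans nR0X.
move=> sRR0.
 case/negP: nsyl; suffices -> : R0 = R by [].
by apply/eqP; rewrite eqEsubset sR0R.
Qed.

(** ['O_p(X)] and ['O_q(X)] commute, so one of them is trivial, and then the Sylow subgroup for the
    other prime is normal. An element of that Sylow subgroup normalising a Sylow subgroup for the
    first prime centralises it. *)
Lemma arrow_asym G p q : solvable G -> arrow G p q -> ~~ arrow G q p.
Proof.
move=> solG arr1; apply/negP=> arr2.
have [X hallX] := Hall_exists (pred2 p q) solG.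
have [sXG piX _] := and3P hallX; have solX := solvableS sXG solG.
have pq_p : p \in pred2 p q by rewrite inE eqxx.
have pq_q : q \in pred2 p q by rewrite !inE eqxx orbT.
have {}arr1 := arrow_Hall solG hallX pq_p pq_q arr1.
have {}arr2 := arrow_Hall solG hallX pq_q pq_p arr2.
have sub : {subset \pi(X) <= pred2 p q} by move=> t; apply: (pnatPpi piX).
have key a b : a != b -> {subset \pi(X) <= pred2 a b} -> arrow X a b ->
    arrow X b a -> 'O_a(X) = 1 -> False.
  move=> neq subX ab ba Oa1.
  have sylO := arrow_pcore1_Sylow solX subX ab Oa1.
  have [pr_b pr_a _ nX arr] := arrowP ba.
  have [A sylA] := Sylow_exists a X; have [ntA [y [Xy nAy oy]]] := arr A sylA.
  have [sAX aA _] := and3P sylA.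
  have cyA : A \subset 'C[y].
    apply: (@TI_comm_normal _ 'O_b(X)%G A y b a) => //; first by rewrite eq_sym.
    - by rewrite (mem_normal_Hall sylO) ?pcore_normal // order_p_elt.
    - by rewrite (subset_trans sAX) // gFnorm.
    exact: pcore_pgroup.
  case/eqP: ntA; rewrite -(setIidPl cyA).
  have neq' : b != a by rewrite eq_sym.
  apply: (nadj_TIcent1 pr_b pr_a neq' nX) => //; first exact: order_p_elt.
  exact: order_prime_neq1 oy.
have [pr_p pr_q neq nX _] := arrowP arr1.
have sub' : {subset \pi(X) <= pred2 q p} by move=> t /sub; rewrite !inE orbC.
have neq' : q != p by rewrite eq_sym.
have [Op1 | ntOp] := eqVneq 'O_p(X) 1; first exact: key neq sub arr1 arr2 Op1.
apply: key neq' sub' arr2 arr1 _.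
apply: (nadj_cent pr_p pr_q neq nX) ntOp; rewrite ?pcore_sub ?pcore_pgroup //.
exact: coprime_normal_cent (pcore_normal p X) (pcore_normal q X) (coprime_pcore X neq).
Qed.

Lemma cyclic_order_prime_sub Q (O : {group gT}) x q : cyclic Q -> O \subset Q ->
  q.-group O -> O :!=: 1 -> x \in Q -> #[x] = q -> x \in O.
Proof.
move=> cycQ sOQ qO ntO Qx ox; have [pr_q qdO _] := pgroup_pdiv qO ntO.
have [w Ow ow] := Cauchy pr_q qdO.
have Qw := subsetP sOQ w Ow.
suffices defx : <[x]> = <[w]> by rewrite -cycle_subG defx cycle_subG.
by apply/eqP; rewrite (eq_subG_cyclic cycQ) ?cycle_subG // -!orderE ox ow.
Qed.

(** Here [q ~ t] for every other prime [t] of [H]. If [A = 'O_q(H)] were nontrivial, the Fitting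
    subgroup of [H / A] would be a cyclic [q']-group containing the derived subgroup, and the
    element of order [p] acting on [Q] would centralise [Q / A]. So [A = 1], and [Q] acts without
    fixed points on some ['O_t(H)], hence has rank one. *)
Lemma arrow2_cyclic H p q r : solvable H ->
  {subset \pi(H) <= [pred t | [|| t == p, t == q | t == r]]} ->
  arrow H p q -> arrow H q r ->
  'O_q(H) = 1 /\ forall Q, q.-Sylow(H) Q -> cyclic Q.
Proof.
move=> solH piH arr1 arr2.
have [pr_p pr_q neq_pq nHpq arrQ] := arrowP arr1.
have [_ pr_r neq_qr nHqr arrR] := arrowP arr2.
have nadjq t : t \in \pi(H) -> t != q -> prime t /\ nadj H q t.
  move=> /piH/or3P[] /eqP->; rewrite ?eqxx // => _; split=> //.
  by rewrite nadjC.
have Oq1 : 'O_q(H) = 1.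
  apply/eqP; apply: contraT => ntA; set A := 'O_q(H) in ntA.
  have qA : q.-group A := pcore_pgroup q H.
  have nsAH : A <| H := pcore_normal q H; have nAH := normal_norm nsAH.
  have [Q sylQ] := Sylow_exists q H; have [ntQ [y [Hy nQy oy]]] := arrQ Q sylQ.
  have [sQH qQ _] := and3P sylQ; have sAQ : A \subset Q := pcore_sub_Hall sylQ.
  have [R sylR] := Sylow_exists r H; have [ntR [x [Hx nRx ox]]] := arrR R sylR.
  have [sRH rR _] := and3P sylR.
  pose Y := (H / A)%G; have solY : solvable Y := quotient_sol A solH.
  have piY t : t \in \pi(Y) -> t \in \pi(H).
    rewrite !mem_primes !cardG_gt0 /= => /andP[-> /dvdn_trans-> //].
    exact: dvdn_quotient.
  have ntQb : Q / A != 1.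
    apply/negP=> /eqP QA1; have {}QA1 : Q \subset A.
      by rewrite -quotient_sub1 ?QA1 // (subset_trans sQH).
    have cxR : R \subset 'C[x].
      apply: (@TI_comm_normal _ [group of A] R x q r) => //.
        rewrite (subsetP QA1) // (mem_normal_Hall sylQ) ?order_p_elt //.
        suffices -> : Q :=: A by [].
        by apply/eqP; rewrite eqEsubset QA1.
      exact: subset_trans nAH.
    case/eqP: ntR; rewrite -(setIidPl cxR).
    apply: (nadj_TIcent1 pr_q pr_r neq_qr nHqr) => //; first exact: order_p_elt.
    exact: order_prime_neq1 ox.
  have qQb : q.-group (Q / A) := quotient_pgroup A qQ.
  have [zq Qz ntz] := trivgPn _ ntQb.
  pose D := 'F(Y)%G.
  have cycD : cyclic D.
    apply: nil_Zgroup_cyclic (Fitting_nil Y).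
    apply/forall_inP=> V /SylowP[t pr_t sylV].
    have defV : V :=: 'O_t(Y).
      rewrite -p_core_Fitting; apply/esym/eqP.
      rewrite eqEsubset (pcore_sub_Hall sylV) /=.
      rewrite (sub_normal_Hall (nilpotent_pcore_Hall t (Fitting_nil Y))).
      - exact: pHall_pgroup sylV.
      - exact: pcore_normal.
      exact: pHall_sub sylV.
    have [-> | ntV] := eqVneq (V : {set _}) 1; first exact: cyclic1.
    have tV := pHall_pgroup sylV.
    have tY : t \in \pi(H).
      apply: piY; have [_ tdV _] := pgroup_pdiv tV ntV.
      rewrite mem_primes pr_t cardG_gt0 (dvdn_trans tdV) // cardSg //.
      by rewrite defV pcore_sub.
    have neq_tq : t != q.
      by apply: contraNneq ntV => tq; rewrite defV tq trivg_pcore_quotient.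
    have [_ nqt] := nadjq t tY neq_tq.
    have sVY : V \subset Y by rewrite defV pcore_sub.
    apply: (@rank1_cyclic _ Y V q t zq) => //.
    - by rewrite eq_sym.
    - move=> E sE; apply: (@abelian_quotient_cyclic _ H [group of A] E t q) => //.
      + by rewrite nadjC.
      + exact: subset_trans sVY.
      exact: pgroupS tV.
    - exact: (subsetP (quotientS A sQH)).
    - exact: mem_p_elt Qz.
    - rewrite defV (subsetP (gFnorm _ Y)) //.
      exact: (subsetP (quotientS A sQH)).
    exact: nadj_quotient.
  have sY'D : Y^`(1) \subset D.
    rewrite (subset_trans _ (cent_sub_Fitting solY)) // subsetI der_sub /=.
    by rewrite der1_sub_cent_cyclic ?gFnorm.
  have tiDQ : D :&: (Q / A) = 1.
    have q'D : q^'.-group D.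
      have := nilpotent_pcore_Hall q (Fitting_nil Y).
      rewrite p_core_Fitting trivg_pcore_quotient /pHall sub1G pgroup1 indexg1.
      by [].
    by rewrite setIC coprime_TIg // (pnat_coprime qQb).
  have nAy : y \in 'N(A) := subsetP nAH y Hy.
  have nQby : <[coset A y]> \subset 'N(Q / A).
    by rewrite -quotient_cycle // quotient_norms ?cycle_subG.
  case/eqP: (ntQb); apply: (@nadj_cent _ Y <[coset A y]>%G (Q / A)%G p q) => //.
  - exact: nadj_quotient.
  - by rewrite cycle_subG mem_quotient.
  - exact: quotientS.
  - suffices : p.-elt (coset A y) by [].
    by rewrite morph_p_elt // order_p_elt.
  - apply/commG1P/trivgP; rewrite -tiDQ subsetI; apply/andP; split.
      apply: subset_trans sY'D; rewrite derg1 commgSS ?quotientS //.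
      by rewrite cycle_subG mem_quotient.
    by rewrite commg_subr.
  rewrite cycle_eq1; apply: contraNneq neq_pq => cy1.
  have := mem_p_elt qA (coset_idr nAy cy1).
  by rewrite /p_elt oy pnatE.
split=> // Q sylQ; have [ntQ [y [Hy nQy oy]]] := arrQ Q sylQ.
have [sQH qQ _] := and3P sylQ.
have ntH : H :!=: 1 by apply: contraNneq ntQ => H1; rewrite -subG1 -H1.
have [t tH ntO] := Fitting_pcore_neq1 solH ntH.
have neq_tq : t != q by apply: contraNneq ntO => ->; rewrite Oq1.
have [pr_t nqt] := nadjq t tH neq_tq.
apply: (@rank1_cyclic _ H Q p q y) => //; last first.
- exact: order_prime_neq1 oy.
- exact: order_p_elt.
move=> E sEQ abE.
apply: (@nadj_abelian_cyclic _ H E 'O_t(H)%G q t) => //.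
- by rewrite eq_sym.
- exact: subset_trans sQH.
- exact: pcore_sub.
- exact: pgroupS qQ.
- exact: pcore_pgroup.
by rewrite (subset_trans sEQ) // (subset_trans sQH) ?gFnorm.
Qed.

(** If ['O_q(Y)] were nontrivial, it would contain the only subgroup of order [q] of a cyclic Sylow
    [q]-subgroup through [x]. Then [x] would lie in ['O_q(Y)] and centralise the [r]-group that it
    normalises. *)
Lemma arrow2_Sylow_normal G p q r Y : solvable G -> arrow G p q ->
  arrow G q r -> (pred2 q r).-Hall(G) Y ->
  r.-Sylow(Y) 'O_r(Y) /\ forall Q, q.-Sylow(G) Q -> cyclic Q.
Proof.
move=> solG arr1 arr2 hallY.
have [pr_p pr_q neq_pq nG _] := arrowP arr1.
have [_ pr_r neq_qr nGqr _] := arrowP arr2.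
pose pi := [pred t | [|| t == p, t == q | t == r]].
have cycG Q : q.-Sylow(G) Q -> cyclic Q.
  move=> sylQ; have piQ : pi.-group Q.
    by rewrite (pi_pgroup (pHall_pgroup sylQ)) // !inE eqxx orbT.
  have [H hallH sQH] := Hall_superset solG (pHall_sub sylQ) piQ.
  have [sHG piH _] := and3P hallH.
  have [||||_] := @arrow2_cyclic H p q r; last by apply; apply: pHall_subl sylQ.
  - exact: solvableS solG.
  - by move=> t; apply: (pnatPpi piH).
  - by apply: (arrow_Hall solG hallH) arr1; rewrite ?inE ?eqxx ?orbT.
  by apply: (arrow_Hall solG hallH) arr2; rewrite ?inE ?eqxx ?orbT.
split=> //.
have arrY : arrow Y q r by apply: (arrow_Hall solG hallY) arr2; rewrite ?inE ?eqxx ?orbT.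
have [sYG piY _] := and3P hallY; have solY := solvableS sYG solG.
have sub : {subset \pi(Y) <= pred2 q r} by move=> t; apply: (pnatPpi piY).
apply: (arrow_pcore1_Sylow solY sub arrY); apply/eqP; apply: contraT => ntO.
have [_ _ _ nY arrR] := arrowP arrY.
have [R sylR] := Sylow_exists r Y; have [ntR [x [Yx nRx ox]]] := arrR R sylR.
have [sRY rR _] := and3P sylR.
have xY : <[x]> \subset Y by rewrite cycle_subG.
have qx : q.-group <[x]> by apply: (order_p_elt pr_q ox).
have [Q sylQ sxQ] := Sylow_superset xY qx.
have cycQ : cyclic Q.
  apply: cycG; apply: subHall_Sylow hallY _ sylQ.
  by rewrite inE eqxx.
have Ox : x \in 'O_q(Y).
  apply: (cyclic_order_prime_sub cycQ) ox => //.
  - exact: pcore_sub_Hall.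
  - exact: pcore_pgroup.
  by rewrite -cycle_subG.
have cxR : R \subset 'C[x].
  apply: (@TI_comm_normal _ 'O_q(Y)%G R x q r) => //.
  - by rewrite (subset_trans sRY) ?gFnorm.
  exact: pcore_pgroup.
case/eqP: ntR; rewrite -(setIidPl cxR).
apply: (nadj_TIcent1 pr_q pr_r neq_qr nY) => //.
exact: order_prime_neq1 ox.
Qed.

Local Notation pred3' p q r := [pred t : nat | [|| t == p, t == q | t == r]].

(** Were ['O_r(H)] trivial, ['O_p(H)] would contain its own centraliser. But [x] of order [q] acts
    without fixed points on both [R] and ['O_p(H)], which forces [R] to centralise ['O_p(H)]. *)
Lemma arrow2_pcore_neq1 H p q r : solvable H ->
  {subset \pi(H) <= pred3' p q r} -> p != r ->
  arrow H p q -> arrow H q r -> 'O_r(H) != 1.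
Proof.
move=> solH piH neq_pr arr1 arr2; apply/eqP=> Or1.
have [Oq1 _] := arrow2_cyclic solH piH arr1 arr2.
have [pr_p pr_q neq_pq nHpq _] := arrowP arr1.
have [_ pr_r neq_qr nHqr arrR] := arrowP arr2.
have sCP : 'C_H('O_p(H)) \subset 'O_p(H).
  apply: Fitting_eq_pcore_pi => // t /piH/or3P[] /eqP-> //.
  by rewrite eqxx.
have [Y hallY] := Hall_exists (pred2 q r) solH.
have [sYH piY _] := and3P hallY.
have [sylO _] := arrow2_Sylow_normal solH arr1 arr2 hallY.
set R := 'O_r(Y)%G; have rR : r.-group R := pcore_pgroup r Y.
have sylR : r.-Sylow(H) R.
  by apply: subHall_Sylow hallY _ sylO; rewrite !inE eqxx orbT.
have [ntR [x [Hx nRx ox]]] := arrR R sylR.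
have sRH := pHall_sub sylR.
have pP := pcore_pgroup p H.
have coPR : coprime #|'O_p(H)| #|R|.
  by rewrite (pnat_coprime pP) // (pi_pnat rR) // !inE eq_sym.
have ntx := order_prime_neq1 pr_q ox; have qx := order_p_elt pr_q ox.
have cPR : R \subset 'C('O_p(H)).
  apply: (@frobenius_cent_pgroup _ 'O_p(H)%G R x p q) => //.
  - by rewrite -ox expg_order.
  - by rewrite (subset_trans sRH) ?gFnorm.
  - exact: (subsetP (gFnorm _ H)).
  - exact: (nadj_TIcent1 pr_q pr_r neq_qr nHqr).
  - apply: (nadj_TIcent1 pr_q pr_p _ _ Hx (pcore_sub p H)) => //.
      by rewrite eq_sym.
    by rewrite nadjC.
  by rewrite (pnat_coprime pP) // (pi_pnat qx) // !inE eq_sym.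
case/eqP: ntR; rewrite -(coprime_TIg coPR); apply/esym/setIidPr.
by rewrite (subset_trans _ sCP) // subsetI sRH.
Qed.

(** The arrow from [r] to [s] makes the Sylow [r]-subgroups cyclic, so the derived subgroup of [H]
    centralises ['O_r(H)], which is nontrivial. But [Q = [~: Q, <[y]>]] lies in that derived
    subgroup, against [q ~ r]. *)
Lemma arrow_no_walk3 G p q r s : solvable G -> arrow G p q -> arrow G q r ->
  arrow G r s -> False.
Proof.
move=> solG arr1 arr2 arr3.
have neq_pr : p != r.
  by apply: contraTneq arr1 => ->; apply: arrow_asym.
have cycR : forall R, r.-Sylow(G) R -> cyclic R.
  have [Y hallY] := Hall_exists (pred2 r s) solG.
  by have [] := arrow2_Sylow_normal solG arr2 arr3 hallY.
have [H hallH] := Hall_exists (pred3' p q r) solG.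
have [sHG piH _] := and3P hallH; have solH := solvableS sHG solG.
have sub : {subset \pi(H) <= pred3' p q r} by move=> t; apply: (pnatPpi piH).
have {}arr1 : arrow H p q by apply: (arrow_Hall solG hallH) arr1; rewrite ?inE ?eqxx ?orbT.
have {}arr2 : arrow H q r by apply: (arrow_Hall solG hallH) arr2; rewrite ?inE ?eqxx ?orbT.
have ntR0 := arrow2_pcore_neq1 solH sub neq_pr arr1 arr2.
have [pr_p pr_q neq_pq nHpq arrQ] := arrowP arr1.
have [_ pr_r neq_qr nHqr arrR] := arrowP arr2.
have cycR0 : cyclic 'O_r(H).
  have [R sylR] := Sylow_exists r H.
  apply: cyclicS (pcore_sub_Hall sylR) (cycR R _).
  by apply: subHall_Sylow hallH _ sylR; rewrite !inE eqxx !orbT.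
have [Q sylQ] := Sylow_exists q H; have [ntQ [y [Hy nQy oy]]] := arrQ Q sylQ.
have [sQH qQ _] := and3P sylQ.
have coQy : coprime #|Q| #|<[y]>|.
  by rewrite (pnat_coprime qQ) // (pi_pnat (order_p_elt pr_p oy)).
have defQ : Q \subset [~: Q, <[y]>].
  have nQ'Q : Q \subset 'N([~: Q, <[y]>]) by apply: commg_norml.
  have sQ'Q : [~: Q, <[y]>] \subset Q by rewrite commg_subl cycle_subG.
  rewrite -quotient_sub1 //.
  have <- : 'C_Q(<[y]>) / [~: Q, <[y]>] = Q / [~: Q, <[y]>].
    rewrite coprime_quotient_cent ?commg_normr ?(pgroup_sol qQ) //.
    by apply/setIidPl; rewrite quotient_cents2r.
  rewrite cent_cycle (nadj_TIcent1 pr_p pr_q neq_pq nHpq Hy sQH) ?quotient1 //.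
    exact: order_p_elt.
  exact: order_prime_neq1 oy.
case/eqP: ntQ; apply: (nadj_cent pr_r pr_q _ _ (pcore_sub r H) sQH) ntR0 => //.
- by rewrite eq_sym.
- by rewrite nadjC.
- exact: pcore_pgroup.
rewrite centsC (subset_trans defQ) //.
rewrite (subset_trans _ (der1_sub_cent_cyclic cycR0 (gFnorm _ H))) //.
by rewrite derg1 commgSS // cycle_subG.
Qed.

(** If [p ~ r], then ['O_p(H)], which commutes with ['O_r(H)], is trivial, and ['O_r(H)] contains
    its own centraliser. As [y] of order [p] acts without fixed points on [Q] and on ['O_r(H)], the
    group [Q] would centralise ['O_r(H)]. *)
Lemma arrow_no_trans G p q r : solvable G -> arrow G p q -> arrow G q r ->
  ~~ nadj G p r.
Proof.
move=> solG arr1 arr2; apply/negP=> nGpr.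
have neq_pr : p != r.
  by apply: contraTneq arr1 => ->; apply: arrow_asym.
have [H hallH] := Hall_exists (pred3' p q r) solG.
have [sHG piH _] := and3P hallH; have solH := solvableS sHG solG.
have sub : {subset \pi(H) <= pred3' p q r} by move=> t; apply: (pnatPpi piH).
have {}arr1 : arrow H p q by apply: (arrow_Hall solG hallH) arr1; rewrite ?inE ?eqxx ?orbT.
have {}arr2 : arrow H q r by apply: (arrow_Hall solG hallH) arr2; rewrite ?inE ?eqxx ?orbT.
have {}nHpr := nadjS sHG nGpr.
have ntR0 := arrow2_pcore_neq1 solH sub neq_pr arr1 arr2.
have [Oq1 _] := arrow2_cyclic solH sub arr1 arr2.
have [pr_p pr_q neq_pq nHpq arrQ] := arrowP arr1.
have [_ pr_r neq_qr nHqr arrR] := arrowP arr2.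
have rR0 := pcore_pgroup r H.
have Op1 : 'O_p(H) = 1.
  apply: (nadj_cent pr_r pr_p _ _ (pcore_sub r H) (pcore_sub p H)) ntR0 => //.
  - by rewrite eq_sym.
  - by rewrite nadjC.
  - exact: pcore_pgroup.
  apply: coprime_normal_cent (pcore_normal r H) (pcore_normal p H) _.
  by rewrite coprime_pcore // eq_sym.
have sCR : 'C_H('O_r(H)) \subset 'O_r(H).
  apply: Fitting_eq_pcore_pi => // t /sub/or3P[] /eqP-> //.
  by rewrite eqxx.
have [Q sylQ] := Sylow_exists q H; have [ntQ [y [Hy nQy oy]]] := arrQ Q sylQ.
have [sQH qQ _] := and3P sylQ.
have ntx := order_prime_neq1 pr_p oy; have py := order_p_elt pr_p oy.
have coRQ : coprime #|'O_r(H)| #|Q|.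
  by rewrite (pnat_coprime rR0) // (pi_pnat qQ) // !inE.
have cRQ : Q \subset 'C('O_r(H)).
  apply: (@frobenius_cent_pgroup _ 'O_r(H)%G Q y r p) => //.
  - by rewrite -oy expg_order.
  - by rewrite (subset_trans sQH) ?gFnorm.
  - exact: (subsetP (gFnorm _ H)).
  - exact: (nadj_TIcent1 pr_p pr_q neq_pq nHpq).
  - exact: (nadj_TIcent1 pr_p pr_r neq_pr nHpr Hy (pcore_sub r H)).
  by rewrite (pnat_coprime rR0) // (pi_pnat py) // !inE.
case/eqP: ntQ; rewrite -(coprime_TIg coRQ); apply/esym/setIidPr.
by rewrite (subset_trans _ sCR) // subsetI sQH.
Qed.

(** An orientation of a triangle is either transitive or cyclic, and a cycle is a closed walk of
    length three. *)
Lemma solvable_no_triangle G p q r : solvable G -> p \in \pi(G) ->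
  q \in \pi(G) -> r \in \pi(G) -> p != q -> q != r -> p != r ->
  nadj G p q -> nadj G q r -> nadj G p r -> False.
Proof.
move=> solG pG qG rG neq_pq neq_qr neq_pr npq nqr npr.
have nw a b c d := @arrow_no_walk3 G a b c d solG.
have nt a b c : arrow G a b -> arrow G b c -> nadj G a c -> False.
  by move=> ab bc; apply/negP; apply: arrow_no_trans bc.
have nqp := npq; rewrite nadjC in nqp; have nrq := nqr; rewrite nadjC in nrq.
have nrp := npr; rewrite nadjC in nrp.
case/orP: (arrow_total solG pG qG neq_pq npq) => apq;
case/orP: (arrow_total solG qG rG neq_qr nqr) => aqr;
case/orP: (arrow_total solG pG rG neq_pr npr) => apr.
- exact: nt apq aqr npr.
- exact: nw apq aqr apr.
- exact: nt apr aqr npq.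
- exact: nt apr apq nrq.
- exact: nt apq apr nqr.
- exact: nt aqr apr nqp.
- exact: nw apr aqr apq.
exact: nt aqr apq nrp.
Qed.

Definition has_out (G : {set gT}) p := has (arrow G p) (primes #|G|).
Definition has_out2 (G : {set gT}) p :=
  has (fun q => arrow G p q && has_out G q) (primes #|G|).
Definition out_color G p : 'I_3 :=
  if has_out2 G p then inord 2 else if has_out G p then inord 1 else inord 0.

Lemma has_outI G p q : arrow G p q -> has_out G p.
Proof.
move=> arr; apply/hasP; exists q => //.
have [_ pr_q _ _ sylP] := arrowP arr.
have [Q sylQ] := Sylow_exists q G; have [ntQ _] := sylP Q sylQ.
have [_ qdQ _] := pgroup_pdiv (pHall_pgroup sylQ) ntQ.
by rewrite mem_primes pr_q cardG_gt0 (dvdn_trans qdQ) // cardSg ?(pHall_sub sylQ).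
Qed.

(* Walks have length at most two, so the greatest length of a walk from p is a
   proper coloring (Gallai-Roy). *)
Lemma out_color_proper G p q : solvable G -> p \in \pi(G) -> q \in \pi(G) ->
  p != q -> nadj G p q -> out_color G p != out_color G q.
Proof.
move=> solG pG qG neq nG.
have key a b : b \in \pi(G) -> arrow G a b -> out_color G a != out_color G b.
  move=> bG ab; rewrite /out_color (has_outI ab).
  have [/hasP[c cG /andP[bc /hasP[d dG cd]]] | _] := boolP (has_out2 G b).
    by case: (arrow_no_walk3 solG ab bc cd).
  have [outb | _] := boolP (has_out G b).
    have -> : has_out2 G a by apply/hasP; exists b; rewrite ?ab.
    by rewrite -val_eqE /= !inordK.
  by case: ifP => _; rewrite -val_eqE /= !inordK.
case/orP: (arrow_total solG pG qG neq nG) => arr; first exact: key.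
by rewrite eq_sym; apply: key.
Qed.

End FrobeniusDigraph.

(** * Extensions of PSL(2,17) by solvable groups *)

(* The properties of PSL(2,17) used below: an element u v of order 17 is
   conjugate to its square, where u and v are generators of order 3. *)
Definition psl_like (gT : finGroupType) (X : {group gT}) :=
  [/\ simple X, #|X| = 2448%N,
      exists V : {group gT},
        [/\ V \subset X, 2.-group V, abelian V & ~~ cyclic V]
    & exists u v h : gT, [/\ <<[set u; v]>> = X, h \in X,
        #[u] = 3%N /\ #[v] = 3%N, #[u * v] = 17%N & (u * v) ^ h = (u * v) ^+ 2]].

Definition psl_primes := [pred p : nat | [|| p == 2, p == 3 | p == 17]].

Lemma psl_like_isog (aT rT : finGroupType) (X : {group aT}) (Y : {group rT}) :
  X \isog Y -> psl_like X -> psl_like Y.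
Proof.
move=> isoXY [simX oX [V [sVX twoV abV ncV]] [u [v [h [genX Xh [ou ov] ouv conj]]]]].
have /isogP[f injf imf] := isoXY.
have [Xu Xv] : u \in X /\ v \in X.
  by rewrite -genX; split; apply: mem_gen; rewrite !inE eqxx ?orbT.
split; first by rewrite -(isog_simple isoXY).
- by rewrite -(card_isog isoXY).
- exists (f @* V)%G; split; first by rewrite -imf morphimS.
  + exact: morphim_pgroup.
  + exact: morphim_abelian.
  by rewrite injm_cyclic.
exists (f u), (f v), (f h); split.
- have sX : [set u; v] \subset X by rewrite subUset !sub1set Xu.
  by have := morphim_gen f sX; rewrite genX imf morphimU !morphim_set1.
- by rewrite -imf mem_morphim.
- by rewrite !order_injm.
- by rewrite -morphM // order_injm ?groupM.
by rewrite -morphM // -morphJ ?groupM // -morphX ?groupM // conj.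
Qed.

Lemma psl_primesP p : (p \in psl_primes) = (prime p) && (p %| 2448).
Proof.
apply/idP/andP=> [/or3P[] /eqP -> // | [pr_p]].
rewrite (_ : 2448 = 2 * (2 * (2 * (2 * (3 * (3 * 17))))))%N // !Euclid_dvdM //.
by rewrite !dvdn_prime2 // !inE; case: (p == 2); case: (p == 3).
Qed.

Section Covering.

Variables (gT : finGroupType) (K N : {group gT}).
Hypotheses (nsNK : N <| K) (pslK : psl_like (K / N)).
Implicit Types (W L P C : {group gT}).

Let nNK := normal_norm nsNK.

Lemma psl_quotient_perfect : (K / N)^`(1) = K / N.
Proof.
have [simK oK _ _] := pslK; have [_ sim] := simpleP _ simK.
case: (sim _ (der_normal 1 (K / N))) => // /derG1P abK.
by have := simple_sol_prime (abelian_sol abK) simK; rewrite oK.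
Qed.

(** Frattini argument for the normal subgroup [W :&: N] of [W]. *)
Lemma cover_norm_Sylow W P p : W \subset K -> W / N = K / N ->
  p.-Sylow(W :&: N) P -> 'N_W(P) / N = K / N.
Proof.
move=> sWK covW sylP; rewrite -covW.
have nsWN : W :&: N <| W.
  by rewrite /normal subsetIl normsI ?normG // (subset_trans sWK).
have frat := Frattini_arg nsWN sylP.
apply/eqP; rewrite eqEsubset quotientS ?subsetIl //=.
rewrite quotientSK; last exact: subset_trans nNK.
apply: (@subset_trans _ _ ((W :&: N) * 'N_W(P))); first by rewrite frat.
by rewrite mulSg ?subsetIr.
Qed.

Lemma cover_norm_Sylow_ker P p : p.-Sylow(N) P -> 'N_K(P) / N = K / N.
Proof.
move=> sylP; apply: (@cover_norm_Sylow K P p) => //.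
by rewrite (setIidPr (normal_sub nsNK)).
Qed.

Lemma cover_der1 L : L / N = K / N -> L \subset K -> L^`(1) / N = K / N.
Proof.
move=> covL sLK; rewrite quotient_der ?(subset_trans sLK) // covL.
exact: psl_quotient_perfect.
Qed.

Lemma cover_dvd L q : L / N = K / N -> q \in psl_primes -> q %| #|L|.
Proof.
move=> covL; rewrite psl_primesP => /andP[_ qd].
have [_ oK _ _] := pslK; apply: dvdn_trans (dvdn_quotient L N).
by rewrite covL oK.
Qed.

Lemma cover_normal W C : W \subset K -> W / N = K / N -> C \subset W ->
  W \subset 'N(C) -> ~~ (C \subset N) -> C / N = K / N.
Proof.
move=> sWK covW sCW nCW nsCN.
have [simK _ _ _] := pslK; have [_ sim] := simpleP _ simK.
case: (sim (C / N)%G) => //.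
  by rewrite /normal quotientS ?(subset_trans sCW) //= -covW quotient_norms.
move=> C1; case/negP: nsCN; rewrite -quotient_sub1 ?C1 //.
by rewrite (subset_trans sCW) ?(subset_trans sWK).
Qed.

(** Two Frattini arguments show that [L], which normalises [P] and a Sylow [t]-subgroup [R] of
    ['N_N(P)], covers [K / N]. As ['Z(R)] acts on [P] without fixed points, it is cyclic, so
    [L^](1)[centralises it. But]L^[(1)] still covers the perfect group [K / N] and has elements of
    order [q]. *)
Lemma cover_adj P t p q : prime t -> prime p -> t != p -> p.-Sylow(N) P ->
  P :!=: 1 -> t %| #|'N_N(P)| -> nadj N t p -> q \in psl_primes -> t != q ->
  ~~ nadj K t q.
Proof.
move=> pr_t pr_p neq_tp sylP ntP tN nN qpi neq_tq; apply/negP=> nK.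
have pr_q : prime q by move: qpi; rewrite psl_primesP => /andP[].
have [sPN pP _] := and3P sylP.
pose W := 'N_K(P)%G; have sWK : W \subset K := subsetIl _ _.
have covW : W / N = K / N := cover_norm_Sylow_ker sylP.
have defWN : W :&: N = 'N_N(P).
  by rewrite /= setIAC (setIidPr (normal_sub nsNK)).
have [R sylR] := Sylow_exists t (W :&: N).
have covL := cover_norm_Sylow sWK covW sylR.
set L := 'N_W(R)%G in covL; have sLK : L \subset K.
  by rewrite (subset_trans (subsetIl _ _)).
have [sRWN tR _] := and3P sylR; have sRN := subset_trans sRWN (subsetIr _ _).
have ntR : R :!=: 1.
  rewrite -cardG_gt1 (card_Hall sylR) p_part_gt1 mem_primes pr_t cardG_gt0.
  by rewrite /= defWN.
have ntZ : 'Z(R) != 1 by rewrite center_nil_eq1 // (pgroup_nil tR).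
have nPR : 'Z(R) \subset 'N(P).
  rewrite (subset_trans (center_sub R)) // (subset_trans sRWN) //.
  by rewrite /= defWN subsetIr.
have sZN : 'Z(R) \subset N := subset_trans (center_sub R) sRN.
have tZ : t.-group 'Z(R) := pgroupS (center_sub R) tR.
have cycZ : cyclic 'Z(R).
  exact: nadj_abelian_cyclic pr_t pr_p neq_tp nN sZN sPN tZ pP ntP nPR
    (center_abelian R).
have nZL : L \subset 'N('Z(R)).
  by rewrite (char_norm_trans (center_char R)) // subsetIr.
have cZL' := der1_sub_cent_cyclic cycZ nZL.
have covL' := cover_der1 covL sLK.
have [g L'g og] := Cauchy pr_q (cover_dvd covL' qpi).
have sL'K : L^`(1) \subset K := subset_trans (der_sub 1 L) sLK.
have [z Zz ntz] := trivgPn _ ntZ.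
case/eqP: (order_prime_neq1 pr_q og).
apply: (nadj_comm pr_t pr_q neq_tq nK) ntz.
- by rewrite (subsetP (normal_sub nsNK)) // (subsetP sZN).
- exact: (subsetP sL'K).
- exact: mem_p_elt Zz.
- exact: order_p_elt.
by apply: commute_sym; apply: (centP (subsetP cZL' g L'g)).
Qed.

(** If 2 divides [#|'N_N(P)|], [cover_adj] applies. Otherwise the noncyclic abelian 2-group of
    [psl_like] lifts isomorphically into ['N_K(P)] and would act on [P] without fixed points. The
    case [p = 17] is allowed, and serves in [cover_nadj3F]. *)
Lemma cover_nadj2 p q : odd p -> p \in \pi(N) -> nadj K 2 p ->
  q \in psl_primes -> q != 2 -> ~~ nadj K 2 q.
Proof.
move=> odd_p piNp nK qpi neq_q2.
have [pr_p p_dv] : prime p /\ p %| #|N| by move: piNp; rewrite mem_primes => /and3P[].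
have neq_2p : 2 != p by apply: contraTneq odd_p => <-.
have [P sylP] := Sylow_exists p N; have [sPN pP _] := and3P sylP.
have ntP : P :!=: 1 by rewrite -cardG_gt1 (card_Hall sylP) p_part_gt1.
have nN : nadj N 2 p := nadjS (normal_sub nsNK) nK.
have [/cover_adj adj | odd_N] := boolP (2 %| #|'N_N(P)|).
  by apply: (adj p) => //; rewrite eq_sym.
pose W := 'N_K(P)%G; have sWK : W \subset K := subsetIl _ _.
have covW : W / N = K / N := cover_norm_Sylow_ker sylP.
have [_ _ [V [sVK twoV abV ncV]] _] := pslK.
pose X := (W :&: coset N @*^-1 V)%G.
have sXW : X \subset W := subsetIl _ _; have sXK := subset_trans sXW sWK.
have defV : X / N = V.
  rewrite /= setIC quotientGI ?sub_cosetpre // cosetpreK covW.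
  exact/setIidPl.
have [O sylO] := Sylow_exists 2 X; have [sOX twoO _] := and3P sylO.
have sOK := subset_trans sOX sXK.
have nNO : O \subset 'N(N) := subset_trans sOK nNK.
have defO : O / N = V.
  have := quotient_pHall nNO sylO; rewrite defV.
  by move/pHall_id; apply.
have tiON : N :&: O = 1.
  rewrite setIC; apply/trivgP; rewrite -(coprime_TIg (G := O) (H := 'N_N(P)%G)).
    rewrite subsetI subsetIl /= subsetI subsetIr.
    by rewrite (subset_trans (subsetIl O N)) // (subset_trans sOX) // (subset_trans sXW) ?subsetIr.
  by rewrite (pnat_coprime twoO) // p'natE.
have isoO := quotient_isog nNO tiON.
have pr_2 : prime 2 by [].
case/negP: ncV; rewrite -defO quotient_cyclic //.
apply: (nadj_abelian_cyclic pr_2 pr_p neq_2p nK sOK _ twoO pP ntP).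
- by rewrite (subset_trans sPN) // normal_sub.
- by rewrite (subset_trans sOX) // (subset_trans sXW) ?subsetIr.
by rewrite (isog_abelian isoO) /= defO.
Qed.

Lemma p_elt_lift_expg W (y : gT) q : prime q -> W \subset K -> y \in W ->
  q.-elt y -> coset N y ^+ q = 1 -> ~~ (q %| #|W :&: N|) -> y ^+ q = 1.
Proof.
move=> pr_q sWK Wy qy cyq q'WN.
have Ny : y \in 'N(N) by rewrite (subsetP nNK) // (subsetP sWK).
have WNyq : y ^+ q \in W :&: N.
  by rewrite inE groupX //=; apply: coset_idr; rewrite ?groupX // morphX.
have qyq : q.-nat #[y ^+ q] by exact: mem_p_elt qy (mem_cycle _ _).
have q'yq : q^'.-nat #[y ^+ q] by apply: pnat_dvd (order_dvdG WNyq) _; rewrite p'natE.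
by apply/eqP; rewrite -order_eq1 (pnat_1 qyq q'yq).
Qed.

(** The [q]-part of any preimage works: its [q]-th power is a [q]-element of [W :&: N]. *)
Lemma lift_prime_order W (x : coset_of N) q : prime q -> W \subset K ->
  x \in W / N -> #[x] = q -> ~~ (q %| #|W :&: N|) ->
  exists y, [/\ y \in W, coset N y = x & #[y] = q].
Proof.
move=> pr_q sWK /morphimP[y0 Ny0 Wy0 /= defx0] ox q'WN.
have defx : coset N y0.`_q = x.
  by rewrite morph_constt //= -defx0 constt_p_elt // order_p_elt.
exists y0.`_q; rewrite groupX //; split=> //; apply: nt_prime_order => //.
  apply: p_elt_lift_expg pr_q sWK (groupX _ Wy0) (p_elt_constt q y0) _ q'WN.
  by rewrite defx -ox expg_order.
apply: contraTneq pr_q => y1; move: ox; rewrite -defx y1 morph1 order1 => <-.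
by [].
Qed.

Import FiniteModule.

(* Here A^-1 = -1 - A and B^-1 = -1 - B: an automorphism of order 3 without
   fixed points satisfies 1 + A + A^2 = 0. So the trace B A + (B A)^-1 commutes
   with A and B. *)
Lemma quadratic_trace_comm (M : zmodType) (A B : M -> M) :
    {morph A : x y / (x + y)%R} -> {morph A : x / (- x)%R} ->
    {morph B : x y / (x + y)%R} -> {morph B : x / (- x)%R} ->
    (forall x, A (A x) = - x - A x)%R -> (forall x, B (B x) = - x - B x)%R ->
  let z x := (B (A x) + (- (- x - B x) - A (- x - B x)))%R in
  forall x, A (z x) = z (A x) /\ B (z x) = z (B x).
Proof.
move=> AD AN BD BN hA hB z x; rewrite /z.
have cancel2 (d e w : M) : ((- d - e) + (e + w) = - d + w)%R.
  by rewrite GRing.addrA GRing.subrK.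
have eqA (a b c d e : M) :
    (c + (- a - d) = (- d - e) + ((b + e) + ((- a - b) + c)))%R.
  rewrite [(b + e)%R]GRing.addrC -(GRing.addrA e b) (GRing.addrA b).
  rewrite [(b + (_ - b))%R]GRing.addrC GRing.subrK cancel2 [RHS]GRing.addrC.
  by rewrite GRing.addrA [(c - a)%R]GRing.addrC.
have eqB (a b c d e : M) :
    ((- b - e) + ((c + (- a - c)) + (e + d)) = d + (- a - b))%R.
  rewrite [(c + _)%R]GRing.addrC GRing.subrK (GRing.addrCA (- a)%R) cancel2.
  by rewrite [LHS]GRing.addrC [RHS]GRing.addrA [(d - a)%R]GRing.addrC.
have AK w : (A (- w - A w) = w)%R.
  by rewrite AD !AN hA GRing.opprD !GRing.opprK GRing.addrCA GRing.addNr GRing.addr0.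
split.
  rewrite AD AK hA; set y := A x.
  have -> : (- (- y - B y) - A (- y - B y) = (y + B y) + ((- x - y) + A (B y)))%R.
    by rewrite AD !AN hA !GRing.opprD !GRing.opprK.
  by rewrite BD !BN -eqA.
have -> : (- B x - B (B x) = x)%R.
  by rewrite hB GRing.opprD !GRing.opprK GRing.addrCA GRing.addNr GRing.addr0.
rewrite BD hB -(eqB x (A x) (B x) (B (A (B x))) (B (A x))); congr (_ + _)%R.
by rewrite !(AD, AN, BD, BN, hB) !GRing.opprD !GRing.opprK.
Qed.

(** [u] and [v] lift to [U] and [V] of order 3 in ['N_K(P)], acting on [Z = 'Z(P)] without fixed
    points. The trace argument shows that the 17-part [c] of [U * V] centralises [Z], from which an
    element of order 3 centralising [Z] is obtained. *)
Lemma cover_nadj3 P p : p.-Sylow(N) P -> P :!=: 1 -> prime p ->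
  ~~ (3 %| #|'N_N(P)|) -> ~~ (17 %| #|'N_N(P)|) -> p \notin psl_primes ->
  ~~ nadj K 3 p.
Proof.
move=> sylP ntP pr_p not3 not17 np; apply/negP=> nK.
have [sPN pP _] := and3P sylP.
pose W := 'N_K(P)%G; have sWK : W \subset K := subsetIl _ _.
have covW : W / N = K / N := cover_norm_Sylow_ker sylP.
have defWN : W :&: N = 'N_N(P).
  by rewrite /= setIAC (setIidPr (normal_sub nsNK)).
have [_ _ _ [u [v [h [genK Kh [ou ov] ouv conj]]]]] := pslK.
have [Ku Kv] : u \in K / N /\ v \in K / N.
  by rewrite -genK; split; apply: mem_gen; rewrite !inE eqxx ?orbT.
have pr3 : prime 3 by []; have pr17 : prime 17 by [].
rewrite -defWN in not3 not17.
have [U [WU defU oU]] : exists U, [/\ U \in W, coset N U = u & #[U] = 3%N].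
  by apply: lift_prime_order => //; rewrite covW.
have [V [WV defV oV]] : exists V, [/\ V \in W, coset N V = v & #[V] = 3%N].
  by apply: lift_prime_order => //; rewrite covW.
have sUVW : [set U; V] \subset W by rewrite subUset !sub1set WU.
have [L defL] : exists L : {group gT}, <<[set U; V]>> = L.
  by exists <<[set U; V]>>%G.
have sLW : L \subset W by rewrite -defL gen_subG.
have sLK := subset_trans sLW sWK; have nNL := subset_trans sLK nNK.
have covL : L / N = K / N.
  rewrite -defL quotient_gen ?(subset_trans sUVW) ?(subset_trans sWK) //.
  rewrite quotientU !quotient_set1 ?defU ?defV ?genK //.
    by rewrite (subsetP nNK) // (subsetP sWK).
  by rewrite (subsetP nNK) // (subsetP sWK).
have LU : U \in L by rewrite -defL mem_gen // !inE eqxx.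
have LV : V \in L by rewrite -defL mem_gen // !inE eqxx orbT.
pose g := U * V; have [c defc0] : exists c, c = g.`_17 by exists g.`_17.
have Lg : g \in L by rewrite groupM.
have Lc : c \in L by rewrite defc0 groupX.
have nNx x : x \in L -> x \in 'N(N) by apply/subsetP.
have defc : coset N c = u * v.
  rewrite defc0 morph_constt ?nNx // constt_p_elt ?morphM ?nNx //= ?defU ?defV //.
  exact: order_p_elt ouv.
have oc : #[c] = 17%N.
  apply: nt_prime_order => //.
    have elc : 17.-elt c by rewrite defc0 p_elt_constt.
    apply: (p_elt_lift_expg pr17 sWK _ elc) => //.
      exact: (subsetP sLW).
    by rewrite defc -ouv expg_order.
  by apply: contraTneq (isT : 1 < 17) => c1; rewrite -ouv -defc c1 morph1 order1.
have not17L : ~~ (17 %| #|L :&: N|).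
  by apply: contra not17 => /dvdn_trans-> //; rewrite cardSg ?setSI.
(* A preimage [x0] of [h] conjugates [c] to [c ^+ 2] only modulo [N]. Since [<[c]>] and [<[c ^ x0]>]
   are Sylow 17-subgroups of [B], a factor [b] in [B] corrects [x0]; modulo [N], [b] is a power of
   [u * v] and keeps the relation. *)
have [x Lx conjx] : exists2 x, x \in L & c ^ x = c ^+ 2.
  have : h \in L / N by rewrite covL.
  case/morphimP=> x0 Nx0 Lx0 /= defh.
  pose B := ((L :&: N) <*> <[c]>)%G.
  have nLNc : <[c]> \subset 'N(L :&: N).
    by rewrite normsI ?cycle_subG ?nNx // (subsetP (normG _)).
  have sBL : B \subset L by rewrite join_subG subsetIl cycle_subG.
  have sylc : 17.-Sylow(B) <[c]>.
    apply: pHall_subl (joing_subr _ _) sBL _.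
    rewrite pHallE cycle_subG Lc -orderE oc.
    rewrite -(Lagrange (subsetIl L N)) partnM ?cardG_gt0 //.
    rewrite part_p'nat ?mul1n; last by rewrite p'natE.
    have -> : #|L : L :&: N| = 2448%N.
      have [_ oK _ _] := pslK; rewrite -[RHS]oK /= -covL card_quotient //.
      by rewrite indexgI.
    by rewrite p_part (_ : logn 17 2448 = 1%N) //; vm_compute.
  have sylcx : 17.-Sylow(B) <[c ^ x0]>.
    have Bcx : c ^ x0 \in B.
      have -> : c ^ x0 = (c ^ x0 * c ^- 2) * c ^+ 2 by rewrite mulgKV.
      rewrite groupM ?groupX ?mem_gen // !inE ?cycle_id ?orbT //.
      rewrite groupM ?groupV ?groupX ?groupJ //=; apply/orP; left.
      apply: coset_idr; first by rewrite groupM ?groupV ?groupX ?groupJ ?nNx.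
      rewrite morphM ?groupV ?groupX ?groupJ ?nNx // morphV ?groupX ?nNx //.
      by rewrite /= morphJ ?nNx // morphX ?nNx //= defc -defh conj mulgV.
    rewrite pHallE cycle_subG Bcx /= -orderE orderJ.
    by have := card_Hall sylc; rewrite -orderE => ->.
  have [b Bb eqc] := Sylow_trans sylcx sylc.
  have Lb := subsetP sBL b Bb.
  exists (x0 * b); first by rewrite groupM.
  have [i defb] : exists i, coset N b = (u * v) ^+ i.
    move: Bb; rewrite /= norm_joinEr // => /mulsgP[n d /setIP[Ln Nn] /cycleP[i ->] ->].
    exists i; rewrite morphM ?nNx ?groupX //= coset_id // mul1g.
    by rewrite morphX ?nNx //= defc.
  have : c ^ (x0 * b) \in <[c]>.
    by rewrite eqc conjgM memJ_conjg cycle_id.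
  case/cycleP=> k defk; rewrite defk; apply/eqP.
  rewrite eq_expg_mod_order oc -ouv -eq_expg_mod_order -defc -!morphX ?nNx //.
  rewrite -defk conjgM /= morphJ ?nNx ?groupJ //= morphJ ?nNx //=.
  rewrite [coset N (c ^+ 2)]morphX ?nNx //= defc -defh conj defb.
  apply/eqP/conjg_fixP/commgP/commuteX2.
  by [].
pose Z := 'Z(P)%G.
have sZP : Z \subset P := center_sub P.
have ntZ : Z :!=: 1 by rewrite center_nil_eq1 // (pgroup_nil pP).
have pZ : p.-group Z := pgroupS sZP pP.
have nZW : W \subset 'N(Z).
  by rewrite (char_norm_trans (center_char P)) // subsetIr.
have abZ : abelian Z := center_abelian P.
have sZK : Z \subset K by rewrite (subset_trans sZP) // (subset_trans sPN) ?normal_sub.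
have neq3p : 3 != p by apply: contraNneq np => <-.
have fpf3 y : y \in W -> #[y] = 3%N -> 'C_Z[y] = 1.
  move=> Wy oy; apply: (nadj_TIcent1 pr3 pr_p neq3p nK) => //.
  - exact: (subsetP sWK).
  - exact: order_p_elt.
  exact: order_prime_neq1 oy.
have nZ y : y \in L -> y \in 'N(Z) by move/(subsetP sLW)/(subsetP nZW).
have sq (y : gT) (w : fmod_of abZ) : y \in L -> #[y] = 3%N ->
    (w ^@ y ^@ y = - w - w ^@ y)%R.
  move=> Ly oy; have Wy := subsetP sLW y Ly.
  have y3 : y ^+ 3 = 1 by rewrite -oy expg_order.
  have := actr_cycle_sum0 w (isT : 0 < 3) y3 (nZ y Ly) (fpf3 y Wy oy).
  rewrite 3!big_ord_recl big_ord0 /= GRing.addr0 expg0 actr1 expg1 => sum0.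
  rewrite -actrM ?nZ // -expg2.
  apply/eqP; rewrite -GRing.opprD -GRing.addr_eq0 GRing.addrC -GRing.addrA.
  by apply/eqP.
have inv3 (y : gT) (w : fmod_of abZ) : y \in L -> #[y] = 3%N ->
    (w ^@ y^-1%g = - w - w ^@ y)%R.
  move=> Ly oy; rewrite -sq // -actrM ?nZ // -expg2; congr (_ ^@ _)%R.
  by apply: (mulgI y); rewrite mulgV -expgS -oy expg_order.
have [z zE] : exists z : nat -> fmod_of abZ -> fmod_of abZ,
    forall m w, (z m w = w ^@ (g ^+ m)%g + w ^@ (g ^- m)%g)%R.
  by exists (fun m w => (w ^@ (g ^+ m)%g + w ^@ (g ^- m)%g)%R).
have nZg : g \in 'N(Z) by rewrite nZ.
have actrX (i : nat) (w : fmod_of abZ) : (w ^@ (g ^+ i)%g ^@ g = w ^@ (g ^+ i.+1)%g)%R.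
  by rewrite -actrM ?groupX // -expgSr.
have actrXV (i : nat) (w : fmod_of abZ) : (w ^@ (g ^- i)%g ^@ g^-1%g = w ^@ (g ^- i.+1)%g)%R.
  by rewrite -actrM ?groupV ?groupX // -!expgVn -expgSr.
(* The Chebyshev recurrence for traces of powers reduces commutation with [U] and [V] to [m = 1]. *)
have zS m w : (z m.+2 w = z 1%N (z m.+1 w) - z m w)%R.
  have h1 : (w ^@ (g ^- m.+1)%g ^@ g = w ^@ (g ^- m)%g)%R by rewrite -actrXV actrKV.
  have h2 : (w ^@ (g ^+ m.+1)%g ^@ g^-1%g = w ^@ (g ^+ m)%g)%R by rewrite -actrX actrK.
  rewrite !zE !expg1 !actAr actrX actrXV h1 h2.
  set a := (w ^@ _)%R; set b := (w ^@ _)%R; set e := (w ^@ _)%R; set d := (w ^@ _)%R.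
  by rewrite (GRing.addrC d b) GRing.addrACA (GRing.addrC e d) GRing.addrK.
have zUV1 w : (z 1%N w ^@ U = z 1%N (w ^@ U) /\ z 1%N w ^@ V = z 1%N (w ^@ V))%R.
  have := @quadratic_trace_comm (fmod_of abZ) (fun w => w ^@ U)%R (fun w => w ^@ V)%R.
  move=> /(_ (actAr U) (actNr U) (actAr V) (actNr V)).
  move=> /(_ (fun w => sq U w LU oU) (fun w => sq V w LV oV) w).
  have z1E w' : (z 1%N w' = w' ^@ U ^@ V + (- (- w' - w' ^@ V) - (- w' - w' ^@ V) ^@ U))%R.
    rewrite !zE !expg1 /g invMg !actrM ?groupV ?nZ //.
    by rewrite (inv3 V) // (inv3 U).
  by rewrite !z1E.
have zUV m w : (z m w ^@ U = z m (w ^@ U) /\ z m w ^@ V = z m (w ^@ V))%R.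
  suffices : (z m w ^@ U = z m (w ^@ U) /\ z m w ^@ V = z m (w ^@ V))%R /\
    (z m.+1 w ^@ U = z m.+1 (w ^@ U) /\ z m.+1 w ^@ V = z m.+1 (w ^@ V))%R by case.
  elim: m => [|m [[IHU IHV] [IHU1 IHV1]]].
    by split=> //; rewrite !zE expg0 invg1 !actr1 !actAr.
  split=> //; rewrite !zS !actAr !actNr IHU IHV.
  by have [-> ->] := zUV1 (z m.+1 w); rewrite IHU1 IHV1.
have zL m w y : y \in L -> (z m w ^@ y = z m (w ^@ y))%R.
  rewrite -defL => /gen_prodgP[n [f UVf ->]].
  have UVL i : f i \in L by rewrite -defL mem_gen.
  pose R x := x \in L /\ forall w, (z m w ^@ x = z m (w ^@ x))%R.
  suffices [_ -> //] : R (\prod_(i < n) f i).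
  apply: big_ind => [|a b [La za] [Lb zb]|i _].
  - by split=> // w'; rewrite !actr1.
  - by split=> [|w']; rewrite ?groupM // !actrM ?nZ // za zb.
  split=> // w'; have [zU zV] := zUV m w'.
  by case/set2P: (UVf i) => ->.
have cZc : c \in 'C(Z).
  have [m defc'] : exists m, c = g ^+ m.
    by apply/cycleP; rewrite defc0 cycle_constt.
  have nZc : c \in 'N(Z) := nZ c Lc.
  (* [c] is a power of [g], so its trace is some [z m] and commutes with [x]; conjugation by [x]
     turns the trace of [c] into that of [c ^+ 2]. *)
  have fix2 (w : fmod_of abZ) :
      (w ^@ (c ^+ 2)%g + w ^@ (c ^- 2)%g = w ^@ c + w ^@ c^-1%g)%R.
    have := zL m (w ^@ x^-1%g)%R x Lx; rewrite !zE -defc' actAr actrKV.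
    rewrite -!actrM ?groupM ?groupV ?nZ //.
    by rewrite -!conjgE conjVg conjx.
  have fixX (d : fmod_of abZ) y k : y \in 'N(Z) -> (d ^@ y = d)%R ->
      (d ^@ (y ^+ k)%g = d)%R.
    move=> nZy dy; elim: k => [|k IHk]; first by rewrite actr1.
    by rewrite expgSr actrM ?groupX // IHk.
  have c17 : c ^+ 17 = 1 by rewrite -oc expg_order.
  suffices fixc (w : fmod_of abZ) : (w ^@ c = w)%R.
    apply/centP=> y Zy; apply/commute_sym/commgP/conjg_fixP.
    by have := congr1 val (fixc (fmod abZ y)); rewrite fmvalJ //= fmodK.
  (* As operators, [fix2] says c^2 - c = (c^2 - c) c^-3. So [d] is fixed by [c ^- 3], and by its
     11th power, which is [c] since 33 = 2 * 17 - 1. *)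
  pose d := (w ^@ (c ^+ 2)%g - w ^@ c)%R.
  have d3 : (d ^@ (c ^- 3)%g = d)%R.
    rewrite /d actAr actNr -!actrM ?groupV ?groupX //.
    have -> : c ^+ 2 * c ^- 3 = c^-1 by rewrite (expgS c 2) invMg mulKVg.
    have -> : c * c ^- 3 = c ^- 2 by rewrite (expgSr c 2) invMg mulKVg.
    have -> : (w ^@ (c ^+ 2)%g = w ^@ c + w ^@ c^-1%g - w ^@ (c ^- 2)%g)%R.
      by rewrite -fix2 GRing.addrK.
    by rewrite -(GRing.addrA (w ^@ c)%R) [RHS]GRing.addrC GRing.addKr.
  have dc : (d ^@ c = d)%R.
    have {1}-> : c = (c ^- 3) ^+ 11.
      rewrite expgVn -expgM; apply/eqP; rewrite eq_sym eq_invg_mul -expgSr.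
      by rewrite (expgM c 17 2) c17 expg1n.
    by apply: fixX; rewrite ?groupV ?groupX.
  (* Each application of [c] adds [d]; after 17 of them 17 d = 0, and [p != 17] gives [d = 0]. *)
  have wc k : (w ^@ (c ^+ k)%g = w + d *+ k)%R.
    have dcV : (d ^@ c^-1%g = d)%R by rewrite -{1}dc actrK.
    have w1 : (w ^@ c = w + d)%R.
      rewrite -dcV /d actAr actNr actrK expgS actrM // actrK.
      by rewrite GRing.addrC GRing.subrK.
    elim: k => [|k IHk]; first by rewrite actr1 GRing.mulr0n GRing.addr0.
    rewrite expgSr actrM ?groupX // IHk actAr actZr dc w1 -GRing.addrA.
    by rewrite -GRing.mulrS.
  have d0 : d = 0%R.
    have := wc 17; rewrite c17 actr1 -{1}[w]GRing.addr0 => /GRing.addrI/esym d17.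
    have coZ : coprime #|Z| 17.
      rewrite (pnat_coprime pZ) // p'natE // dvdn_prime2 //.
      by apply: contraNneq np => ->.
    apply: val_inj; rewrite -(expgK coZ (fmodP d)) -fmvalZ d17.
    by rewrite expg1n.
  by have := wc 1%N; rewrite d0 GRing.mul0rn GRing.addr0 expg1.
have sCW : 'C_W(Z) \subset W := subsetIl _ _.
have Wc := subsetP sLW c Lc.
(* [c] lies in ['C_W(Z)] but not in [N], so simplicity of [K / N] applies. *)
have covC : 'C_W(Z) / N = K / N.
  apply: (cover_normal sWK covW sCW); first by rewrite normsI ?normG ?norms_cent.
  apply/negP=> /subsetP/(_ c); rewrite inE Wc cZc => /(_ isT) Nc.
  by have := ouv; rewrite -defc coset_id // order1.
have [y Cy oy] := Cauchy pr3 (cover_dvd covC (isT : 3 \in psl_primes)).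
have [Wy cZy] := setIP Cy.
case/eqP: ntZ; rewrite -(fpf3 y Wy oy); apply/esym/setIidPl.
by rewrite sub_cent1.
Qed.

Hypothesis solN : solvable N.

Lemma cover_pi p : p \in \pi(K) -> p \notin psl_primes -> p \in \pi(N).
Proof.
rewrite !mem_primes !cardG_gt0 /= => /andP[pr_p pK] np; rewrite pr_p.
have [_ oK _ _] := pslK; move: pK; rewrite -(Lagrange (normal_sub nsNK)).
rewrite -card_quotient // oK Euclid_dvdM // => /orP[// | pd].
by case/negP: np; rewrite psl_primesP pr_p.
Qed.

Lemma cover_psl_pi q : q \in psl_primes -> q \in \pi(K).
Proof.
move=> qpi; rewrite mem_primes cardG_gt0 (cover_dvd _ qpi) //= andbT.
by move: qpi; rewrite psl_primesP => /andP[].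
Qed.

Lemma cover_no_out r s q : r \notin psl_primes -> q \in psl_primes ->
  nadj K r q -> ~~ arrow N r s.
Proof.
move=> nr qpi nK; apply/negP=> /arrowP[pr_r pr_s neq nN arr].
have [S sylS] := Sylow_exists s N; have [ntS [y [Ny nSy oy]]] := arr S sylS.
have rNS : r %| #|'N_N(S)| by rewrite -oy order_dvdG // inE Ny.
have neq_rq : r != q by apply: contraNneq nr => ->.
by have := cover_adj pr_r pr_s neq sylS ntS rNS nN qpi neq_rq; rewrite nK.
Qed.

Lemma cover_nadj2F p q : p \in \pi(K) -> p \notin psl_primes -> nadj K 2 p ->
  q \in psl_primes -> q != 2 -> ~~ nadj K 2 q.
Proof.
move=> pK np; apply: cover_nadj2 (cover_pi pK np).
have : prime p by move: pK; rewrite mem_primes => /andP[].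
by case/even_prime => // p2; rewrite p2 in np.
Qed.

(** To apply [cover_nadj3], neither 3 nor 17 may divide [#|'N_N(P)|]. For 3, and for 17 when
    [17 ~ p], this is [cover_adj] against [3 ~ 17]. In the triangle case, 17 dividing [#|N|]
    contradicts [2 ~ 17] by [cover_nadj2]. *)
Lemma cover_nadj3F p : p \in \pi(K) -> p \notin psl_primes -> nadj K 3 p ->
  nadj K 3 17 -> nadj K 17 p \/ nadj K 3 2 /\ nadj K 2 17 -> False.
Proof.
move=> pK np n3p n317 alt; have pN := cover_pi pK np.
have [pr_p p_dv] : prime p /\ p %| #|N| by move: pN; rewrite mem_primes => /and3P[].
have [P sylP] := Sylow_exists p N.
have ntP : P :!=: 1 by rewrite -cardG_gt1 (card_Hall sylP) p_part_gt1.
have pr3 : prime 3 by []; have pr17 : prime 17 by [].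
have neq3p : 3 != p by apply: contraNneq np => <-.
have neq17p : 17 != p by apply: contraNneq np => <-.
have sNK := normal_sub nsNK.
have not3 : ~~ (3 %| #|'N_N(P)|).
  apply/negP=> d3; have nN := nadjS sNK n3p.
  have pi17 : 17 \in psl_primes by [].
  by have := cover_adj pr3 pr_p neq3p sylP ntP d3 nN pi17 isT; rewrite n317.
have not17 : ~~ (17 %| #|'N_N(P)|).
  apply/negP=> d17; case: alt => [n17p | [n32 n217]].
    have nN := nadjS sNK n17p; have pi3 : 3 \in psl_primes by [].
    have := cover_adj pr17 pr_p neq17p sylP ntP d17 nN pi3 isT.
    by rewrite nadjC n317.
  have pi17 : 17 \in psl_primes by [].
  have N17 : 17 \in \pi(N).
    rewrite mem_primes cardG_gt0 (dvdn_trans d17) // cardSg //.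
    exact: subsetIl.
  by have := @cover_nadj2 17 17 isT N17 n217 pi17 isT; rewrite n217.
by have := cover_nadj3 sylP ntP pr_p not3 not17 np; rewrite n3p.
Qed.

End Covering.

(** * Reduction to such extensions *)

Section PseudoSolvable.

Variables (hT : finGroupType) (S : {group hT}).

Definition good_section (gT : finGroupType) (U : section gT) :=
  abelian U || (U \isog S).

Lemma good_section_isog (gT rT : finGroupType) (U : section gT) (V : section rT) :
  U \isog V -> good_section U = good_section V.
Proof.
move=> isoUV; rewrite /good_section (isog_abelian isoUV); congr (_ || _).
exact: isog_transl isoUV.
Qed.

(** The preimages of the terms of [s'], followed by [t], form a composition series; its upper
    factors are those of [s'] by the third isomorphism theorem. *)
Lemma comps_lift (gT : finGroupType) (G N : {group gT}) s' t :
  N <| G -> comps (G / N) s' -> comps N t ->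
  exists2 s, comps G s & all (@good_section _) (pairmap (@mkSec gT) G s)
    = all (@good_section _) (pairmap (@mkSec _) (G / N)%G s')
      && all (@good_section _) (pairmap (@mkSec gT) N t).
Proof.
elim: s' G => [|H s' IH] G nsNG cs' ct.
  case/andP: cs' => /eqP/(congr1 val)/= /trivgP GN1 _.
  have defG : G = N.
    apply/val_inj/eqP; rewrite eqEsubset (normal_sub nsNG) andbT /=.
    by rewrite -quotient_sub1 ?normal_norm.
  by exists t; rewrite defG.
have [sNG nNG] := andP nsNG.
have /andP[/= lasts' /andP[maxH pths']] := cs'.
have nsH : H <| (G / N)%G := maxnormal_normal maxH.
pose G1 := (coset N @*^-1 H)%G.
have nsG1G : G1 <| G by rewrite -(quotientGK nsNG) cosetpre_normal.
have sNG1 : N \subset G1 by rewrite -{1}(ker_coset N) morphpreS ?sub1G.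
have nsNG1 : N <| G1 := normalS sNG1 (normal_sub nsG1G) nsNG.
have defH : (G1 / N)%G = H by apply: val_inj; rewrite /= cosetpreK.
have cs1 : comps (G1 / N)%G s' by rewrite defH; apply: comps_cons cs'.
have [s cs eqs] := IH G1 nsNG1 cs1 ct.
have isoGG1 : (G / N / H) \isog (G / G1).
  by rewrite -defH; apply: third_isog.
exists (G1 :: s).
  have /andP[lasts pths] := cs.
  apply/andP; split=> //=; rewrite pths andbT.
  by rewrite -quotient_simple // -(isog_simple isoGG1) quotient_simple.
rewrite /= eqs defH andbA; congr (_ && _ && _).
by apply/esym; apply: (good_section_isog (U := (_ / H)%sec) (V := (G / G1)%sec)).
Qed.

Lemma pseudo_solvableP (gT : finGroupType) (G : {group gT}) s : comps G s ->
  all (@good_section _) (pairmap (@mkSec gT) G s) -> pseudo_solvable S G.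
Proof.
move=> cs /allP ok s2 cs2; apply/allP=> U Us2.
have : jordanholder.section_repr U \in mkfactors G s2 by apply: map_f.
rewrite (perm_mem (JordanHolderUniqueness cs2 cs)) => /mapP[V Vs eqUV].
rewrite -[_ || _]/(good_section U); have /good_section_isog -> : U \isog V.
  by rewrite (isog_transl _ (isog_symr (section_reprP U))) eqUV section_reprP.
exact: ok.
Qed.

Lemma pseudo_solvable_quotient (gT : finGroupType) (G N : {group gT}) :
  N <| G -> pseudo_solvable S G <->
  pseudo_solvable S (G / N)%G /\ pseudo_solvable S N.
Proof.
move=> nsNG.
have [t ct] := exists_comps N; have [s' cs'] := exists_comps (G / N)%G.
split=> [psG | [psQ psN]].
  split=> [s'' cs'' | t'' ct''].
    by have [s cs eqs] := comps_lift nsNG cs'' ct; have := psG s cs; rewrite eqs => /andP[].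
  by have [s cs eqs] := comps_lift nsNG cs' ct''; have := psG s cs; rewrite eqs => /andP[].
have [s cs eqs] := comps_lift nsNG cs' ct.
by apply: (pseudo_solvableP cs); rewrite eqs [all _ _]psQ // [all _ _]psN.
Qed.

Lemma solvable_pseudo (gT : finGroupType) (G : {group gT}) :
  solvable G -> pseudo_solvable S G.
Proof.
move=> solG s; elim: s G solG => [|H s IH] G solG //= cs.
have /andP[_ /= /andP[maxH _]] := cs.
have nsH := maxnormal_normal maxH.
rewrite IH ?(comps_cons cs) ?(solvableS (normal_sub nsH)) // andbT.
have simQ : simple (G / H) by rewrite quotient_simple.
have := simple_sol_prime (quotient_sol H solG) simQ.
by move/prime_cyclic/cyclic_abelian => ->.
Qed.

Lemma simple_pseudo (gT : finGroupType) (G : {group gT}) :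
  simple G -> pseudo_solvable S G <-> abelian G || (G \isog S).
Proof.
move=> simG.
have iso1 : G \isog (G / 1%G) by apply: quotient_isog; rewrite ?norms1 ?setI1g.
have eqok : good_section (G / 1%G)%sec = abelian G || (G \isog S).
  rewrite /good_section /= -(isog_abelian iso1); congr (_ || _).
  by rewrite -(isog_transl _ iso1).
split=> [psG | ok s cs].
  have [s cs] := exists_comps G; have := psG s cs.
  by rewrite (simple_compsP cs simG) /= andbT -eqok.
by rewrite (simple_compsP cs simG) /= andbT -[_ || _]/(good_section (G / 1%G)%sec) eqok.
Qed.

End PseudoSolvable.

(** * Coprime action on groups like PSL(2,17) and their products *)

Section CoprimeSimple.

Variable gT : finGroupType.
Implicit Types (A D H P Q C K N : {group gT}).

(** The number of fixed points of [x] on [P] is congruent to [#|P|] modulo [p], and 9 - 1, 9 - 3, 17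
    - 1 have no prime factor other than 2 and 3. *)
Lemma p_elt_cent_small_Sylow P (x : gT) p q : prime p -> p.-elt x ->
  x \in 'N(P) -> p \notin psl_primes -> q.-group P ->
  (#|P| == 9) || (#|P| == 17) -> x \in 'C(P).
Proof.
move=> pr_p px nPx np qP oP.
have act : [acts <[x]>, on P | 'J] by rewrite astabsJ cycle_subG.
have fixmod := pgroup_fix_mod (px : p.-group <[x]>) act.
have defF : 'Fix_(P | 'J)(<[x]>) = 'C_P[x].
  by rewrite afixJ cent_cycle.
rewrite defF in fixmod.
have dC : #|'C_P[x]| %| #|P| by rewrite cardSg ?subsetIl.
suffices /eqP eqC : #|'C_P[x]| == #|P|.
  have /setIidPl : 'C_P[x] = P.
    by apply/eqP; rewrite eqEcard subsetIl eqC /=.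
  by rewrite sub_cent1.
have small a b : b < a -> #|P| = a -> #|'C_P[x]| = b -> p %| a - b.
  move=> ltba oPa oCb; rewrite -eqn_mod_dvd ?(ltnW ltba) //.
  by rewrite -oPa -oCb; apply/eqP.
have np2 : ~~ (p %| 2) by apply: contra np => d2; rewrite psl_primesP pr_p (dvdn_trans d2).
have np3 : ~~ (p %| 3) by apply: contra np => d3; rewrite psl_primesP pr_p (dvdn_trans d3).
case/orP: oP => /eqP oP; rewrite oP in dC *.
  have : #|'C_P[x]| \in divisors 9 by rewrite -dvdn_divisors.
  rewrite (_ : divisors 9 = [:: 1%N; 3; 9]) // !inE => /or3P[] // /eqP oC.
    have := small 9 1%N isT oP oC; rewrite (_ : 9 - 1 = 2 ^ 3)%N // Euclid_dvdX //.
    by rewrite (negPf np2).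
  have := small 9 3 isT oP oC; rewrite (_ : 9 - 3 = 2 * 3)%N // Euclid_dvdM //.
  by rewrite (negPf np2) (negPf np3).
have : #|'C_P[x]| \in divisors 17 by rewrite -dvdn_divisors.
rewrite (_ : divisors 17 = [:: 1%N; 17]) // !inE => /orP[] // /eqP oC.
have := small 17 1%N isT oP oC; rewrite (_ : 17 - 1 = 2 ^ 4)%N // Euclid_dvdX //.
by rewrite (negPf np2).
Qed.

Lemma psl_like_nonabelian D : psl_like D -> ~~ abelian D.
Proof.
case=> simD oD _ _; apply/negP=> abD.
by have := simple_sol_prime (abelian_sol abD) simD; rewrite oD.
Qed.

(** A conjugate of [P1], of order 17, that met [C] trivially would give [17 * #|C|] elements in [D],
    too many for the index. So [C] contains all conjugates of [P1], and these generate the simple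
    group [D]. *)
Lemma psl_like_sub_index D C : psl_like D -> C \subset D -> #|D : C| < 17 ->
  17 %| #|C| -> C :=: D.
Proof.
move=> [simD oD _ _] sCD ltm dC; have pr17 : prime 17 by [].
have [P1 sylP1] := Sylow_exists 17 C; have [sP1C pP1 _] := and3P sylP1.
have sP1D := subset_trans sP1C sCD.
have ntP1 : P1 :!=: 1.
  by rewrite -cardG_gt1 (card_Hall sylP1) p_part_gt1 mem_primes pr17 cardG_gt0.
have oP1 : #|P1| = 17%N.
  have [_ dP1 [m om]] := pgroup_pdiv pP1 ntP1.
  have := cardSg sP1D; rewrite oD om; case: m {om} (om) => [|m] // om.
  by rewrite expnS expnS mulnA => /(dvdn_trans (dvdn_mulr _ (dvdnn _))).
have sPgC g : g \in D -> P1 :^ g \subset C.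
  move=> Dg; have prP : prime #|P1 :^ g| by rewrite cardJg oP1.
  apply: prime_meetG => //; apply/eqP=> ti; move: ltm.
  rewrite ltnNge -(leq_pmul2l (cardG_gt0 C)) (Lagrange sCD).
  rewrite -oP1 -(cardJg P1 g) -TI_cardMg ?subset_leq_card //; last by rewrite setIC.
  by rewrite mul_subG // conj_subG.
have [_ sim] := simpleP _ simD.
have nsD : <<class_support P1 D>> <| D.
  rewrite /normal gen_subG class_support_subG //.
  by rewrite norms_gen // class_support_norm.
have sC : <<class_support P1 D>> \subset C.
  rewrite gen_subG class_supportEr; apply/bigcupsP=> g Dg; exact: sPgC.
case: (sim _ nsD) => defD; last by apply/eqP; rewrite eqEsubset sCD -defD.
case/negP: ntP1; rewrite -subG1 -defD (subset_trans _ (subset_gen _)) //.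
by rewrite sub_class_support.
Qed.

(** By coprimality [x] normalises Sylow subgroups of orders 9 and 17, and centralises them by fixed
    point counting. The index of ['C_D[x]] thus divides 16, which is less than 17. *)
Lemma psl_coprime_cent D (x : gT) p : psl_like D -> prime p -> p.-elt x ->
  p \notin psl_primes -> x \in 'N(D) -> x \in 'C(D).
Proof.
move=> pslD pr_p px np nDx; have [simD oD _ _] := pslD.
have coDx : coprime #|D| #|<[x]>|.
  rewrite coprime_sym (pnat_coprime (px : p.-group <[x]>)) // p'natE // oD.
  by apply: contra np => d; rewrite psl_primesP pr_p.
have sDx : <[x]> \subset 'N(D) by rewrite cycle_subG.
have solx : solvable <[x]> := abelian_sol (cycle_abelian x).
have cP (q : nat) : (2448`_q)%N \in [:: 9; 17] -> (2448`_q)%N %| #|'C_D[x]|.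
  move=> oq; have [P sylP nPx] := sol_coprime_Sylow_exists q solx sDx coDx.
  have [sPD qP _] := and3P sylP; have oP := card_Hall sylP.
  have cPx : x \in 'C(P).
    apply: (p_elt_cent_small_Sylow pr_p px _ np qP); first by rewrite -cycle_subG.
    by move: oq; rewrite oP oD !inE.
  rewrite -oD -oP cardSg // subsetI sPD sub_cent1 //.
have o3 : (2448`_3 = 9)%N by rewrite p_part (_ : logn 3 2448 = 2%N) //; vm_compute.
have o17 : (2448`_17 = 17)%N by rewrite p_part (_ : logn 17 2448 = 1%N) //; vm_compute.
have d9 : 9 %| #|'C_D[x]| by rewrite -o3 cP // o3.
have d17 : 17 %| #|'C_D[x]| by rewrite -{1}o17 cP // o17.
have d153 : (9 * 17 %| #|'C_D[x]|)%N by rewrite Gauss_dvd // d9.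
have sCD : 'C_D[x] \subset D := subsetIl _ _.
suffices /setIidPl : 'C_D[x] = D by rewrite sub_cent1.
apply: psl_like_sub_index => //.
have : (#|D : 'C_D[x]| %| 16)%N.
  rewrite -(@dvdn_pmul2l #|'C_D[x]|) // Lagrange // oD.
  by rewrite (_ : 2448 = (9 * 17) * 16)%N // dvdn_pmul2r.
by move/dvdn_leq; apply.
Qed.

Lemma simple_normal_cent A D (E : {group gT}) : simple D -> ~~ abelian D -> D <| A -> E <| A ->
  #|E| = #|D| -> D :!=: E -> D \subset 'C(E).
Proof.
move=> simD nabD nsDA nsEA oE neq; have [_ sim] := simpleP _ simD.
have nsDE : D :&: E <| D.
  by apply: normalS (normalI nsDA nsEA); rewrite ?subsetIl ?normal_sub.
case: (sim _ nsDE) => /= [ti | /setIidPl sDE].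
  apply/commG1P/trivgP; rewrite -ti subsetI commg_subl commg_subr.
  rewrite (subset_trans (normal_sub nsEA) (normal_norm nsDA)).
  by rewrite (subset_trans (normal_sub nsDA) (normal_norm nsEA)).
by case/eqP: neq; apply/eqP; rewrite eqEcard sDE oE /=.
Qed.

(* If x permutes the conjugates D, D^x, ..., D^(x^(p-1)) of D, which commute
   pairwise, the diagonal subgroup of their product centralises x. *)
Lemma diagonal_subgroup A D (x : gT) p : prime p -> x \in 'N(A) ->
  simple D -> ~~ abelian D -> D <| A -> x \notin 'N(D) -> x ^+ p \in 'C(A) ->
  exists E : {group gT}, [/\ E \subset 'C_A[x], D \isog E & E <| 'C_A[x]].
Proof.
move=> pr_p nAx simD nabD nsDA nDx cxp; have [sDA nDA] := andP nsDA.
have nAxi i : x ^+ i \in 'N(A) by rewrite groupX.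
have cDxp (d : gT) : d \in A -> d ^ (x ^+ p) = d.
  by move=> Ad; apply/conjg_fixP/commgP/commute_sym; apply: (centP cxp).
have Axi (d : gT) i : d \in A -> d ^ (x ^+ i) \in A by move=> Ad; rewrite memJ_norm.
have comDi i : 0 < i < p -> D \subset 'C(D :^ (x ^+ i)).
  case/andP=> i_gt0 ltip.
  apply: (simple_normal_cent (A := A) (E := (D :^ (x ^+ i))%G)) => //.
  - by rewrite -(normP (nAxi i)) normalJ.
  - exact: cardJg.
  (* If [x ^+ i] normalised [D], so would [x], by a Bezout relation between [i] and [p], because
     [x ^+ p] centralises [A]. *)
  apply: contra nDx => /eqP/esym/normP nDxi.
  have nDxp : x ^+ p \in 'N(D).
    by rewrite (subsetP (cent_sub D)) // (subsetP (centS sDA)).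
  have co : coprime p i by rewrite prime_coprime // gtnNdvd.
  have [k l defkl _] := egcdnP p i_gt0.
  have {}defkl : (k * i = l * p + 1)%N.
    by rewrite defkl; move: co; rewrite coprime_sym => /eqnP ->.
  have : x ^+ (k * i) \in 'N(D) by rewrite mulnC expgM groupX.
  by rewrite defkl expgD expg1 groupMl // mulnC expgM groupX.
have comij (a b : gT) i : a \in D -> b \in D -> 0 < i < p -> commute a (b ^ (x ^+ i)).
  by move=> Da Db /comDi/subsetP/(_ a Da)/centP; apply; rewrite memJ_conjg.
have comij2 (a b : gT) i j : a \in D -> b \in D -> i < j < p ->
    commute (a ^ (x ^+ i)) (b ^ (x ^+ j)).
  move=> Da Db /andP[ltij ltjp]; have := comij a b (j - i)%N Da Db.
  rewrite subn_gt0 ltij (leq_ltn_trans (leq_subr _ _) ltjp) => /(_ isT).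
  rewrite /commute => com; rewrite -{1 2}(subnK (ltnW ltij)) expgD conjgM.
  by rewrite -!conjMg com.
pose phi n (d : gT) := \prod_(i < n) d ^ (x ^+ i).
have phiS n d : phi n.+1 d = phi n d * d ^ (x ^+ n) by rewrite /phi big_ord_recr.
have comphi n (a b : gT) : a \in D -> b \in D -> n < p ->
    commute (phi n a) (b ^ (x ^+ n)).
  move=> Da Db ltnp; apply: commute_sym; rewrite /phi.
  apply: big_ind => [|u v cu cv|i _]; first exact: commute1.
    exact: commuteM.
  by apply: commute_sym; apply: comij2; rewrite ?ltn_ord.
have phiM n : n <= p -> {in D &, {morph phi n : a b / a * b}}.
  elim: n => [|n IH] lenp a b Da Db; first by rewrite /phi !big_ord0 mulg1.
  rewrite !phiS IH ?(ltnW lenp) // conjMg; have := comphi n b a Db Da lenp.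
  move: (phi n a) (phi n b) (a ^ _) (b ^ _) => u v w t cvw.
  by rewrite -!mulgA; congr (_ * _); rewrite !mulgA; congr (_ * _).
pose f := Morphism (phiM p (leqnn p)).
have fE d : f d = phi p d by [].
have phi1 (d : gT) : d \in D -> phi p d = d * \prod_(i < p.-1) d ^ (x ^+ i.+1).
  by rewrite /phi -(prednK (prime_gt0 pr_p)) big_ord_recl /= expg0 conjg1.
have comtl (a d : gT) : a \in D -> d \in D ->
    commute a (\prod_(i < p.-1) d ^ (x ^+ i.+1)).
  move=> Da Dd; apply: big_ind => [|u v cu cv|i _]; first exact: commute1.
    exact: commuteM.
  by apply: comij; rewrite //= -[p in _ < p](prednK (prime_gt0 pr_p)) ltnS.
(* If [f d = 1], then [d] is the inverse of a product of conjugates that commute with [D], so it is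
   central in the nonabelian simple group [D]. *)
have injf : 'injm f.
  apply/subsetP=> d /morphpreP[Dd /set1P fd1].
  have Zd : d \in 'Z(D).
    rewrite inE Dd; apply/centP=> a Da.
    move: fd1; rewrite fE phi1 // => /eqP; rewrite -eq_invg_mul => /eqP eqd.
    by apply: commute_sym; rewrite -[d]invgK eqd; apply/commuteV/comtl.
  have [_ sim] := simpleP _ simD.
  case: (sim _ (center_normal D)) => defZ; last first.
    by case/negP: nabD; rewrite -[X in abelian X]defZ center_abelian.
  by have := Zd; rewrite -['Z(D)]/(gval 'Z(D)%G) defZ.
have fx d : d \in D -> f d ^ x = f d.
  move=> Dd; rewrite !fE [in RHS]phi1 // comtl // /phi.
  rewrite (big_morph (conjg^~ x) (fun a b => conjMg a b x) (conj1g x)).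
  rewrite (eq_bigr (fun i : 'I_p => d ^ (x ^+ i.+1))) => [|i _]; last first.
    by rewrite -conjgM -expgSr.
  rewrite -[in LHS](prednK (prime_gt0 pr_p)) big_ord_recr /=.
  by rewrite (prednK (prime_gt0 pr_p)) cDxp // (subsetP sDA).
have fA d : d \in D -> f d \in A.
  by move=> Dd; apply: group_prod => i _; rewrite Axi // (subsetP sDA).
have fC d : d \in D -> f d \in 'C_A[x].
  by move=> Dd; rewrite inE fA //; apply/cent1P/commgP/conjg_fixP; rewrite fx.
have sEC : f @* D \subset 'C_A[x].
  by apply/subsetP=> _ /morphimP[d _ Dd ->]; apply: fC.
exists (f @* D)%G; split=> //; first by apply/isogP; exists f.
rewrite /normal sEC; apply/subsetP=> c /setIP[Ac /cent1P cxc].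
rewrite inE; apply/subsetP=> _ /imsetP[_ /morphimP[d _ Dd ->] ->].
have Ddc : d ^ c \in D by rewrite memJ_norm ?(subsetP nDA).
have -> : f d ^ c = f (d ^ c).
  rewrite !fE (big_morph (conjg^~ c) (fun a b => conjMg a b c) (conj1g c)).
  apply: eq_bigr => i _; rewrite -!conjgM; congr (_ ^ _).
  by apply: commute_sym; apply: commuteX.
exact: mem_morphim.
Qed.

(* Descending along a chain of subgroups of prime index in Q. *)
Lemma psl_coprime_centraliser n A D Q : #|Q| <= n -> solvable Q ->
  Q \subset 'N(A) -> coprime #|A| #|Q| -> psl_like D -> D <| A ->
  (forall p, p \in \pi(Q) -> p \notin psl_primes) ->
  exists E : {group gT}, [/\ E \subset 'C_A(Q), D \isog E & E <| 'C_A(Q)].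
Proof.
elim: n Q => [|n IH] Q; first by rewrite leqNgt cardG_gt0.
move=> leQn solQ nAQ coAQ pslD nsDA piQ.
have [Q1 | ntQ] := eqVneq (Q : {set gT}) 1.
  rewrite Q1 cent1T setIT; exists D; split=> //; [exact: normal_sub | exact: isog_refl].
have [Q0 nsQ0 pr_p] := sol_prime_factor_exists solQ ntQ.
set p := #|Q : Q0| in pr_p.
have sQ0Q := normal_sub nsQ0.
have ltQ0 : #|Q0| < #|Q|.
  by rewrite -(Lagrange sQ0Q) -[X in X < _]muln1 ltn_pmul2l ?cardG_gt0 ?prime_gt1.
have [|||||E0 [sE0C isoE0 nsE0]] := IH Q0 _ _ _ _ pslD nsDA.
- by rewrite -ltnS (leq_trans ltQ0).
- exact: solvableS solQ.
- exact: subset_trans nAQ.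
- exact: coprimegS coAQ.
- move=> q /(piSg sQ0Q); exact: piQ.
have pslE0 := psl_like_isog isoE0 pslD.
have pQ : p \in \pi(Q) by rewrite mem_primes pr_p cardG_gt0 dvdn_indexg.
have np := piQ p pQ.
have [x [Qx px nQ0x xp]] : exists x, [/\ x \in Q, p.-elt x, x \notin Q0 & x ^+ p \in Q0].
  have oQQ0 : #|Q / Q0| = p by rewrite card_quotient ?normal_norm.
  have [xb Qxb oxb] : {x | x \in Q / Q0 & #[x] = p}.
    by apply: Cauchy; rewrite // oQQ0.
  case/morphimP: Qxb oxb => z Nz Qz -> /= oz.
  have cz : coset Q0 z.`_p = coset Q0 z.
    by rewrite morph_constt // constt_p_elt // order_p_elt.
  have [x defx] : exists x, x = z.`_p by exists z.`_p.
  rewrite -defx in cz; exists x.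
  have Qx : x \in Q by rewrite defx groupX.
  have nQ0x : x \in 'N(Q0) := subsetP (normal_norm nsQ0) x Qx.
  split=> //; first by rewrite defx p_elt_constt.
    apply: contraTN (prime_gt1 pr_p) => Q0x.
    by rewrite -oz -cz coset_id // order1.
  by apply: coset_idr; rewrite ?groupX // morphX //= cz -oz expg_order.
have defQ : Q :=: Q0 <*> <[x]>.
  rewrite norm_joinEr ?cycle_subG ?(subsetP (normal_norm nsQ0)) //.
  apply/esym/mulg_normal_maximal; rewrite ?p_index_maximal ?cycle_subG //.
pose C0 := 'C_A(Q0)%G.
have defC : 'C_A(Q) = 'C_C0[x].
  by rewrite defQ centY cent_cycle setIA.
have nC0x : x \in 'N(C0).
  rewrite -cycle_subG normsI ?norms_cent //; rewrite cycle_subG.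
    exact: (subsetP nAQ).
  exact: (subsetP (normal_norm nsQ0)).
have cxp : x ^+ p \in 'C(C0).
  by rewrite (subsetP _ _ xp) // centsC subsetIr.
have [simE0 _ _ _] := pslE0.
have nabE0 := psl_like_nonabelian pslE0.
rewrite defC; have [nE0x | nE0x] := boolP (x \in 'N(E0)).
  have cx := psl_coprime_cent pslE0 pr_p px np nE0x.
  have sE0 : E0 \subset 'C_C0[x] by rewrite subsetI sE0C sub_cent1.
  by exists E0; split=> //; apply: normalS nsE0; rewrite ?subsetIl.
have [E [sE isoE nsE]] := diagonal_subgroup pr_p nC0x simE0 nabE0 nsE0 nE0x cxp.
by exists E; split=> //; apply: isog_trans isoE.
Qed.

End CoprimeSimple.

(** [A] is a direct product of images of a simple [H] under automorphisms. A factor is normal, and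
    so is [H], its preimage under an automorphism; all factors have the same order. *)
Lemma charsimple_normal_factor (gT : finGroupType) (A : {group gT}) :
  charsimple A -> ~~ solvable A ->
  exists H : {group gT},
    [/\ H <| A, simple H, ~~ abelian H & {subset \pi(A) <= \pi(H)}].
Proof.
move=> charA nsolA; have [ntA simA] := charsimpleP A charA.
have [H [sHA simH [I AutI defA]]] := charsimple_dprod charA.
have nsHA : H <| A.
  have [f If] : exists f, f \in I.
    have [I0 | [f If]] := set_0Vmem I; last by exists f.
    by case/negP: ntA; rewrite -defA I0 big_set0.
  have Af := subsetP AutI f If.
  have imH : autm Af @* H = f @: H by rewrite morphimEsub.
  move: defA; rewrite (bigD1 f) //= => /dprodP[[B1 B2 defB1 defB2] defA cB ti].
  rewrite -(injm_normal (injm_autm Af)) // im_autm imH.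
  have: B1 \x B2 = A by rewrite dprodE // -?defB1 -?defB2.
  by case/dprod_normal2; rewrite defB1.
exists H; split=> //.
  apply: contra nsolA => abH.
  have ntF : 'F(A) != 1.
    have [ntH _] := simpleP _ simH; apply: contraNneq ntH => F1; rewrite -subG1 -F1.
    by apply: Fitting_max => //; apply: abelian_nil.
  rewrite -(simA _ ntF (Fitting_char A)).
  exact: nilpotent_sol (Fitting_nil A).
move=> p; rewrite !mem_primes !cardG_gt0 /= => /andP[pr_p].
rewrite -(bigdprod_card defA) Euclid_dvd_prod // pr_p /=.
elim/big_ind: _ => // [a b ha hb /orP[] //|f _].
by rewrite card_imset //; apply: perm_inj.
Qed.

Section MinimalCover.

Variables (hT : finGroupType) (S : {group hT}).
Hypothesis pslS : psl_like S.

(** Modulo [P] only the primes 3 and 17 remain, so Burnside's theorem on orders p^a q^b applies. *)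
Lemma norm_Sylow2_solvable (gT : finGroupType) (A P : {group gT}) :
  {subset \pi(A) <= psl_primes} -> 2.-Sylow(A) P -> solvable 'N_A(P).
Proof.
move=> piA sylP; have [sPA twoP p'P] := and3P sylP.
have nsPN : P <| 'N_A(P) by rewrite normal_subnorm.
rewrite (series_sol nsPN) (pgroup_sol twoP) /=.
apply: Burnside_p_a_q_b; apply: (@leq_trans (size [:: 3; 17])) => //.
apply: uniq_leq_size; first exact: primes_uniq.
move=> q; rewrite mem_primes => /and3P[pr_q _ qd].
have oq : q %| #|A : P|.
  apply: dvdn_trans qd _; rewrite card_quotient ?normal_norm //.
  by rewrite indexSg ?subsetIl // subsetI sPA normG.
have : q \in psl_primes.
  apply: piA; rewrite mem_primes pr_q cardG_gt0 (dvdn_trans oq) //.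
  exact: dvdn_indexg.
rewrite !inE => /or3P[/eqP q2 | -> // | ->]; last by rewrite orbT.
by move: p'P; rewrite q2 in oq; rewrite p'natE // oq.
Qed.

(* K is obtained from G by replacing each chief factor of type S^n, except one,
   by the normaliser of a Sylow 2-subgroup. *)
Lemma exists_cover n (gT : finGroupType) (G : {group gT}) : #|G| <= n ->
  pseudo_solvable S G -> ~~ solvable G ->
  exists K N : {group gT}, [/\ K \subset G, N <| K, solvable N,
    S \isog (K / N) & {subset \pi(G) <= \pi(K)}].
Proof.
elim: n gT G => [|n IH] gT G; first by rewrite leqNgt cardG_gt0.
move=> leGn psG nsolG.
have ntG : G :!=: 1 by apply: contraNneq nsolG => ->; apply: solvable1.
have [A minA sAG] := minnormal_exists ntG (normG G).
have /andP[ntA nAG] := mingroupp minA.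
have nsAG : A <| G by rewrite /normal sAG.
have [psQ psA] := (pseudo_solvable_quotient S nsAG).1 psG.
have ltQ : #|G / A| <= n by rewrite -ltnS (leq_trans _ leGn) // ltn_quotient.
have [pr_S oS] : {subset psl_primes <= \pi(S)} /\ #|S| = 2448%N.
  have [_ oS _ _] := pslS; split=> // q; rewrite psl_primesP => /andP[pr_q qd].
  by rewrite mem_primes pr_q cardG_gt0 /= oS.
have pi_cover (K N : {group gT}) : N <| K -> S \isog (K / N) ->
    {subset psl_primes <= \pi(K)}.
  move=> nsNK iso q /pr_S; rewrite !mem_primes !cardG_gt0 /= => /andP[-> qS].
  by rewrite (dvdn_trans _ (dvdn_quotient K N)) // -(card_isog iso).
have liftK (K' N' : {group coset_of A}) : K' \subset G / A -> N' <| K' ->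
    S \isog (K' / N') ->
    let K0 := (coset A @*^-1 K')%G in let N0 := (coset A @*^-1 N')%G in
    [/\ A \subset N0, K0 \subset G, N0 <| K0, S \isog (K0 / N0)
      & K0 / A = K' /\ N0 / A = N'].
  move=> sK' nsN' iso K0 N0.
  have nsN0 : N0 <| K0 by rewrite cosetpre_normal.
  have sAN0 : A \subset N0 by rewrite -{1}(ker_coset A) morphpreS ?sub1G.
  have sAK0 : A \subset K0 := subset_trans sAN0 (normal_sub nsN0).
  split; rewrite ?cosetpreK //; first by rewrite sub_cosetpre_quo.
  apply: isog_trans iso _; rewrite isog_sym.
  have nsAK0 : A <| K0.
    by rewrite /normal sAK0 (subset_trans _ nAG) // sub_cosetpre_quo.
  have nsAN0 : A <| N0 by rewrite (normalS sAN0 (normal_sub nsN0)).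
  have eqK : (K0 / A)%G = K' by apply: val_inj; rewrite /= cosetpreK.
  have eqN : (N0 / A)%G = N' by apply: val_inj; rewrite /= cosetpreK.
  by rewrite -eqK -eqN isog_sym; apply: third_isog.
have [solA | nsolA] := boolP (solvable A).
  have nsolQ : ~~ solvable (G / A) by apply: contra nsolG; rewrite (series_sol nsAG) solA.
  have [K' [N' [sK' nsN' solN' iso piK']]] := IH _ _ ltQ psQ nsolQ.
  have [sAN0 sK0G nsN0 isoK0 [defK' defN']] := liftK _ _ sK' nsN' iso.
  set K0 := (coset A @*^-1 K')%G in sK0G nsN0 isoK0 defK'.
  set N0 := (coset A @*^-1 N')%G in sAN0 nsN0 isoK0 defN'.
  exists K0, N0; split=> //.
    have nsAN0 : A <| N0.
      by apply: normalS nsAG; rewrite ?(subset_trans (normal_sub nsN0)).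
    by rewrite (series_sol nsAN0) solA defN'.
  have sAK0 := subset_trans sAN0 (normal_sub nsN0).
  move=> p; rewrite mem_primes => /and3P[pr_p _] /=.
  rewrite -(Lagrange sAG) -card_quotient // Euclid_dvdM // => /orP[pA | pQ].
    by rewrite mem_primes pr_p cardG_gt0 (dvdn_trans pA) ?cardSg.
  have : p \in \pi(K') by apply: piK'; rewrite mem_primes pr_p cardG_gt0.
  have dK : #|K'| %| #|K0| by rewrite -defK' dvdn_quotient.
  rewrite !mem_primes !cardG_gt0 pr_p => /dvdn_trans; exact.
have [H [nsHA simH nabH piHA]] :=
  charsimple_normal_factor (minnormal_charsimple minA) nsolA.
have isoH : S \isog H.
  have [_ psH] := (pseudo_solvable_quotient S nsHA).1 psA.
  have [/idPn[] // | ] := orP ((simple_pseudo S simH).1 psH).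
  by rewrite isog_sym.
have piA : {subset \pi(A) <= psl_primes}.
  move=> q /piHA; rewrite mem_primes psl_primesP => /and3P[-> _] /=.
  by rewrite -(card_isog isoH) oS.
have piG p : p \in \pi(G) -> p \notin psl_primes -> p \in \pi(G / A).
  rewrite !mem_primes !cardG_gt0 /= => /andP[pr_p].
  rewrite -(Lagrange sAG) -card_quotient // Euclid_dvdM // => /orP[pA np | -> //].
    by case/negP: np; apply: piA; rewrite mem_primes pr_p cardG_gt0.
  by rewrite pr_p.
have [solQ | nsolQ] := boolP (solvable (G / A)).
  (* [A] contains the factor to be kept. By Schur-Zassenhaus, a Hall subgroup of [G / A] for the
     primes other than 2, 3, 17 lifts to a complement [Q] of [A] in its preimage. [Q] centralises a
     copy [E] of [S] in [A], and the cover is the direct product of [E] and [Q]. *)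
  have [M hallM] := Hall_exists [predC psl_primes] solQ.
  have [sMQ piM _] := and3P hallM.
  pose M0 := (coset A @*^-1 M)%G.
  have sM0G : M0 \subset G by rewrite sub_cosetpre_quo.
  have sAM0 : A \subset M0 by rewrite -{1}(ker_coset A) morphpreS ?sub1G.
  have nsAM0 : A <| M0 by rewrite (normalS sAM0 sM0G).
  have defM : M0 / A = M by rewrite /= cosetpreK.
  have coAM : coprime #|A| #|M|.
    rewrite coprime_sym; apply: pnat_coprime piM _.
    apply/pgroupP=> q pr_q qA; have: q \in psl_primes.
      by apply: piA; rewrite mem_primes pr_q cardG_gt0.
    by move=> psl_q; apply/negP=> /negP; rewrite psl_q.
  have hallA : Hall M0 A.
    by rewrite /Hall sAM0 -card_quotient ?normal_norm // defM.
  have /splitsP[Q /complP[tiAQ defM0]] : [splits M0, over A].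
    exact: SchurZassenhaus_split.
  have sQM0 : Q \subset M0 by rewrite -defM0 mulG_subr.
  have nAQ : Q \subset 'N(A) := subset_trans sQM0 (normal_norm nsAM0).
  have isoQ : Q \isog M.
    rewrite -defM -defM0 quotientMidl.
    by apply: quotient_isog; rewrite // setIC.
  have oQ : #|Q| = #|M| := card_isog isoQ.
  have solQg : solvable Q.
    by rewrite (isog_sol isoQ) (solvableS sMQ).
  have coAQ : coprime #|A| #|Q| by rewrite oQ.
  have piQ p : p \in \pi(Q) -> p \notin psl_primes.
    by rewrite /= oQ => /(pnatPpi piM).
  have [E [sE isoE nsE]] := psl_coprime_centraliser (leqnn _) solQg nAQ coAQ
    (psl_like_isog isoH pslS) nsHA piQ.
  have [sEA cEQ] : E \subset A /\ E \subset 'C(Q) by apply/andP; rewrite -subsetI.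
  have tiEQ : E :&: Q = 1.
    by apply/trivgP; rewrite -tiAQ setSI.
  have nsQK : Q <| E <*> Q.
    by rewrite /normal joing_subr join_subG normG cents_norm.
  exists (E <*> Q)%G, Q; split=> //.
  - by rewrite join_subG !(subset_trans _ sM0G) // (subset_trans sEA).
  - rewrite /= cent_joinEl // quotientMidr.
    apply: isog_trans isoH _; apply: isog_trans isoE _.
    by apply: quotient_isog; rewrite ?cents_norm // setIC.
  move=> p pG; have [psl_p | np] := boolP (p \in psl_primes).
    apply: (piSg (joing_subl E Q)); rewrite /= -(card_isog isoE).
    by rewrite -(card_isog isoH) pr_S.
  apply: (piSg (joing_subr E Q)); rewrite /= oQ.
  exact: (pi_Hall hallM) (piG p pG np).
have [K' [N' [sK' nsN' solN' iso piK']]] := IH _ _ ltQ psQ nsolQ.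
have [sAN0 sK0G nsN0 isoK0 [defK' defN']] := liftK _ _ sK' nsN' iso.
set K0 := (coset A @*^-1 K')%G in sK0G nsN0 isoK0 defK'.
set N0 := (coset A @*^-1 N')%G in sAN0 nsN0 isoK0 defN'.
have sAK0 := subset_trans sAN0 (normal_sub nsN0).
have nsAK0 : A <| K0 := normalS sAK0 sK0G nsAG.
(* The kept factor lies above [A]. By the Frattini argument the normaliser of [P] in [K0] covers
   [K0 / A], while it meets [A] in the solvable group ['N_A(P)]. No prime is lost, since those of
   [A] divide [#|S|]. *)
have [P sylP] := Sylow_exists 2 A.
have frat := Frattini_arg nsAK0 sylP.
have defN : N0 :&: 'N_K0(P) = 'N_N0(P).
  by rewrite setIA (setIidPl (normal_sub nsN0)).
have nsN : 'N_N0(P) <| 'N_K0(P).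
  by rewrite -defN setIC (normalGI _ nsN0) // subsetIl.
have sNA : A :&: 'N_N0(P) = 'N_A(P) by rewrite setIA (setIidPl sAN0).
have isoK : S \isog ('N_K0(P) / 'N_N0(P)).
  apply: isog_trans isoK0 _.
  have nNK : 'N_K0(P) \subset 'N(N0) by rewrite (subset_trans (subsetIl _ _)) // normal_norm.
  rewrite /= (_ : K0 / N0 = 'N_K0(P) / N0); last first.
    have sKN : A * 'N_K0(P) \subset N0 * 'N_K0(P) by rewrite mulSg.
    have /eqP eqK0 : N0 * 'N_K0(P) == K0.
      by rewrite eqEsubset mul_subG ?subsetIl ?(normal_sub nsN0) // -{1}frat.
    by rewrite -(quotientMidl N0 'N_K0(P)) eqK0.
  by rewrite isog_sym -defN; apply: second_isog.
exists 'N_K0(P)%G, 'N_N0(P)%G; split=> //.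
- by rewrite (subset_trans (subsetIl _ _)).
- have nAN : 'N_N0(P) \subset 'N(A).
    by rewrite (subset_trans _ nAG) // (subset_trans (subsetIl _ _)) //
               (subset_trans (normal_sub nsN0)).
  have nsA1 : A :&: 'N_N0(P) <| 'N_N0(P) by rewrite setIC norm_normalI.
  rewrite (series_sol nsA1) /= {1}sNA (norm_Sylow2_solvable piA sylP) /=.
  rewrite (isog_sol (second_isog nAN)).
  by apply: solvableS solN'; rewrite -defN' quotientS // subsetIl.
move=> p pG; have [psl_p | np] := boolP (p \in psl_primes).
  exact: pi_cover nsN isoK p psl_p.
have := piK' p (piG p pG np); rewrite !mem_primes !cardG_gt0 /= => /andP[-> pK'] /=.
have defKA : 'N_K0(P) / A = K' by rewrite -quotientMidl frat.
by apply: dvdn_trans pK' _; rewrite -{1}defKA dvdn_quotient.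
Qed.

End MinimalCover.

(** * Triangles and colorings for an extension of PSL(2,17) *)

Section CoverColoring.

Variables (gT : finGroupType) (K N : {group gT}).
Hypotheses (nsNK : N <| K) (pslK : psl_like (K / N)) (solN : solvable N).
Implicit Types p q r : nat.

Lemma cover_out_color0 p q : p \notin psl_primes -> q \in psl_primes ->
  nadj K p q -> out_color N p = inord 0.
Proof.
move=> np psl_q npq; have no r := cover_no_out nsNK pslK r np psl_q npq.
have has0 a (s : seq nat) : (forall r, ~~ a r) -> has a s = false.
  by move=> a0; apply/hasP=> -[r _]; apply/negP.
by rewrite /out_color /has_out2 /has_out !has0 // => r; rewrite (negPf (no r)).
Qed.

(** A pair containing 2 is excluded by the Klein four-group argument; what remains is the pair 3,
    17, excluded by the trace argument. *)
Lemma cover_triangle1 p q r : p \in \pi(K) -> p \notin psl_primes ->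
  q \in psl_primes -> r \in psl_primes -> q != r ->
  nadj K q p -> nadj K r p -> nadj K q r -> False.
Proof.
move=> pK np.
wlog ltqr: q r / q < r.
  move=> IH psl_q psl_r neq nqp nrp nqr.
  have [ltqr | ltrq | eqr] := ltngtP q r; first exact: (IH q r).
    by apply: (IH r q) => //; rewrite 1?eq_sym // nadjC.
  by rewrite eqr eqxx in neq.
move=> psl_q psl_r neq nqp nrp nqr.
have [q2 | nq2] := eqVneq q 2.
  rewrite q2 in nqp nqr neq.
  by have := cover_nadj2F nsNK pslK pK np nqp psl_r; rewrite eq_sym neq nqr => /(_ isT).
have [q3 r17] : q = 3 /\ r = 17.
  move: psl_q psl_r nq2 ltqr; rewrite !inE => /or3P[]/eqP-> /or3P[]/eqP-> //.
rewrite q3 r17 in nqp nrp nqr.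
by apply: (cover_nadj3F nsNK pslK pK np); [| | left].
Qed.

(** Neither [p] nor [r] has an outgoing arrow in [N], whereas [p ~ r] would provide an arrow between
    them. *)
Lemma cover_triangle2 p q r : p \in \pi(K) -> r \in \pi(K) ->
  p \notin psl_primes -> r \notin psl_primes -> q \in psl_primes -> p != r ->
  nadj K p q -> nadj K r q -> nadj K p r -> False.
Proof.
move=> pK rK np nr psl_q neq npq nrq npr.
have := arrow_total solN (cover_pi nsNK pslK pK np) (cover_pi nsNK pslK rK nr) neq.
rewrite (nadjS (normal_sub nsNK) npr) => /(_ isT).
by rewrite (negPf (cover_no_out nsNK pslK r np psl_q npq))
           (negPf (cover_no_out nsNK pslK p nr psl_q nrq)).
Qed.

Lemma cover_triangle p q r : p \in \pi(K) -> q \in \pi(K) -> r \in \pi(K) ->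
  p != q -> q != r -> p != r -> nadj K p q -> nadj K q r -> nadj K p r ->
  [/\ p \in psl_primes, q \in psl_primes & r \in psl_primes].
Proof.
move=> pK qK rK npq nqr npr apq aqr apr.
have [aqp arq arp] : [/\ nadj K q p, nadj K r q & nadj K r p].
  by split; rewrite nadjC.
have [hp | hp] := boolP (p \in psl_primes); have [hq | hq] := boolP (q \in psl_primes);
  have [hr | hr] := boolP (r \in psl_primes) => //; exfalso.
- exact: (cover_triangle1 rK hr hp hq).
- exact: (cover_triangle1 qK hq hp hr).
- exact: (cover_triangle2 qK rK hq hr hp).
- exact: (cover_triangle1 pK hp hq hr).
- exact: (cover_triangle2 pK rK hp hr hq).
- exact: (cover_triangle2 pK qK hp hq hr).
have sN := nadjS (normal_sub nsNK); have piN := cover_pi nsNK pslK.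
by apply: (solvable_no_triangle solN) (sN _ _ apq) (sN _ _ aqr) (sN _ _ apr);
  rewrite ?piN.
Qed.

Lemma cover_triangle_isolated p q :
  nadj K 2 3 -> nadj K 2 17 -> nadj K 3 17 -> p \in \pi(K) -> p \notin psl_primes ->
  q \in pred2 2 3 -> ~~ nadj K q p.
Proof.
move=> n23 n217 n317 pK np /pred2P[]->; apply/negP=> nqp.
  by have /negP[] := cover_nadj2F nsNK pslK pK np nqp (q := 3) isT isT.
apply: (cover_nadj3F nsNK pslK pK np nqp n317); right.
by rewrite nadjC.
Qed.

Definition cover_color (kappa : nat -> 'I_3) p :=
  if p \in psl_primes then kappa p else out_color N p.

Lemma cover_color_proper kappa p q :
  (forall q r, q \in psl_primes -> r \in psl_primes -> q != r -> nadj K q r ->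
     kappa q != kappa r) ->
  (forall p q, p \in \pi(K) -> p \notin psl_primes -> q \in psl_primes ->
     nadj K p q -> kappa q != inord 0) ->
  p \in \pi(K) -> q \in \pi(K) -> p != q -> nadj K p q ->
  cover_color kappa p != cover_color kappa q.
Proof.
move=> hpsl hmix pK qK neq npq; rewrite /cover_color.
have [hp | hp] := boolP (p \in psl_primes); have [hq | hq] := boolP (q \in psl_primes).
- exact: hpsl.
- have nqp : nadj K q p by rewrite nadjC.
  by rewrite (cover_out_color0 hq hp nqp) (hmix q p).
- by rewrite (cover_out_color0 hp hq npq) eq_sym (hmix p q).
by apply: out_color_proper; rewrite ?(cover_pi nsNK pslK) // (nadjS (normal_sub nsNK)).
Qed.

(** By [cover_out_color0], the outside primes related to 2, 3 or 17 have color 0. It remains to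
    color 2, 3, 17 by some [kappa] that avoids 0 wherever there is an outside neighbor. In a
    triangle 3 has none and takes 0; otherwise the colors 1 and 2 suffice. *)
Lemma cover_3coloring : exists col : nat -> 'I_3,
  (forall p q, p \in \pi(K) -> q \in \pi(K) -> p != q -> nadj K p q -> col p != col q) /\
  (forall p q r, p \notin psl_primes -> q \notin psl_primes -> r \in psl_primes ->
     nadj K p r -> nadj K q r -> col p = col q).
Proof.
suffices [kappa hpsl hmix]: exists2 kappa : nat -> 'I_3,
    forall q r, q \in psl_primes -> r \in psl_primes -> q != r -> nadj K q r ->
      kappa q != kappa r &
    forall p q, p \in \pi(K) -> p \notin psl_primes -> q \in psl_primes ->
      nadj K p q -> kappa q != inord 0.
  exists (cover_color kappa); split=> [p q|p q r np nq psl_r npr nqr].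
    exact: cover_color_proper.
  by rewrite /cover_color (negPf np) (negPf nq) !(@cover_out_color0 _ r).
have I3_neq i j : i < 3 -> j < 3 -> i != j -> inord i != inord j :> 'I_3.
  by move=> lti ltj; rewrite -val_eqE /= !inordK.
have [/and3P[n23 n217 n317] | ntri] := boolP [&& nadj K 2 3, nadj K 2 17 & nadj K 3 17].
  exists (fun q => inord (if q == 2 then 2 else if q == 3 then 0 else 1%N)) => [q r|p q pK np].
    by rewrite !inE => /or3P[]/eqP-> /or3P[]/eqP-> //= _ _; apply: I3_neq.
  rewrite nadjC => psl_q nqp.
  have := contraL (cover_triangle_isolated n23 n217 n317 pK np (q := q)) nqp.
  rewrite !inE negb_or => /andP[/negPf-> /negPf->]; exact: I3_neq.
(* Without a triangle, some [m] meets every relation among 2, 3, 17; it takes color 1, the other two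
   share color 2. *)
have [m mP] : exists m, forall q r, q \in psl_primes -> r \in psl_primes ->
    q != m -> r != m -> q != r -> ~~ nadj K q r.
  have [n23 | n23] := boolP (nadj K 2 3); last first.
    exists 17 => q r; rewrite !inE.
    by move=> /or3P[]/eqP-> /or3P[]/eqP-> //; rewrite nadjC.
  have [n217 | n217] := boolP (nadj K 2 17); last first.
    exists 3 => q r; rewrite !inE.
    by move=> /or3P[]/eqP-> /or3P[]/eqP-> //; rewrite nadjC.
  exists 2 => q r; rewrite n23 n217 /= in ntri; rewrite !inE.
  by move=> /or3P[]/eqP-> /or3P[]/eqP-> //; rewrite nadjC.
exists (fun q => inord (if q == m then 1%N else 2)) => [q r hq hr neq|p q pK np _ _].
  have [eqm | qm] := eqVneq q m; have [rm | rm] := eqVneq r m.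
  - by rewrite eqm rm eqxx in neq.
  - by move=> _; apply: I3_neq.
  - by move=> _; apply: I3_neq.
  by rewrite (negPf (mP q r hq hr qm rm neq)).
by case: (q == m); apply: I3_neq.
Qed.

End CoverColoring.

Section PrimeGraphOnly.

Variables (hT : finGroupType) (S : {group hT}).
Hypothesis pslS : psl_like S.

Lemma prime_graph_coloring (gT : finGroupType) (G : {group gT}) :
  pseudo_solvable S G ->
  exists2 col : nat -> 'I_3,
    forall p q, p \in \pi(G) -> q \in \pi(G) -> p != q -> nadj G p q -> col p != col q
  & (forall p q r, p \in \pi(G) -> q \in \pi(G) -> r \in \pi(G) ->
      p != q -> q != r -> p != r -> nadj G p q -> nadj G q r -> nadj G p r -> False)
    \/ [/\ forall p, p \in psl_primes -> p \in \pi(G),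
          forall p q, p \in psl_primes -> q \in psl_primes -> p != q -> nadj G p q,
          forall p q r, p \in \pi(G) -> q \in \pi(G) -> r \in \pi(G) ->
            p != q -> q != r -> p != r -> nadj G p q -> nadj G q r -> nadj G p r ->
            [/\ p \in psl_primes, q \in psl_primes & r \in psl_primes],
          forall p q, p \in \pi(G) -> p \notin psl_primes -> q \in pred2 2 3 ->
            ~~ nadj G q p
        & forall p q, p \notin psl_primes -> q \notin psl_primes ->
            nadj G p 17 -> nadj G q 17 -> col p = col q].
Proof.
move=> psG; have [solG | nsolG] := boolP (solvable G).
  exists (out_color G) => [p q | ]; first exact: out_color_proper.
  by left=> p q r; apply: solvable_no_triangle.
have [K [N [sKG nsNK solN iso piGK]]] := exists_cover pslS (leqnn _) psG nsolG.
have pslK := psl_like_isog iso pslS; have nGK := nadjS sKG.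
have [col [colP col17]] := cover_3coloring nsNK pslK solN.
exists col => [p q pG qG neq npq|].
  by apply: colP; rewrite ?piGK // nGK.
have triG p q r : p \in \pi(G) -> q \in \pi(G) -> r \in \pi(G) ->
    p != q -> q != r -> p != r -> nadj G p q -> nadj G q r -> nadj G p r ->
    [/\ p \in psl_primes, q \in psl_primes & r \in psl_primes].
  move=> pG qG rG npq nqr npr apq aqr apr.
  by apply: (cover_triangle nsNK pslK solN); rewrite ?piGK // nGK.
have [/and3P[n23 n217 n317] | ntri] := boolP [&& nadj G 2 3, nadj G 2 17 & nadj G 3 17].
  right; split=> // [p psl_p|p q|p q pG np q23|p q np nq n1 n2].
  - exact: (piSg sKG) (cover_psl_pi pslK psl_p).
  - by rewrite !inE => /or3P[]/eqP-> /or3P[]/eqP-> // _; rewrite nadjC.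
  - apply: contra (cover_triangle_isolated nsNK pslK (nGK _ _ n23) (nGK _ _ n217)
      (nGK _ _ n317) (piGK p pG) np q23); exact: nGK.
  by apply: (col17 p q 17); rewrite ?nGK.
left=> p q r pG qG rG npq nqr npr apq aqr apr.
case/negP: ntri; have [] := triG p q r pG qG rG npq nqr npr apq aqr apr.
have [aqp arq arp] : [/\ nadj G q p, nadj G r q & nadj G r p].
  by split; rewrite nadjC.
rewrite !inE => /or3P[]/eqP ep /or3P[]/eqP eq /or3P[]/eqP er; subst p q r; 
 do ?[by case/eqP: npq | by case/eqP: nqr | by case/eqP: npr]; exact/and3P.
Qed.

End PrimeGraphOnly.

(** * Transfer of the restrictions to the abstract graph *)

Section Transfer.

Variables (T : finType) (e : rel T) (gT : finGroupType) (G : {group gT}).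

Lemma compl_prime_graph (f : T -> prime_vertex G) : bijective f ->
  (forall x y, prime_graph (f x) (f y) = e x y) ->
  exists v : T -> nat, [/\ forall x, v x \in \pi(G), injective v,
      forall p, p \in \pi(G) -> exists x, v x = p
    & forall x y, compl_graph e x y = (v x != v y) && nadj G (v x) (v y)].
Proof.
move=> [g fK gK] eqe; have injv : injective (fun x => val (f x)).
  exact: inj_comp val_inj (can_inj fK).
exists (fun x => val (f x)); split=> // [x | p pG | x y]; first exact: valP.
  by exists (g (SeqSub pG)); rewrite gK.
rewrite /compl_graph -eqe /prime_graph negb_and negbK.
rewrite (can_eq fK) (inj_eq val_inj) (can_eq fK).
by have [-> | neq] := eqVneq x y; rewrite // negb_exists_in.
Qed.

Lemma prime_graph_condition (hT : finGroupType) (S : {group hT}) :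
  psl_like S -> pseudo_solvable S G -> graph_isomorphic e (@prime_graph gT G) ->
  (triangle_free (compl_graph e) /\ three_colorable (compl_graph e))
  \/ (exists a b c : T,
       unique_triangle (compl_graph e) a b c /\
       (forall x : T, x \notin [set a; b; c] ->
          ~~ compl_graph e a x /\ ~~ compl_graph e b x) /\
       (exists col : T -> 'I_3,
          proper_3coloring (compl_graph e) col /\
          forall x y : T,
            compl_graph e c x -> x \notin [set a; b] ->
            compl_graph e c y -> y \notin [set a; b] ->
            col x = col y)).
Proof.
move=> pslS psG [f [bijf eqf]].
have [v [piG injv surj ce]] := compl_prime_graph bijf eqf.
have [col colP] := prime_graph_coloring pslS psG.
have propcol : proper_3coloring (compl_graph e) (col \o v).
  by move=> x y; rewrite ce => /andP[neq nxy]; apply: colP.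
have triP x y z : triangle (compl_graph e) x y z ->
    [/\ v x != v y, v y != v z & v x != v z]
    /\ [/\ nadj G (v x) (v y), nadj G (v y) (v z) & nadj G (v x) (v z)].
  by rewrite /triangle !ce => /and3P[/andP[-> ->] /andP[-> ->] /andP[-> ->]].
case=> [notri | [pslG adj3 triG isolG col17]].
  left; split; last by exists (col \o v).
  move=> x y z; apply/negP=> /triP[[nxy nyz nxz] [axy ayz axz]].
  exact: (notri (v x) (v y) (v z)).
right; have [a va] := surj 2 (pslG 2 isT).
have [b vb] := surj 3 (pslG 3 isT); have [c vc] := surj 17 (pslG 17 isT).
have inabc x : (x \in [set a; b; c]) = (v x \in psl_primes).
  by rewrite !inE -!(inj_eq injv) va vb vc orbA.
have inab x : (x \in [set a; b]) = (v x \in pred2 2 3).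
  by rewrite !inE -!(inj_eq injv) va vb.
exists a, b, c; split; [split | split].
- by rewrite /triangle !ce va vb vc !adj3.
- move=> x y z /triP[[nxy nyz nxz] [axy ayz axz]].
  have [px py pz] := triG _ _ _ (piG x) (piG y) (piG z) nxy nyz nxz axy ayz axz.
  apply/eqP; rewrite eqEcard; apply/andP; split.
    by apply/subsetP=> t; rewrite inabc => /setUP[/set2P[]|/set1P] ->.
  have card3 (s t u : T) : v s != v t -> v t != v u -> v s != v u ->
      #|[set s; t; u]| = 3.
    rewrite !(inj_eq injv) => nst ntu nsu.
    by rewrite setUC cardsU1 cards2 !inE nst negb_or eq_sym nsu eq_sym ntu.
  by rewrite !card3 // ?va ?vb ?vc.
- move=> x; rewrite inabc => nx.
  by rewrite !ce va vb !(negPf (isolG _ _ _ nx _)) ?andbF.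
exists (col \o v); split=> // x y.
have nbr t : compl_graph e c t -> t \notin [set a; b] ->
    v t \notin psl_primes /\ nadj G (v t) 17.
  rewrite ce vc inab nadjC !inE => /andP[n17 ->]; rewrite negb_or => /andP[n2 n3].
  by rewrite (negPf n2) (negPf n3) eq_sym (negPf n17).
by move=> cx nx cy ny /=; have [] := nbr x cx nx; have [] := nbr y cy ny; auto.
Qed.

End Transfer.

(** * Extensions by fixed point free modules *)

Section SemidirectProducts.

Lemma sdprod_exists (aT rT : finGroupType) (phi : rT -> aT -> rT) :
  phi^~ 1 =1 id -> (forall x a b, phi x (a * b) = phi (phi x a) b) ->
  (forall x y a, phi (x * y) a = phi x a * phi y a) ->
  exists (gT : finGroupType) (f : {morphism [set: rT] >-> gT})
      (g : {morphism [set: aT] >-> gT}),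
    [/\ 'injm f, 'injm g, f @* setT ><| g @* setT = setT
      & forall x a, f (phi x a) = f x ^ g a].
Proof.
move=> phi1 phiM phiD; pose to : action [set: aT] rT := TotalAction phi1 phiM.
have toA : is_groupAction [set: rT] to.
  move=> a _; rewrite inE; apply/andP; split; first by apply/subsetP=> x; rewrite inE.
  by apply/morphicP=> x y _ _; rewrite !actpermE; apply: phiD.
pose gto := GroupAction toA.
exists (sdprod_by gto), (sdpair1_morphism gto), (sdpair2_morphism gto).
split; [exact: injm_sdpair1 | exact: injm_sdpair2 | exact: sdprod_sdpair |].
by move=> x a; rewrite -[phi x a]/(gto x a); apply: sdpair_act; rewrite inE.
Qed.

Lemma nadj_isog (aT rT : finGroupType) (G : {group aT}) (H : {group rT}) p q :
  G \isog H -> nadj G p q = nadj H p q.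
Proof.
suff imp (aT' rT' : finGroupType) (G' : {group aT'}) (H' : {group rT'}) :
    G' \isog H' -> nadj G' p q -> nadj H' p q.
  by move=> iso; apply/idP/idP; apply: imp; rewrite // isog_sym.
by case/isogP=> f _ <-; apply: nadj_morphim.
Qed.

Variables (gT : finGroupType) (G W H : {group gT}).
Hypotheses (defG : W ><| H = G) (coWH : coprime #|W| #|H|) (abW : abelian W).

Lemma nadj_sdprod_complement p q : p \in \pi(H) -> q \in \pi(H) ->
  nadj G p q = nadj H p q.
Proof.
have [nsWG sHG _ _ _] := sdprod_context defG; have nWG := normal_norm nsWG.
move=> pH qH; apply/idP/idP; first exact: nadjS.
rewrite (nadj_isog _ _ (sdprod_isog defG)); apply: contraTT => /nadjPn[g Gg og].
have coW : coprime #|W| (p * q).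
  rewrite coprimeMr; move: pH qH; rewrite !mem_primes.
  case/and3P=> _ _ pH /and3P[_ _ qH].
  by rewrite !(coprime_dvdr _ coWH).
apply/nadjPn; exists (coset W g); first exact: mem_quotient.
have Ng := subsetP nWG g Gg.
apply/eqP; rewrite eqn_dvd -{1}og morph_order //= -og order_dvdn.
set m := #[_]; have Wgm : g ^+ m \in W.
  by apply: coset_idr; rewrite ?groupX // morphX //= expg_order.
rewrite -order_eq1 -dvdn1 -(eqnP coW) dvdn_gcd order_dvdG //=.
by rewrite -og orderXdvd.
Qed.

(** If [g] has order [r * q], then [g ^+ q] lies in [W] and [g ^+ r = w * h] with [h] of order [q];
    as [W] is abelian, [h] commutes with [g ^+ q]. *)
Lemma nadj_sdprod_kernel r q : prime r -> prime q -> r \in \pi(W) -> q \in \pi(H) ->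
  nadj G r q <->
  forall w h, w \in W -> h \in H -> #[w] = r -> #[h] = q -> ~ commute w h.
Proof.
have [nsWG sHG defWH _ tiWH] := sdprod_context defG; have nWG := normal_norm nsWG.
move=> pr_r pr_q rW qH.
have r'H : ~~ (r %| #|H|).
  rewrite -prime_coprime // (coprime_dvdl _ coWH) //.
  by move: rW; rewrite mem_primes => /and3P[].
have q'W : ~~ (q %| #|W|).
  rewrite -prime_coprime // coprime_sym (coprime_dvdr _ coWH) //.
  by move: qH; rewrite mem_primes => /and3P[].
have neq : r != q by apply: contraNneq r'H => ->; move: qH; rewrite mem_primes => /and3P[].
split=> [nG w h Ww Hh ow oh com | fpf].
  have /eqP := nadj_comm pr_r pr_q neq nG (subsetP (normal_sub nsWG) w Ww)
    (subsetP sHG h Hh) (order_p_elt pr_r ow) (order_p_elt pr_q oh) com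
    (order_prime_neq1 pr_r ow).
  by apply/negP; apply: order_prime_neq1 pr_q oh.
apply/negPn/nadjPn=> -[g Gg og].
have ou : #[g ^+ q] = r by rewrite orderXdiv og ?dvdn_mull // mulnK ?prime_gt0.
have ov : #[g ^+ r] = q by rewrite orderXdiv og ?dvdn_mulr // mulKn ?prime_gt0.
have nWGe x : x \in G -> x \in 'N(W) := subsetP nWG x.
have Wu : g ^+ q \in W.
  apply: coset_idr; first by rewrite groupX ?nWGe.
  apply/eqP; rewrite -order_eq1 -dvdn1.
  have /eqnP <- : coprime r #|H| by rewrite prime_coprime.
  rewrite dvdn_gcd -{1}ou morph_order /= ?groupX ?nWGe //.
  by rewrite (card_isog (sdprod_isog defG)) order_dvdG // mem_quotient ?groupX.
have : g ^+ r \in W * H by rewrite defWH groupX.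
case/mulsgP=> w h Ww Hh defv.
have Gh := subsetP sHG h Hh.
have oh : #[h] = q.
  apply: nt_prime_order => //.
    suff Whq : h ^+ q \in W by apply/set1gP; rewrite -tiWH inE Whq groupX.
    apply: coset_idr; first by rewrite groupX ?nWGe.
    have -> : coset W (h ^+ q) = coset W (g ^+ r) ^+ q.
      by rewrite defv coset_kerl // morphX ?nWGe.
    by rewrite -morphX ?groupX ?nWGe //= -expgM -og expg_order morph1.
  by apply: contraNneq q'W => h1; rewrite -ov defv h1 mulg1 order_dvdG.
apply: (fpf (g ^+ q) h Wu Hh ou oh).
have -> : h = w^-1 * g ^+ r by rewrite defv mulKg.
apply: commuteM.
  by apply: (centsP abW); rewrite ?groupV.
by apply: commuteX; apply/commute_sym/commuteX.
Qed.

Lemma pi_sdprod : \pi(G) =i predU (mem \pi(W)) (mem \pi(H)).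
Proof.
by move=> p; rewrite /= -(sdprod_card defG) primesM // !inE.
Qed.

Lemma nadj_abelian p q : prime p -> prime q -> p != q -> p \in \pi(W) -> q \in \pi(W) ->
  ~~ nadj G p q.
Proof.
move=> pr_p pr_q neq; rewrite !mem_primes !cardG_gt0 /= => /andP[_ pW] /andP[_ qW].
have [x Wx ox] := Cauchy pr_p pW; have [y Wy oy] := Cauchy pr_q qW.
have [nsWG _ _ _ _] := sdprod_context defG; have sWG := normal_sub nsWG.
apply/nadjPn; exists (x * y); first by rewrite groupM ?(subsetP sWG).
by rewrite orderM ?ox ?oy //; [apply: (centsP abW) | rewrite ?prime_coprime ?dvdn_prime2].
Qed.

End SemidirectProducts.

Section ModuleExtension.

(* The functions f : H -> K whose sum over every orbit <x> g with #[x] in Sig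
   vanishes form a KH-module, on which such an x has no fixed point (if #[x] is
   nonzero in K). *)
Definition orbit_sum0 (hT : finGroupType) (H : {set hT}) (Sig : pred nat)
    (K : zmodType) (f : hT -> K) :=
  forall x g, x \in H -> g \in H -> prime #[x] -> #[x] \in Sig ->
  (\sum_(i < #[x]) f (x ^+ i * g)%g = 0)%R.

Definition has_fpf_module (hT : finGroupType) (H : {set hT}) (Sig : pred nat)
    (K : zmodType) :=
  (exists f : hT -> K, orbit_sum0 H Sig f /\ exists2 g, g \in H & f g != 0%R) /\
  forall p, p \in primes #|H| -> p \notin Sig ->
    exists y (f : hT -> K), [/\ y \in H, #[y] = p, orbit_sum0 H Sig f,
      forall g, g \in H -> f (y * g) = f g & exists2 g, g \in H & f g != 0%R].

Variables (hT : finGroupType) (H : {group hT}) (s : seq nat) (Sig : nat -> pred nat).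
Hypotheses (s_uniq : uniq s) (s_prime : all prime s).
Hypothesis s_coprime : forall r, r \in s -> ~~ (r %| #|H|).
Hypothesis s_module : forall r, r \in s -> has_fpf_module H (Sig r) 'F_r.

(** All primes of [s] are treated at once over Z/R, the product of the fields F_r: multiplication by
    [R %/ r] kills every component except the one at [r]. *)
Let R := (\prod_(r <- s) r)%N.

Lemma prod_s_gt0 : 0 < R.
Proof.
rewrite /R big_seq prodn_cond_gt0 // => r /(allP s_prime); exact: prime_gt0.
Qed.

Lemma prod_s_div r : r \in s -> R = (r * (R %/ r))%N.
Proof.
by move=> rs; rewrite mulnC divnK // /R (big_rem r) //= dvdn_mulr.
Qed.

Lemma prod_s_prime r : prime r -> (r %| R) = (r \in s).
Proof.
move=> pr_r; rewrite /R Euclid_dvd_prod // big_has.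
apply/hasP/idP => [[q qs] | rs]; last by exists r.
by rewrite dvdn_prime2 ?(allP s_prime q) // => /eqP->.
Qed.

Lemma prod_s_ndiv r : r \in s -> ~~ (r %| R %/ r).
Proof.
move=> rs; have pr_r := allP s_prime r rs.
rewrite /R (big_rem r) //= mulKn ?prime_gt0 //.
rewrite Euclid_dvd_prod // big_has; apply/hasPn=> q.
rewrite mem_rem_uniq // !inE => /andP[neq qs].
by rewrite dvdn_prime2 ?(allP s_prime) // eq_sym.
Qed.

Lemma prod_s_dvd2 r q : r \in s -> q \in s -> r != q -> r %| R %/ q.
Proof.
move=> rs qs neq; have pr_r := allP s_prime r rs.
have := prod_s_prime pr_r; rewrite rs {1}(prod_s_div qs) Euclid_dvdM //.
by rewrite dvdn_prime2 ?(allP s_prime) // (negPf neq).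
Qed.

(** As [R] is positive this is Z/R; the successor form is a group also for [R = 1], when [s] is
    empty. *)
Local Notation V := 'I_R.-1.+1.
Local Notation rV := 'rV[V]_#|hT|.

Let ev (f : rV) (g : hT) : V := f 0%R (enum_rank g).
Let mkv (F : hT -> V) : rV := (\row_i F (enum_val i))%R.

Lemma ev_mkv F g : ev (mkv F) g = F g.
Proof. by rewrite /ev mxE enum_rankK. Qed.

Lemma ev_inj f f' : (forall g, ev f g = ev f' g) -> f = f'.
Proof. by move=> eqf; apply/rowP=> i; have := eqf (enum_val i); rewrite /ev enum_valK. Qed.

Lemma evM (f f' : rV) g : ev (f * f')%g g = (ev f g + ev f' g)%R.
Proof. by rewrite FinRing.zmodMgE /ev mxE. Qed.

Lemma evX (f : rV) n g : ev (f ^+ n)%g g = (ev f g *+ n)%R.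
Proof. by rewrite FinRing.zmodXgE /ev mulmxnE. Qed.

Lemma ev1 g : ev 1%g g = 0%R.
Proof. by rewrite FinRing.zmod1gE /ev mxE. Qed.

Lemma mulrnR (v : V) : (v *+ R = 0)%R.
Proof.
rewrite Zp_mulrn; apply: val_inj => /=.
by apply/eqP/dvdn_mull; rewrite (prednK prod_s_gt0).
Qed.

Let phi (f : rV) (a : hT) : rV := mkv (fun g => ev f (a * g)).

Lemma phi1 : phi^~ 1 =1 id.
Proof. by move=> f; apply: ev_inj => g; rewrite ev_mkv mul1g. Qed.

Lemma phiM f a b : phi f (a * b) = phi (phi f a) b.
Proof. by apply: ev_inj => g; rewrite !ev_mkv mulgA. Qed.

Lemma phiD f f' a : phi (f * f')%g a = phi f a * phi f' a.
Proof. by apply: ev_inj => g; rewrite !(ev_mkv, evM). Qed.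

Definition module_set : {set rV} :=
  [set f | all (fun r => [forall x in H, prime #[x] && (#[x] \in Sig r) ==>
      [forall g, ((\sum_(i < #[x]) ev f (x ^+ i * g)%g) *+ (R %/ r) == 0)%R]]) s].

Lemma module_setP f : reflect (forall r x g, r \in s -> x \in H -> prime #[x] ->
    #[x] \in Sig r -> ((\sum_(i < #[x]) ev f (x ^+ i * g)%g) *+ (R %/ r) = 0)%R)
  (f \in module_set).
Proof.
rewrite inE; apply: (iffP allP) => [ok r x g rs Hx pr_x Sx | ok r rs].
  by have /forall_inP/(_ x Hx) := ok r rs; rewrite pr_x Sx => /forallP/(_ g)/eqP.
apply/forall_inP=> x Hx; apply/implyP=> /andP[pr_x Sx].
by apply/forallP=> g; apply/eqP/ok.
Qed.

Lemma module_group_set : group_set module_set.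
Proof.
apply/group_setP; split=> [|f f' /module_setP Wf /module_setP Wf'];
  apply/module_setP=> r x g rs Hx pr_x Sx.
  by rewrite big1 ?GRing.mul0rn // => i _; rewrite ev1.
rewrite (eq_bigr (fun i : 'I__ => ev f (x ^+ i * g)%g + ev f' (x ^+ i * g)%g)%R); last first.
  by move=> i _; rewrite evM.
by rewrite big_split GRing.mulrnDl /= Wf // Wf' // GRing.addr0.
Qed.

Let W := Group module_group_set.

Lemma module_stable f a : f \in W -> a \in H -> phi f a \in W.
Proof.
move=> /module_setP Wf Ha; apply/module_setP=> r x g rs Hx pr_x Sx.
rewrite -(orderJ _ a^-1) in pr_x Sx.
rewrite -[RHS](Wf r (x ^ a^-1) (a * g) rs _ pr_x Sx) ?groupJ ?groupV //.
rewrite orderJ; congr (_ *+ _)%R; apply: eq_bigr => i _.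
by rewrite ev_mkv -conjXg conjgE invgK !mulgA mulgKV.
Qed.

Lemma inZpD m n : (inZp (m + n) = inZp m + inZp n :> V)%R.
Proof. by apply: val_inj; rewrite /= modnDm. Qed.

Lemma inZp_eq0 m : ((inZp m : V) == 0%R) = (R %| m).
Proof. by rewrite -val_eqE /= (prednK prod_s_gt0). Qed.

Lemma inZpM m n : (inZp m *+ n = inZp (m * n) :> V)%R.
Proof. by rewrite Zp_mulrn; apply: val_inj; rewrite /= modnMml. Qed.

Lemma inZp_sum n (F : 'I_n -> nat) :
  (\sum_(i < n) inZp (F i) = inZp (\sum_(i < n) F i) :> V)%R.
Proof.
by apply/esym/(big_morph (fun m => inZp m : V) inZpD); apply: val_inj; rewrite /= mod0n.
Qed.

(** The factor [R %/ r] embeds F_r in Z/R. Outside [H] the value is 0, because [module_set] tests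
    orbits in the whole type. *)
Let emb r (f0 : hT -> 'F_r) : rV :=
  mkv (fun g => if g \in H then inZp (f0 g * (R %/ r)) else 0%R).

Lemma mem_orbit x g n : x \in H -> (x ^+ n * g \in H) = (g \in H).
Proof. by move=> Hx; rewrite groupMl ?groupX. Qed.

Lemma emb_in r f0 : r \in s -> orbit_sum0 H (Sig r) f0 -> @emb r f0 \in W.
Proof.
move=> rs sum0; have pr_r := allP s_prime r rs.
apply/module_setP=> r' x g rs' Hx pr_x Sx.
have [Hg | nHg] := boolP (g \in H); last first.
  by rewrite big1 ?GRing.mul0rn // => i _; rewrite ev_mkv mem_orbit // (negPf nHg).
rewrite (eq_bigr (fun i : 'I__ => inZp (f0 (x ^+ i * g)%g * (R %/ r)))); last first.
  by move=> i _; rewrite ev_mkv mem_orbit // Hg.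
rewrite inZp_sum -big_distrl /=; apply/eqP.
(* For [r' != r] the product of [R %/ r] and [R %/ r'] is a multiple of [R]; for [r' = r] the
   vanishing of the sum in F_r supplies the missing factor [r]. *)
rewrite inZpM inZp_eq0; have [eqr | neq] := eqVneq r r'; last first.
  by rewrite -mulnA dvdn_mull // {1}(prod_s_div rs) mulnC dvdn_mul // prod_s_dvd2.
rewrite -eqr in Sx *; apply: dvdn_mulr.
rewrite {1}(prod_s_div rs) dvdn_mul //.
rewrite (GRing.dvdn_pcharf (pchar_Fp pr_r)) GRing.natr_sum.
rewrite -[X in _ == X](sum0 x g Hx Hg pr_x Sx); apply/eqP/eq_bigr => i _.
exact: natr_Zp.
Qed.

Lemma emb_order r f0 : r \in s -> (exists2 g, g \in H & f0 g != 0%R) ->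
  #[@emb r f0] = r.
Proof.
move=> rs [g Hg nz]; have pr_r := allP s_prime r rs; apply: nt_prime_order => //.
  apply: ev_inj => k; rewrite evX ev1 ev_mkv; case: ifP => // _; last by rewrite GRing.mul0rn.
  by apply/eqP; rewrite inZpM inZp_eq0 -mulnA dvdn_mull // mulnC -prod_s_div.
apply: contra nz => /eqP/(congr1 (ev^~ g)); rewrite ev1 ev_mkv Hg => /eqP.
rewrite inZp_eq0 {1}(prod_s_div rs) dvdn_pmul2r; last first.
  by have := prod_s_gt0; rewrite {1}(prod_s_div rs) muln_gt0 => /andP[].
by rewrite (GRing.dvdn_pcharf (pchar_Fp pr_r)) natr_Zp.
Qed.

Lemma module_pi : \pi(W) =i s.
Proof.
move=> p; apply/idP/idP => [|ps].
  rewrite mem_primes => /and3P[pr_p _ /(Cauchy pr_p)[f Wf ordf]].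
  rewrite -prod_s_prime // -ordf order_dvdn; apply/eqP/ev_inj => g.
  by rewrite evX ev1 mulrnR.
have [[f0 [sum0 nz]] _] := s_module ps.
rewrite mem_primes (allP s_prime) // cardG_gt0 /= -{1}(emb_order ps nz).
exact: (order_dvdG (emb_in ps sum0)).
Qed.

(** If [f] were fixed, its orbit sums would be [#[x]] times its values. Each value would then be
    killed by [#[x] * (R %/ r)] and by [r], which are coprime. *)
Lemma module_fpf r (f : rV) x : r \in s -> f \in W -> #[f] = r -> x \in H ->
  prime #[x] -> #[x] \in Sig r -> phi f x != f.
Proof.
move=> rs /module_setP Wf ordf Hx pr_x Sx; have pr_r := allP s_prime r rs.
apply/eqP=> fx; have fx1 g : ev f (x * g)%g = ev f g.
  by have := congr1 (ev^~ g) fx; rewrite ev_mkv.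
have fxi g i : ev f (x ^+ i * g)%g = ev f g.
  by elim: i => [|i IH]; rewrite ?mul1g // expgS -mulgA fx1.
have /eqP[] : f != 1 by apply: order_prime_neq1 pr_r ordf.
apply: ev_inj => g; rewrite ev1.
have := Wf r x g rs Hx pr_x Sx.
rewrite (eq_bigr (fun=> ev f g)) => [|i _]; last exact: fxi.
rewrite GRing.sumr_const card_ord -GRing.mulrnA -FinRing.zmodXgE => /eqP e1.
have e2 : ev f g ^+ r == 1.
  by rewrite FinRing.zmodXgE -evX -ordf expg_order ev1.
rewrite -FinRing.zmod1gE -order_dvdn in e1; rewrite -order_dvdn in e2.
have /eqnP co : coprime (#[x] * (R %/ r)) r.
  rewrite coprime_sym prime_coprime // Euclid_dvdM // negb_or prod_s_ndiv // andbT.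
  by apply: contra (s_coprime rs) => /dvdn_trans; apply; apply: order_dvdG.
by apply/eqP; rewrite -FinRing.zmod1gE -order_eq1 -dvdn1 -co dvdn_gcd e1.
Qed.

Lemma module_extension :
  exists (gT : finGroupType) (G M H1 : {group gT}),
    [/\ M ><| H1 = G, abelian M, H \isog H1, \pi(M) =i s &
        forall r q, r \in s -> q \in \pi(H) -> nadj G r q = (q \in Sig r)].
Proof.
have [gT [f [g [injf injg defT fJ]]]] := sdprod_exists phi1 phiM phiD.
have [_ _ nTT tiTT] := sdprodP defT.
have nMH : g @* H \subset 'N(f @* W).
  apply/subsetP=> _ /morphimP[h _ Hh ->]; rewrite inE.
  apply/subsetP=> _ /imsetP[_ /morphimP[w _ Ww ->] ->].
  by rewrite -fJ mem_morphim ?in_setT // module_stable.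
have tiMH : f @* W :&: g @* H = 1.
  by apply/trivgP; rewrite -tiTT setISS // morphimS ?subsetT.
have defG : f @* W ><| g @* H = (f @* W <*> g @* H)%G by rewrite sdprodEY.
have abW : abelian W := FinRing.zmod_abelian W.
have abM : abelian (f @* W) by rewrite morphim_abelian.
have isoH : H \isog g @* H by apply: sub_isog; rewrite ?subsetT.
have isoW : W \isog f @* W by apply: sub_isog; rewrite ?subsetT.
have coMH : coprime #|f @* W| #|g @* H|.
  rewrite -(card_isog isoH) -(card_isog isoW).
  apply: pnat_coprime (pnat_pi (cardG_gt0 W)) _; apply/pgroupP=> q pr_q qH.
  rewrite inE /= -[_ \in _]/(q \in \pi(W)) module_pi.
  by apply: contraL qH; apply: s_coprime.
exists gT, (f @* W <*> g @* H)%G, (f @* W)%G, (g @* H)%G; split=> //.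
  by move=> p; rewrite /= -(card_isog isoW) module_pi.
move=> r q rs qH; have pr_r := allP s_prime r rs.
have pr_q : prime q by move: qH; rewrite mem_primes => /and3P[].
have rM : r \in \pi(f @* W) by rewrite /= -(card_isog isoW) module_pi.
have qH1 : q \in \pi(g @* H) by rewrite /= -(card_isog isoH).
have kerP := nadj_sdprod_kernel defG coMH abM pr_r pr_q rM qH1.
have commE w h : commute (f w) (g h) <-> phi w h = w.
  rewrite /commute; split=> [com|fix_w].
    apply: (injmP injf); rewrite ?in_setT // fJ.
    by apply/conjg_fixP/commgP.
  by apply/commgP/conjg_fixP; rewrite -fJ fix_w.
apply/idP/idP => [nG | Sq].
  apply/negPn/negP=> nSq; have [_ /(_ q qH nSq)] := s_module rs.
  case=> y [f0 [Hy oy sum0 fy nz]].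
  apply: (kerP.1 nG (f (emb f0)) (g y)).
  - by rewrite mem_morphim ?in_setT // emb_in.
  - by rewrite mem_morphim ?in_setT.
  - by rewrite order_injm ?in_setT // emb_order.
  - by rewrite order_injm ?in_setT.
  apply/commE/ev_inj => k; rewrite !ev_mkv groupMl //.
  by case: ifP => // Hk; rewrite fy.
apply/kerP=> _ _ /morphimP[w _ Ww ->] /morphimP[h _ Hh ->].
rewrite !order_injm ?in_setT // => ow oh /commE/eqP.
by apply/negP; apply: (module_fpf rs); rewrite ?oh.
Qed.

End ModuleExtension.

Lemma has_fpf_module_eq (hT : finGroupType) (H : {group hT}) (Sig Sig' : pred nat)
    (K : zmodType) :
  {in \pi(H), Sig =1 Sig'} -> has_fpf_module H Sig K -> has_fpf_module H Sig' K.
Proof.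
move=> eqS; have eqsum f : orbit_sum0 H Sig f -> orbit_sum0 H Sig' f (K := K).
  move=> sum0 x g Hx Hg pr_x Sx; apply: sum0 => //.
  by rewrite -topredE /= eqS // mem_primes pr_x cardG_gt0 order_dvdG.
case=> [[f [/eqsum sum0 nz]] inv]; split; first by exists f.
move=> p pH nSp; have [|y [f' [Hy oy /eqsum sum0' fy nz']]] := inv p pH.
  by rewrite -topredE /= eqS.
by exists y, f'.
Qed.

Lemma orbit_sum0_transl (hT : finGroupType) (H : {group hT}) (Sig : pred nat)
    (K : zmodType) (f : hT -> K) h :
  h \in H -> orbit_sum0 H Sig f -> orbit_sum0 H Sig (fun g => f (h * g)).
Proof.
move=> Hh sum0 x g Hx Hg pr_x Sx; rewrite -(orderJ _ h^-1) in pr_x Sx *.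
rewrite -[RHS](sum0 (x ^ h^-1) (h * g)) ?groupJ ?groupM ?groupV //.
apply: eq_bigr => i _; move: (nat_of_ord i) => n.
by rewrite -conjXg conjgE invgK !mulgA mulgKV.
Qed.

Lemma trivial_fpf_module (hT : finGroupType) (H : {group hT}) (Sig : pred nat)
    (K : nzRingType) :
  {in \pi(H), forall p, p \notin Sig} -> has_fpf_module H Sig K.
Proof.
move=> nS; have sum0 (f : hT -> K) : orbit_sum0 H Sig f.
  move=> x g Hx _ pr_x Sx; have /negP[] : #[x] \notin Sig.
    by apply: nS; rewrite mem_primes pr_x cardG_gt0 order_dvdG.
  by [].
have nz : exists2 g, g \in H & (1 != 0 :> K)%R by exists 1; rewrite ?GRing.oner_neq0.
split=> [|p]; first by exists (fun=> 1%R).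
rewrite mem_primes => /and3P[pr_p _ pH] _; have [y Hy oy] := Cauchy pr_p pH.
by exists y, (fun=> 1%R).
Qed.

(* f is the product, over the primes r of rs, of r 1_(M r) - 1: for x of order r,
   each coset <x> g meets M r exactly once, while x lies in the other M r'. *)
Lemma index_family_module (hT : finGroupType) (H : {group hT}) (rs : seq nat)
    (M : nat -> {group hT}) (K : fieldType) :
  uniq rs -> all prime rs ->
  (forall r, r \in rs -> [/\ M r \subset H, #|H : M r| = r & ~~ (r %| #|M r|)]) ->
  (forall x r, x \in H -> #[x] \in rs -> r \in rs -> r != #[x] -> x \in M r) ->
  (exists2 g, g \in H & forall r, r \in rs -> g \notin M r) ->
  (forall p, p \in \pi(H) -> p \notin rs ->
     exists2 y, y \in H & #[y] = p /\ forall r, r \in rs -> y \in M r) ->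
  has_fpf_module H (mem rs) K.
Proof.
move=> uniq_rs pr_rs MH Mx [g0 Hg0 Mg0] My.
pose phi (r : nat) (g : hT) : K := (r%:R * (g \in M r)%:R - 1)%R.
pose f g := (\prod_(r <- rs) phi r g)%R.
have nz : exists2 g, g \in H & f g != 0%R.
  exists g0 => //; rewrite /f big_seq GRing.prodf_seq_neq0; apply/allP=> r rs_r.
  apply/implyP=> _; rewrite /phi (negPf (Mg0 r rs_r)) GRing.mulr0 GRing.sub0r.
  by rewrite GRing.oppr_eq0 GRing.oner_neq0.
have sum0 : orbit_sum0 H (mem rs) f.
  move=> x g Hx Hg pr_x rs_x; set q := #[x] in pr_x rs_x *.
  have [sMH iMH qM] := MH q rs_x.
  have tiMx : M q :&: <[x]> = 1.
    by rewrite coprime_TIg // coprime_sym -orderE prime_coprime.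
  have defH : M q * <[x]> = H.
    apply/eqP; rewrite eqEcard mul_subG ?cycle_subG //= TI_cardMg //.
    by rewrite -(Lagrange sMH) iMH -orderE.
  have [i0 Mi0] : exists i0 : 'I_q, x ^+ i0 * g \in M q.
    have : g^-1 \in M q * <[x]> by rewrite defH groupV.
    case/mulsgP=> m _ Mm /cyclePmin[i ltiq ->] defg.
    exists (Ordinal ltiq) => /=; rewrite -groupV invMg defg -[m]invgK.
    by rewrite invgK mulgK.
  have Mi (i : 'I_q) : (x ^+ i * g \in M q) = (i == i0).
    apply/idP/eqP => [Mi | -> //]; apply: val_inj => /=.
    have : x ^+ i * (x ^+ i0)^-1 \in M q :&: <[x]>.
      apply/setIP; split; last by rewrite groupM ?groupV ?mem_cycle.
      rewrite (_ : _ * _ = (x ^+ i * g) * (x ^+ i0 * g)^-1).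
        by rewrite groupMl // groupV.
      by rewrite invMg mulgA mulgK.
    rewrite tiMx => /set1P/eqP; rewrite -eq_mulgV1 eq_expg_mod_order.
    by rewrite -/q !modn_small // => /eqP.
  have phix r i : r \in rs -> r != q -> phi r (x ^+ i * g) = phi r g.
    by move=> rs_r neq; rewrite /phi groupMl // groupX // Mx.
  have fE (i : 'I_q) : f (x ^+ i * g) =
      (phi q (x ^+ i * g)%g * \prod_(r <- rem q rs) phi r g)%R.
    rewrite /f (big_rem q) //=; congr (_ * _)%R; rewrite !big_seq.
    apply: eq_bigr => r; rewrite mem_rem_uniq // !inE => /andP[neq rs_r].
    exact: phix.
  rewrite (eq_bigr _ (fun i _ => fE i)) -GRing.mulr_suml /phi GRing.sumrB.
  rewrite -GRing.mulr_sumr (bigD1 i0) //= Mi0 big1 => [|i /negPf ni]; last by rewrite Mi ni.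
  by rewrite GRing.sumr_const card_ord GRing.addr0 GRing.mulr1 GRing.subrr GRing.mul0r.
split=> [|p pH nrs]; first by exists f.
have [y Hy [oy yM]] := My p pH nrs; exists y, f; split=> // g Hg.
by rewrite /f !big_seq; apply: eq_bigr => r rs_r; rewrite /phi groupMl // yM.
Qed.

(** By coprimality an element of prime order lies in one factor, and along its orbit only one of the
    two functions varies. *)
Lemma orbit_sum0_setX (aT rT : finGroupType) (A : {group aT}) (B : {group rT})
    (Sig : pred nat) (K : fieldType) (f1 : aT -> K) (f2 : rT -> K) :
  coprime #|A| #|B| -> orbit_sum0 A Sig f1 -> orbit_sum0 B Sig f2 ->
  orbit_sum0 (setX A B) Sig (fun g => f1 g.1 * f2 g.2)%R.
Proof.
move=> coAB sum1 sum2 [x1 x2] [g1 g2] /setXP[/= Ax Bx] /setXP[/= Ag Bg].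
set q := #[_] => pr_q Sq.
have xX i : (x1, x2) ^+ i = (x1 ^+ i, x2 ^+ i).
  by elim: i => // i IH; rewrite !expgS IH.
have [x1q x2q] : x1 ^+ q = 1 /\ x2 ^+ q = 1.
  by have := expg_order (x1, x2); rewrite -/q xX => -[].
have [x11 | nx1] := eqVneq x1 1.
  have oq : q = #[x2].
    have nx2 : x2 != 1.
      by apply: contraTneq pr_q => x21; rewrite /q x11 x21 order1.
    by rewrite -(nt_prime_order pr_q x2q nx2).
  rewrite oq in pr_q Sq *; have := sum2 x2 g2 Bx Bg pr_q Sq.
  move/(congr1 (fun z => f1 g1 * z)%R); rewrite GRing.mulr0 GRing.mulr_sumr => sum0; rewrite -[RHS]sum0.
  by apply: eq_bigr => i _; rewrite xX x11 /= expg1n mul1g.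
have oq := nt_prime_order pr_q x1q nx1.
have x21 : x2 = 1.
  apply/eqP; rewrite -order_eq1 -dvdn1 -(eqnP (_ : coprime q #|B|)).
    by rewrite dvdn_gcd order_dvdn x2q eqxx order_dvdG.
  by apply: coprime_dvdl coAB; rewrite -oq order_dvdG.
have Sq1 : #[x1] \in Sig by rewrite oq.
have pr1 : prime #[x1] by rewrite oq.
have := sum1 x1 g1 Ax Ag pr1 Sq1; rewrite oq.
move/(congr1 (fun z => z * f2 g2)%R); rewrite GRing.mul0r GRing.mulr_suml => sum0; rewrite -[RHS]sum0.
by apply: eq_bigr => i _; rewrite xX x21 /= expg1n mul1g.
Qed.

Lemma has_fpf_module_setX (aT rT : finGroupType) (A : {group aT}) (B : {group rT})
    (Sig : pred nat) (K : fieldType) :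
  coprime #|A| #|B| -> has_fpf_module A Sig K -> has_fpf_module B Sig K ->
  has_fpf_module (setX A B) Sig K.
Proof.
move=> coAB [[f1 [sum1 [g1 Ag1 nz1]]] inv1] [[f2 [sum2 [g2 Bg2 nz2]]] inv2].
split=> [|p].
  exists (fun g => f1 g.1 * f2 g.2)%R; split; first exact: orbit_sum0_setX.
  by exists (g1, g2); rewrite ?inE ?Ag1 //= GRing.mulf_neq0.
rewrite cardsX primesM // => /orP[pA | pB] nSp.
  have [y [f [Ay oy sum fy [g Ag nz]]]] := inv1 p pA nSp.
  exists (y, 1), (fun g => f g.1 * f2 g.2)%R; split.
  - by rewrite inE Ay group1.
  - by rewrite -oy; apply: (order_injm (injm_pairg1 aT rT)); rewrite inE.
  - exact: orbit_sum0_setX.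
  - by move=> [h1 h2] /setXP[/= Ah Bh]; rewrite fy // mul1g.
  by exists (g, g2); rewrite ?inE ?Ag //= GRing.mulf_neq0.
have [y [f [By oy sum fy [g Bg nz]]]] := inv2 p pB nSp.
exists (1, y), (fun g => f1 g.1 * f g.2)%R; split.
- by rewrite inE By group1.
- by rewrite -oy; apply: (order_injm (injm_pair1g aT rT)); rewrite inE.
- exact: orbit_sum0_setX.
- by move=> [h1 h2] /setXP[/= Ah Bh]; rewrite fy // mul1g.
by exists (g1, g); rewrite ?inE ?Ag1 //= GRing.mulf_neq0.
Qed.

(** * The group PSL(2,17) *)

Section Matrices2.

Local Open Scope ring_scope.
Variable F : comUnitRingType.
Implicit Types a b c d : F.

Definition mx2 a b c d : 'M[F]_2 :=
  \matrix_(i, j) if i == 0 then if j == 0 then a else b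
                 else if j == 0 then c else d.

Lemma eq_mx2P (A B : 'M[F]_2) :
  A 0 0 = B 0 0 -> A 0 1 = B 0 1 -> A 1 0 = B 1 0 -> A 1 1 = B 1 1 -> A = B.
Proof.
move=> e00 e01 e10 e11; apply/matrixP=> i j.
have I2 (k : 'I_2) : k = 0 \/ k = 1.
  by case: k => [[|[|[]]]] //= lt; [left | right]; apply: val_inj.
by case: (I2 i) => ->; case: (I2 j) => ->.
Qed.

Lemma mx2E (A : 'M[F]_2) : A = mx2 (A 0 0) (A 0 1) (A 1 0) (A 1 1).
Proof. by apply: eq_mx2P; rewrite !mxE. Qed.

Lemma mx2_inj a b c d a' b' c' d' : mx2 a b c d = mx2 a' b' c' d' ->
  [/\ a = a', b = b', c = c' & d = d'].
Proof.
move=> /matrixP eqM.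
by split; [have := eqM 0 0 | have := eqM 0 1 | have := eqM 1 0 | have := eqM 1 1];
  rewrite !mxE.
Qed.

Lemma mx2_mul a b c d a' b' c' d' : mx2 a b c d *m mx2 a' b' c' d' =
  mx2 (a * a' + b * c') (a * b' + b * d') (c * a' + d * c') (c * b' + d * d').
Proof.
by apply: eq_mx2P; rewrite !mxE big_ord_recl big_ord1 !mxE.
Qed.

Lemma mx2_1 : 1%:M = mx2 1 0 0 1.
Proof. by apply: eq_mx2P; rewrite !mxE. Qed.

Lemma det_mx2 a b c d : \det (mx2 a b c d) = a * d - b * c.
Proof.
rewrite (expand_det_row _ 0) big_ord_recl big_ord1 /cofactor !det_mx11 !mxE /=.
by rewrite GRing.expr0 GRing.mul1r GRing.expr1 GRing.mulN1r GRing.mulrN.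
Qed.

End Matrices2.

Section PSL17.

(* The order 17 of the field is kept out of sight, because tactics tend to
   unfold computations with ['F_17]. *)
Variables (F : finFieldType) (S : {group {'GL_2[F]}}).
Hypothesis SP : forall x, (x \in S) = (\det (GLval x) == 1)%R.
Hypothesis cardF : #|F| = 17.

Local Notation Z := 'Z(S).
Local Notation det a b c d := (a * d - b * c)%R.
Implicit Types a b c d s t : F.

Lemma F17 : (17%:R = 0 :> F)%R.
Proof.
have := expg_cardG (in_setT (1%R : F)).
by rewrite cardsT cardF FinRing.zmodXgE FinRing.zmod1gE.
Qed.

Definition sl2 a b c d : {'GL_2[F]} := insubd (1 : {'GL_2[F]}) (mx2 a b c d).

Arguments sl2 (a b c d)%_R.

Lemma val_sl2 a b c d : det a b c d = 1%R -> GLval (sl2 a b c d) = mx2 a b c d.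
Proof.
move=> D; rewrite /sl2 /insubd insubT //.
by rewrite -[_ \is a _]/(_ \in unitmx) unitmxE det_mx2 D GRing.unitr1.
Qed.

Local Opaque sl2.

Lemma GL_inj (x y : {'GL_2[F]}) : GLval x = GLval y -> x = y.
Proof. exact: val_inj. Qed.

(** Derives an equation from a known one [l = r] by a polynomial identity, mostly left to [ring]; a
    multiple of [F17] used as [l = r] gives computation modulo 17. *)
Lemma eq_of_sub (x y l r : F) : l = r -> (x - y = l - r)%R -> x = y.
Proof. by move=> ->; rewrite GRing.subrr => /eqP; rewrite GRing.subr_eq0 => /eqP. Qed.

Lemma sl2P x : reflect (exists a b c d, det a b c d = 1%R /\ x = sl2 a b c d) (x \in S).
Proof.
apply: (iffP idP) => [|[a [b [c [d [D ->]]]]]]; last by rewrite SP val_sl2 // det_mx2 D.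
rewrite SP => /eqP; rewrite [GLval x]mx2E det_mx2 => D.
exists (GLval x 0 0)%R, (GLval x 0 1)%R, (GLval x 1 0)%R, (GLval x 1 1)%R.
by split=> //; apply: GL_inj; rewrite val_sl2 -?mx2E.
Qed.

Lemma sl2_in a b c d : det a b c d = 1%R -> sl2 a b c d \in S.
Proof. by move=> D; apply/sl2P; exists a, b, c, d. Qed.

Lemma sl2_inj a b c d a' b' c' d' : det a b c d = 1%R -> det a' b' c' d' = 1%R ->
  sl2 a b c d = sl2 a' b' c' d' -> [/\ a = a', b = b', c = c' & d = d'].
Proof. by move=> D D' /(congr1 (@GLval _ _)); rewrite !val_sl2 //; apply: mx2_inj. Qed.

Lemma detM a b c d a' b' c' d' : det a b c d = 1%R -> det a' b' c' d' = 1%R ->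
  (det (a * a' + b * c') (a * b' + b * d') (c * a' + d * c') (c * b' + d * d') = 1)%R.
Proof.
move=> D D'; transitivity (det a b c d * det a' b' c' d')%R; first by ring.
by rewrite D D' GRing.mul1r.
Qed.

Lemma sl2M a b c d a' b' c' d' : det a b c d = 1%R -> det a' b' c' d' = 1%R ->
  sl2 a b c d * sl2 a' b' c' d' = sl2 (a * a' + b * c') (a * b' + b * d')
                                      (c * a' + d * c') (c * b' + d * d').
Proof.
move=> D D'; apply: GL_inj; rewrite GL_MxE !val_sl2 ?mx2_mul //.
exact: detM.
Qed.

Lemma detN a b c d : det a b c d = 1%R -> det (- a) (- b) (- c) (- d) = 1%R.
Proof. by move=> <-; ring. Qed.

Lemma det1 : det 1 0 0 1 = 1%R :> F.
Proof. by ring. Qed.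

Lemma sl2_1 : sl2 1 0 0 1 = 1.
Proof. by apply: GL_inj; rewrite val_sl2 -?mx2_1 ?det1. Qed.

Lemma det_up t : det 1 t 0 1 = 1%R.
Proof. by ring. Qed.

Lemma det_lo t : det 1 0 t 1 = 1%R.
Proof. by ring. Qed.

Lemma sl2_central a b c d : det a b c d = 1%R ->
  (sl2 a b c d \in Z) = [&& b == 0%R, c == 0%R, a == d & (a == 1)%R || (a == -1)%R].
Proof.
move=> D; apply/centerP/and4P=> [[_ cent] | [/eqP b0 /eqP c0 /eqP ad a1]].
- have := cent _ (sl2_in (det_lo 1%R)); rewrite /commute !sl2M ?det_lo //.
  case/sl2_inj; rewrite ?detM ?det_lo // => e1 _ _ _.
  have := cent _ (sl2_in (det_up 1%R)); rewrite /commute !sl2M ?det_up //.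
  case/sl2_inj; rewrite ?detM ?det_up // => f1 f2 _ _.
  have b0 : b = 0%R by apply: (eq_of_sub e1); ring.
  have c0 : c = 0%R by apply/esym/(eq_of_sub f1); ring.
  have ad : a = d by apply: (eq_of_sub f2); rewrite b0; ring.
  rewrite b0 c0 ad eqxx; split=> //; rewrite -GRing.sqrf_eq1.
  by rewrite GRing.expr2 -D b0 c0 ad; apply/eqP; ring.
split=> [|y /sl2P[a' [b' [c' [d' [D' ->]]]]]]; first exact: sl2_in.
by rewrite /commute !sl2M // b0 c0 -ad; congr sl2; ring.
Qed.

Lemma F2_neq0 : (2%:R != 0 :> F)%R.
Proof.
apply/eqP=> F2; have /eqP[] : (1 != 0 :> F)%R by rewrite GRing.oner_neq0.
by transitivity (17%:R - 8%:R * 2%:R : F)%R; [ring | rewrite F17 F2; ring].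
Qed.

Lemma F3_neq0 : (3%:R != 0 :> F)%R.
Proof.
apply/eqP=> F3; have /eqP[] : (1 != 0 :> F)%R by rewrite GRing.oner_neq0.
by transitivity (6%:R * 3%:R - 17%:R : F)%R; [ring | rewrite F17 F3; ring].
Qed.

Lemma eqN_eq0 t : t = (- t)%R -> t = 0%R.
Proof.
move=> eqt; apply: (GRing.mulfI F2_neq0).
by apply: (eq_of_sub eqt); ring.
Qed.

Lemma card_center_SL : #|Z| = 2.
Proof.
have D := detN det1; rewrite !GRing.oppr0 in D.
have -> : Z = [set 1; sl2 (-1) 0 0 (-1)] :> {set _}.
  apply/setP=> x; apply/idP/set2P => [Zx | [] ->]; first last.
  - by rewrite sl2_central ?eqxx ?orbT.
  - exact: group1.
  have /sl2P[a [b [c [d [Dx defx]]]]] := subsetP (center_sub _) x Zx.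
  move: Zx; rewrite defx sl2_central // => /and4P[/eqP-> /eqP-> /eqP<- /orP[]/eqP->].
    by left; apply: sl2_1.
  by right.
rewrite cards2 -sl2_1; apply/eqP; rewrite eqSS eqb1; apply/eqP=> /sl2_inj[]//.
  exact: det1.
by move/eqN_eq0/eqP; rewrite GRing.oner_eq0.
Qed.

(** The determinant maps the general linear group onto the 16 units, with kernel [S]. *)
Lemma card_SL : #|S| = (17 * 16 * 18)%N.
Proof.
have unitdet (x : {'GL_2[F]}) : (\det (GLval x))%R \is a GRing.unit.
  by rewrite -unitmxE GL_unitmx.
pose f (x : {'GL_2[F]}) : {unit F} := FinRing.unit F (unitdet x).
have fM : {in [set: {'GL_2[F]}] &, {morph f : x y / x * y}}.
  by move=> x y _ _; apply: val_inj; rewrite /= det_mulmx.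
pose phi := Morphism fM.
have kerphi : 'ker phi = S.
  by apply/setP=> x; rewrite SP !inE -val_eqE.
have imphi : phi @* [set: _] = [set: {unit F}].
  apply/eqP; rewrite eqEsubset subsetT; apply/subsetP=> u _.
  have Uu : mx2 (val u) 0%R 0%R 1%R \in unitmx.
    by rewrite unitmxE det_mx2 GRing.mulr1 GRing.mul0r GRing.subr0 (valP u).
  apply/morphimP; exists (FinRing.unit 'M_2 Uu : {'GL_2[F]}); rewrite ?inE //.
  by apply: val_inj; rewrite /= det_mx2 GRing.mulr1 GRing.mul0r GRing.subr0.
have := card_morphim phi [set: _]; rewrite imphi card_finField_unit cardF setIid.
have SG : S \subset [set: {'GL_2[F]}] := subsetT S.
rewrite kerphi => /eqP; rewrite -(eqn_pmul2l (cardG_gt0 S)) Lagrange //.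
have := card_GL_2 F; rewrite cardF => /= ->.
have E i j k : (i * j ^ 2 * k = i * j * k * j)%N by ring.
by rewrite E eqn_pmul2r // => /eqP.
Qed.

Definition psl2 a b c d := coset Z (sl2 a b c d).
Arguments psl2 (a b c d)%_R.

Local Notation T := (S / Z)%G.

Lemma card_PSL : #|T| = 2448%N.
Proof.
have := card_quotient (normal_norm (center_normal S)).
by rewrite -divgS ?center_sub // card_SL card_center_SL.
Qed.

Lemma norm_center_SL x : x \in S -> x \in 'N(Z).
Proof. exact: (subsetP (normal_norm (center_normal S))). Qed.

Lemma psl2P X : reflect (exists a b c d, det a b c d = 1%R /\ X = psl2 a b c d) (X \in T).
Proof.
apply: (iffP morphimP) => [[x Nx /sl2P[a [b [c [d [D ->]]]]] ->] | [a [b [c [d [D ->]]]]]].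
  by exists a, b, c, d.
by exists (sl2 a b c d); rewrite ?norm_center_SL ?sl2_in.
Qed.

Lemma psl2_in a b c d : det a b c d = 1%R -> psl2 a b c d \in T.
Proof. by move=> D; apply/psl2P; exists a, b, c, d. Qed.

Lemma psl2M a b c d a' b' c' d' : det a b c d = 1%R -> det a' b' c' d' = 1%R ->
  psl2 a b c d * psl2 a' b' c' d' = psl2 (a * a' + b * c') (a * b' + b * d')
                                      (c * a' + d * c') (c * b' + d * d').
Proof.
by move=> D D'; rewrite /psl2 -morphM ?norm_center_SL ?sl2_in // sl2M.
Qed.

Lemma psl2E a b c d : psl2 a b c d = coset Z (sl2 a b c d).
Proof. by []. Qed.

Local Opaque psl2.

Lemma eq_psl2 a b c d a' b' c' d' : a = a' -> b = b' -> c = c' -> d = d' ->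
  psl2 a b c d = psl2 a' b' c' d'.
Proof. by move=> -> -> -> ->. Qed.

Lemma mem_psl2 a b c d a' b' c' d' (M : {set coset_of Z}) :
  a = a' -> b = b' -> c = c' -> d = d' -> psl2 a b c d \in M -> psl2 a' b' c' d' \in M.
Proof. by move=> -> -> -> ->. Qed.

Lemma psl2_1 : psl2 1 0 0 1 = 1.
Proof. rewrite psl2E sl2_1.
exact: coset_id (group1 Z). Qed.

Lemma psl2N a b c d : det a b c d = 1%R -> psl2 (-a) (-b) (-c) (-d) = psl2 a b c d.
Proof.
move=> D; have D1 := detN det1; rewrite !GRing.oppr0 in D1.
have Zm : sl2 (-1) 0 0 (-1) \in Z by rewrite sl2_central // !eqxx orbT.
rewrite -[RHS]mul1g -(coset_id Zm) -psl2E psl2M //.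
apply: eq_psl2; ring.
Qed.

Lemma psl2_inj a b c d a' b' c' d' : det a b c d = 1%R -> det a' b' c' d' = 1%R ->
  psl2 a b c d = psl2 a' b' c' d' ->
  [/\ a = a', b = b', c = c' & d = d'] \/ [/\ a = - a', b = - b', c = - c' & d = - d']%R.
Proof.
move=> D D' /(rcoset_kercosetP (norm_center_SL (sl2_in D)) (norm_center_SL (sl2_in D'))).
case/rcosetP=> z Zz.
have /sl2P[x [y [z' [t [Dz defz]]]]] := subsetP (center_sub _) z Zz.
move: Zz; rewrite defz sl2_central // => /and4P[/eqP y0 /eqP z0 /eqP xt x1].
rewrite y0 z0 -xt in Dz *; rewrite sl2M // => /(sl2_inj D (detM Dz D')).
rewrite !GRing.mul0r !GRing.addr0 !GRing.add0r => -[-> -> -> ->].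
by case/orP: x1 => /eqP->; [left | right]; split; ring.
Qed.

Lemma psl2V a b c d : det a b c d = 1%R -> (psl2 a b c d)^-1 = psl2 d (-b) (-c) a.
Proof.
move=> D; have D' : det d (- b) (- c) a = 1%R by rewrite -D; ring.
apply/eqP; rewrite eq_invg_mul psl2M // -psl2_1; apply/eqP; apply: eq_psl2.
all: by rewrite -?D; ring.
Qed.

Definition up t := psl2 1 t 0 1.
Definition lo t := psl2 1 0 t 1.
Arguments up t%_R.
Arguments lo t%_R.

Lemma up_in t : up t \in T.
Proof. exact: psl2_in (det_up t). Qed.

Lemma lo_in t : lo t \in T.
Proof. exact: psl2_in (det_lo t). Qed.

Lemma upD s t : up s * up t = up (s + t).
Proof. rewrite psl2M ?det_up //; apply: eq_psl2; ring. Qed.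

Lemma up0 : up 0 = 1.
Proof. exact: psl2_1. Qed.

Lemma upX t n : up t ^+ n = up (t *+ n).
Proof. by elim: n => [|n IH]; rewrite ?up0 // expgS IH upD GRing.mulrS. Qed.

Lemma up_inj : injective up.
Proof.
move=> s t /(psl2_inj (det_up s) (det_up t))[[] // | [/eqN_eq0/eqP]].
by rewrite GRing.oner_eq0.
Qed.

Lemma order_up t : t != 0%R -> #[up t] = 17.
Proof.
move=> nt; apply: nt_prime_order => //.
  by rewrite upX -GRing.mulr_natr F17 GRing.mulr0 up0.
by apply: contra nt => /eqP; rewrite -up0 => /up_inj ->.
Qed.

Lemma psl2_Bruhat a b c d : det a b c d = 1%R -> c != 0%R ->
  psl2 a b c d = up ((a - 1) / c) * lo c * up ((d - 1) / c).
Proof.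
move=> D nc; rewrite [up _ * _]psl2M ?det_up ?det_lo // psl2M ?det_up //; last first.
  exact: detM (det_up _) (det_lo _).
have bE : b = ((a * d - 1) / c)%R by rewrite -D; field.
by apply: eq_psl2; rewrite ?bE; field.
Qed.

(** Elements with [c != 0] have a Bruhat decomposition; multiplication by [lo 1] brings the others
    to this case. *)
Lemma psl2_generated (H : {group coset_of Z}) :
  (forall t, up t \in H) -> (forall t, lo t \in H) -> T \subset H.
Proof.
move=> Hu Hl; have big a b c d : det a b c d = 1%R -> c != 0%R -> psl2 a b c d \in H.
  by move=> D nc; rewrite psl2_Bruhat // !groupM.
apply/subsetP=> _ /psl2P[a [b [c [d [D ->]]]]].
have [c0 | ] := eqVneq c 0%R; last exact: big.
rewrite -(groupMl _ (Hl 1%R)) psl2M ?det_lo //; apply: big.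
  exact: detM (det_lo _) D.
rewrite c0 GRing.mulr0 GRing.addr0 GRing.mul1r; apply: contraPneq D => a0.
by rewrite a0 c0 GRing.mulr0 GRing.mul0r GRing.subrr; apply/nesym/eqP; rewrite GRing.oner_eq0.
Qed.

(* u, v as below: u has trace -1 and v has trace 1, so their cubes are central. *)
Lemma order_tr1 a b c d : det a b c d = 1%R -> (a + d = -1)%R -> #[psl2 a b c d] = 3.
Proof.
move=> D tr; have dE : d = (- 1 - a)%R by apply: (eq_of_sub tr); ring.
have bc : (b * c = - 1 - a - a ^+ 2)%R by apply/esym/(eq_of_sub D); rewrite dE; ring.
apply: nt_prime_order => //.
  rewrite expgS expgS expg1 !psl2M ?detM // -psl2_1.
  apply: eq_psl2; rewrite ?dE; ring: bc.
apply/eqP; rewrite -psl2_1 => /(psl2_inj D det1) H.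
have : (2%:R + 1 = 0 :> F \/ 1 = 0 :> F)%R.
  case: H => [[a1 _ _ d1] | [a1 _ _ d1]]; [left | right].
    by apply: (eq_of_sub tr); rewrite a1 d1; ring.
  by apply/esym/(eq_of_sub tr); rewrite a1 d1; ring.
case=> /eqP; rewrite ?GRing.oner_eq0 //.
by rewrite GRing.natr1 (negPf F3_neq0).
Qed.

Lemma psl2J a b c d a' b' c' d' : det a b c d = 1%R -> det a' b' c' d' = 1%R ->
  psl2 a b c d ^ psl2 a' b' c' d' =
  psl2 ((d' * a - b' * c) * a' + (d' * b - b' * d) * c')
       ((d' * a - b' * c) * b' + (d' * b - b' * d) * d')
       ((a' * c - c' * a) * a' + (a' * d - c' * b) * c')
       ((a' * c - c' * a) * b' + (a' * d - c' * b) * d').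
Proof.
move=> D D'; have DV : det d' (- b') (- c') a' = 1%R by rewrite -D'; ring.
rewrite /conjg psl2V // [psl2 a b c d * _]psl2M // psl2M //; last exact: detM.
by apply: eq_psl2; ring.
Qed.

Lemma upJ a b c d s : det a b c d = 1%R ->
  up s ^ psl2 a b c d = psl2 (1 + s * c * d) (s * d ^+ 2) (- (s * c ^+ 2)) (1 - s * c * d).
Proof.
move=> D; have D' : det d (- b) (- c) a = 1%R by rewrite -D; ring.
have ad : (a * d = 1 + b * c)%R by apply: (eq_of_sub D); ring.
rewrite /conjg psl2V // [up s * _]psl2M ?det_up // psl2M //; last exact: detM (det_up s) D.
by apply: eq_psl2; ring: ad.
Qed.

Lemma diag_upJ a d s : (a * d = 1)%R -> up s ^ psl2 a 0 0 d = up (s * d ^+ 2).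
Proof.
move=> ad; have D : det a 0 0 d = 1%R by rewrite ad; ring.
by rewrite upJ //; apply: eq_psl2; ring.
Qed.

(** A nontrivial [M] contains an element with [c != 0], which makes each [lo t] agree with some
    [up s] modulo [M]. So [T / M] is abelian, and conjugation by a diagonal element then puts all
    [up s] in [M]. *)
Lemma PSL_simple : simple T.
Proof.
apply/simpleP; split=> [|M nsM]; first by rewrite -cardG_gt1 card_PSL.
have [-> | ntM] := eqVneq (M : {set _}) 1; [by left | right].
have nMT := normal_norm nsM.
have MJ x y : x \in M -> y \in T -> x ^ y \in M.
  by move=> Mx Ty; rewrite memJ_norm // (subsetP nMT).
have [a [b [c [d [D nc Mx]]]]] : exists a b c d,
    [/\ det a b c d = 1%R, c != 0%R & psl2 a b c d \in M].
  have /trivgPn[x Mx ntx] := ntM.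
  have /psl2P[a [b [c [d [D defx]]]]] := subsetP (normal_sub nsM) x Mx.
  rewrite {x}defx in Mx ntx.
  have [c0 | nc] := eqVneq c 0%R; last by exists a, b, c, d.
  have [b0 | nb] := eqVneq b 0%R.
    (* Conjugating a diagonal matrix by [lo 1] produces the entry [d - a], nonzero unless the matrix
       is central. *)
    exists a, 0%R, (d - a)%R, d; rewrite b0 c0 in D Mx ntx; split.
    - by rewrite -D; ring.
    - rewrite GRing.subr_eq0; apply: contra ntx => /eqP da; rewrite da in D *.
      have : (a ^+ 2 == 1)%R by rewrite -D; apply/eqP; ring.
      rewrite GRing.sqrf_eq1 => /orP[]/eqP->; apply/eqP; first exact: psl2_1.
      by rewrite -[RHS]psl2_1 -[RHS](psl2N det1) !GRing.oppr0.
    have := MJ _ _ Mx (lo_in 1%R); rewrite psl2J ?det_lo //.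
    by apply: mem_psl2; ring.
  have Dw : det 0 (-1) 1 0 = 1%R :> F by ring.
  exists d, (- c)%R, (- b)%R, a; split; first by rewrite -D; ring.
    by rewrite GRing.oppr_eq0.
  have := MJ _ _ Mx (psl2_in Dw); rewrite psl2J //.
  by apply: mem_psl2; ring.
have Ny x : x \in T -> x \in 'N(M) by move/(subsetP nMT).
(* [y] is a conjugate of the given element with upper left entry 0, so up to an [up] it carries
   upper to lower unipotents. Since [y] is trivial modulo [M] and the [up] commute, [up s] and its
   image agree modulo [M]. *)
have [y My upJy] : exists2 y, y \in M & forall s,
    (up s ^ y) ^ up (- (a + d) / c) = lo (- (s * c ^+ 2)).
  exists (psl2 a b c d ^ up (a / c)); first exact: MJ (up_in _).
  have Dy : det 0 (- c^-1) c (a + d) = 1%R by field.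
  have -> : psl2 a b c d ^ up (a / c) = psl2 0 (- c^-1) c (a + d).
    rewrite psl2J ?det_up //; have bE : b = ((a * d - 1) / c)%R by rewrite -D; field.
    by apply: eq_psl2; rewrite ?bE; field.
  move=> s; rewrite upJ // psl2J ?det_up //; first by apply: eq_psl2; field.
  by ring.
have phi_lo s : coset M (lo (- (s * c ^+ 2))) = coset M (up s).
  have Ty : y \in T := subsetP (normal_sub nsM) y My.
  have upC r : up s ^ up r = up s.
    by apply/conjg_fixP/commgP; rewrite /commute !upD GRing.addrC.
  by rewrite -upJy !morphJ ?groupJ ?Ny ?up_in //= (coset_id My) conjg1 -morphJ ?Ny ?up_in //= upC.
have upM s : up s \in M.
  pose A := [set coset M (up t) | t : F].
  have upC t : coset M (up t) \in 'C(A).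
    apply/centP=> _ /imsetP[r _ ->].
    have /(congr1 (coset M)) : up t * up r = up r * up t by rewrite !upD GRing.addrC.
    by rewrite !morphM ?Ny ?up_in.
  have /subsetP sTC : T \subset (coset M @*^-1 'C(A))%G.
    apply: psl2_generated => t; apply/morphpreP; split.
    - exact: Ny (up_in t).
    - exact: upC.
    - exact: Ny (lo_in t).
    have -> : t = (- ((- t / c ^+ 2) * c ^+ 2))%R by field.
    rewrite -[coset_morphism M _]/(coset M _) phi_lo; exact: upC.
  (* Conjugation by diag(2, 9) multiplies the parameter of [up] by 81 and is trivial modulo [M], so
     [up (80 r)] lies in [M]. With r = 10 s this is [up s], as 800 = 47 * 17 + 1. *)
  have D29 : (2%:R * 9%:R = 1 :> F)%R by apply: (eq_of_sub F17); ring.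
  have D29' : det 2%:R 0 0 9%:R = 1%R :> F by rewrite D29; ring.
  have /morphpreP[_ /centP cA] := sTC _ (psl2_in D29').
  have sE : s = ((s * 10%:R) * 9%:R ^+ 2 + - (s * 10%:R))%R.
    by apply: (eq_of_sub (congr1 (fun z => - (s * 47%:R * z))%R F17)); ring.
  have upN t : up (- t) = (up t)^-1.
    by apply/eqP; rewrite eq_sym eq_invg_mul upD GRing.subrr up0.
  rewrite sE -upD; set r := (s * 10%:R)%R.
  have eqr : coset M (up (r * 9%:R ^+ 2)) = coset M (up r).
    rewrite -(diag_upJ _ D29) morphJ ?Ny ?up_in ?psl2_in //=.
    by apply/conjg_fixP/commgP/commute_sym/cA; apply/imsetP; exists r.
  apply: coset_idr; first by rewrite groupM ?Ny ?up_in.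
  have Nr : up r \in 'N(M) := Ny _ (up_in r).
  rewrite upN (morphM (coset_morphism M) (Ny _ (up_in _)) (groupVr Nr)).
  rewrite (morphV (coset_morphism M) Nr).
  by apply/eqP; rewrite -eq_mulgV1; apply/eqP.
apply/eqP; rewrite eqEsubset normal_sub //=; apply: psl2_generated => // t.
apply: coset_idr; rewrite ?Ny ?lo_in //.
have -> : t = (- ((- t / c ^+ 2) * c ^+ 2))%R by field.
by rewrite phi_lo coset_id.
Qed.

Lemma PSL_gen17 s t : s != 0%R -> up t \in <[up s]>.
Proof.
move=> ns; suffices -> : <[up s]> = up @: setT by rewrite imset_f.
apply/eqP; rewrite eqEcard card_imset ?cardsT; last exact: up_inj.
rewrite [X in _ <= X]order_up // cardF leqnn andbT.
by apply/subsetP=> _ /cycleP[n ->]; rewrite upX imset_f.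
Qed.

Lemma PSL_order2 : (4%:R * - 4%:R = 1 :> F)%R -> #[psl2 4%:R 0 0 (- 4%:R)] = 2.
Proof.
move=> m16; have Dj : det 4%:R 0 0 (- 4%:R) = 1%R :> F by rewrite m16; ring.
apply: nt_prime_order => //.
  rewrite expgS expg1 psl2M // -psl2_1 -[RHS](psl2N det1).
    by apply: eq_psl2; try ring; apply/esym/(eq_of_sub m16); ring.
  apply/eqP; rewrite -psl2_1 => /(psl2_inj Dj det1)[[e4 _ _ en4]|[e4 _ _ en4]].
    have /eqN_eq0/eqP : (1 = - 1 :> F)%R by rewrite -{1}en4 e4.
    by rewrite GRing.oner_eq0.
  have /eqN_eq0/eqP : (1 = - 1 :> F)%R by rewrite -e4; apply: GRing.oppr_inj; rewrite en4.
  by rewrite GRing.oner_eq0.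
Qed.

(** As 16 = -1 in F, diag(4, -4) has determinant 1; it anticommutes with the Weyl element [i], so
    the two involutions commute modulo the centre. *)
Lemma PSL_klein : exists V : {group coset_of Z},
  [/\ V \subset T, 2.-group V, abelian V & ~~ cyclic V].
Proof.
have m16 : (4%:R * - 4%:R = 1 :> F)%R by apply/esym/(eq_of_sub F17); ring.
pose i := psl2 0 (-1) 1 0; pose j := psl2 4%:R 0 0 (- 4%:R).
have Di : det 0 (-1) 1 0 = 1%R :> F by ring.
have Dj : det 4%:R 0 0 (- 4%:R) = 1%R :> F by rewrite m16; ring.
have ntri : i != 1.
  apply/eqP; rewrite -psl2_1 => /(psl2_inj Di det1)[[_ _ /eqP] | [_ _ /eqP]].
    by rewrite GRing.oner_eq0.
  by rewrite GRing.oppr0 GRing.oner_eq0.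
have n4 : (4%:R != 0 :> F)%R.
  by apply: contraPneq m16 => ->; rewrite GRing.mul0r; apply/nesym/eqP; rewrite GRing.oner_eq0.
have oi : #[i] = 2.
  apply: nt_prime_order => //; rewrite expgS expg1 psl2M // -psl2_1 -[RHS](psl2N det1).
  by apply: eq_psl2; ring.
have oj : #[j] = 2 := PSL_order2 m16.
have neq : i != j.
  apply/eqP=> /(psl2_inj Di Dj)[[/eqP] | [/eqP]]; first by rewrite eq_sym (negPf n4).
  by rewrite eq_sym GRing.oppr_eq0 (negPf n4).
have cij : j \in 'C[i].
  apply/cent1P; rewrite /commute !psl2M // -[RHS]psl2N; last exact: detM.
  by apply: eq_psl2; ring.
have Ti : i \in T := psl2_in Di; have Tj : j \in T := psl2_in Dj.
have cent_ij : <[j]> \subset 'C(<[i]>) by rewrite cycle_subG /= cent_cycle.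
exists (<[i]> <*> <[j]>)%G; split.
- by rewrite join_subG !cycle_subG Ti.
- by rewrite /= cent_joinEr // pgroupM /pgroup -!orderE oi oj.
- by rewrite /= cent_joinEr // abelianM !cycle_abelian.
apply/negP=> cyc; have [i_in j_in] : <[i]> \subset <[i]> <*> <[j]> /\ <[j]> \subset <[i]> <*> <[j]>.
  by rewrite joing_subl joing_subr.
have : <[i]> == <[j]> by rewrite (eq_subG_cyclic cyc) // -!orderE oi oj.
rewrite (cycle2g oi) (cycle2g oj) => /eqP/setP/(_ j).
rewrite !inE eqxx orbT (eq_sym j i) (negPf neq) orbF => /eqP j1.
by rewrite j1 order1 in oj.
Qed.

Lemma PSL_like : psl_like T.
Proof.
split; [exact: PSL_simple | exact: card_PSL | exact: PSL_klein | ].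
pose u := psl2 0 (-1) 1 (-1); pose v := psl2 (-1) 3%:R (-1) 2%:R.
have Du : det 0 (-1) 1 (-1) = 1%R :> F by ring.
have Dv : det (-1) 3%:R (-1) 2%:R = 1%R :> F by ring.
(* Since 6^2 = 36 = 2 in F, conjugation by diag(3, 6) doubles the parameter of [up], which squares
   the element. *)
have Dh : (3%:R * 6%:R = 1 :> F)%R by apply: (eq_of_sub F17); ring.
have Dh' : det 3%:R 0 0 6%:R = 1%R :> F by rewrite Dh; ring.
have uv : u * v = up (- 2%:R) by rewrite psl2M //; apply: eq_psl2; ring.
exists u, v, (psl2 3%:R 0 0 6%:R); rewrite uv; split.
- have [Tu Tv] : u \in T /\ v \in T by split; apply: psl2_in.
  apply/eqP; rewrite eqEsubset gen_subG subUset !sub1set Tu Tv /=.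
  have [Hu Hv] : u \in <<[set u; v]>> /\ v \in <<[set u; v]>>.
    by split; apply: mem_gen; rewrite !inE eqxx ?orbT.
  have Hup t : up t \in <<[set u; v]>>.
    have : up t \in <[up (- 2%:R)]> by rewrite PSL_gen17 // GRing.oppr_eq0 F2_neq0.
    by apply: subsetP; rewrite cycle_subG -uv groupM.
  apply: psl2_generated => // t.
  have <- : up (- t) ^ u^-1 = lo t by rewrite psl2V // upJ; [apply: eq_psl2; ring | ring].
  by rewrite groupJ ?groupV.
- exact: psl2_in.
- split; first by apply: order_tr1; rewrite // GRing.add0r.
  by rewrite /v -(psl2N Dv) order_tr1 ?detN //; ring.
- by rewrite order_up // GRing.oppr_eq0 F2_neq0.
rewrite diag_upJ // upX; congr up.
by apply: (eq_of_sub (congr1 (fun z => - (4%:R * z))%R F17)); ring.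
Qed.

(** Cayley-Hamilton: X^2 = (tr X) X - 1. *)
Lemma psl2_sqr a b c d : det a b c d = 1%R -> psl2 a b c d ^+ 2 =
  psl2 ((a + d) * a - 1) ((a + d) * b) ((a + d) * c) ((a + d) * d - 1).
Proof.
move=> D; have bc : (b * c = a * d - 1)%R by apply/esym/(eq_of_sub D); ring.
by rewrite expgS expg1 psl2M //; apply: eq_psl2; ring: bc.
Qed.

Lemma det_sqr a b c d : det a b c d = 1%R ->
  det ((a + d) * a - 1) ((a + d) * b) ((a + d) * c) ((a + d) * d - 1) = 1%R.
Proof.
move=> D; have bc : (b * c = a * d - 1)%R by apply/esym/(eq_of_sub D); ring.
by ring: bc.
Qed.

Lemma psl2_involution a b c d : det a b c d = 1%R ->
  psl2 a b c d ^+ 2 = 1 -> psl2 a b c d != 1 -> (a + d = 0)%R.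
Proof.
move=> D; rewrite psl2_sqr // -{1}psl2_1 => sq1 nt1.
have [-> // | nt] := eqVneq (a + d)%R 0%R; case/negP: nt1.
have [e1 e2 e3] : [/\ (a + d) * b = (a + d) * 0, (a + d) * c = (a + d) * 0
    & (a + d) * a = (a + d) * d]%R.
  case: (psl2_inj (det_sqr D) det1 sq1) => -[h1 -> -> h4]; rewrite ?GRing.oppr0 GRing.mulr0.
    by split=> //; apply: (GRing.addIr (- 1)%R); rewrite h1.
  by split=> //; apply: (GRing.addIr (- 1)%R); rewrite h1.
have ad := GRing.mulfI nt e3; have b0 := GRing.mulfI nt e1; have c0 := GRing.mulfI nt e2.
rewrite b0 c0 -ad in D *; have : (a ^+ 2 == 1)%R by rewrite -D; apply/eqP; ring.
rewrite GRing.sqrf_eq1 => /orP[] /eqP->; apply/eqP; first exact: psl2_1.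
by rewrite -[RHS]psl2_1 -[RHS](psl2N det1) !GRing.oppr0.
Qed.

(** A root would give 3^8 = t^16 = 1, but 3^8 - 1 = 6560 = 386 * 17 - 2. *)
Lemma nonsquare_3 t : (t ^+ 2 != 3%:R)%R.
Proof.
apply/eqP=> t3; have t0 : (t != 0)%R.
  by apply: contraNneq F3_neq0 => t0; rewrite -t3 t0 GRing.expr2 GRing.mul0r.
have /eqP := expf_card t; rewrite cardF (GRing.exprS _ 16).
rewrite -[X in _ == X]GRing.mulr1 (inj_eq (GRing.mulfI t0)).
rewrite (GRing.exprM _ 2 8) t3 => /eqP e3.
have /eqP[] : (2%:R != 0 :> F)%R := F2_neq0.
transitivity (386%:R * 17%:R - (3%:R ^+ 8 - 1) : F)%R; first by ring.
by rewrite F17 e3; ring.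
Qed.

(** Let t be the trace of [x]. The involution [x ^+ 3] has trace t^3 - 3 t = 0, and t is nonzero
    because [x ^+ 2] is nontrivial; so t would be a square root of 3. *)
Lemma nadj_PSL_2_3 : nadj T 2 3.
Proof.
apply/negPn/nadjPn => -[x /psl2P[a [b [c [d [D defx]]]]] ox].
have ox2 : #[x ^+ 2] = 3 by rewrite orderXdiv ox.
have ox3 : #[x ^+ 3] = 2 by rewrite orderXdiv ox.
have x3E : x ^+ 3 = psl2 a b c d * psl2 a b c d ^+ 2 by rewrite expgS defx.
rewrite psl2_sqr // psl2M // in x3E; last exact: det_sqr.
have nt3 : x ^+ 3 != 1 by rewrite -order_eq1 ox3.
have := expg_order (x ^+ 3); rewrite ox3.
rewrite x3E in nt3 * => inv3.
have tr3 := psl2_involution (detM D (det_sqr D)) inv3 nt3.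
have bc : (b * c = a * d - 1)%R by apply/esym/(eq_of_sub D); ring.
have t0 : (a + d != 0)%R.
  apply/eqP=> t0; have : x ^+ 2 = 1.
    rewrite defx psl2_sqr // t0 -[RHS]psl2_1 -[RHS](psl2N det1).
    by apply: eq_psl2; ring.
  by move=> x21; rewrite x21 order1 in ox2.
have t3 : ((a + d) ^+ 2 = 3%:R)%R.
  by apply: (GRing.mulfI t0); apply: (eq_of_sub tr3); ring: bc.
by have /eqP[] := nonsquare_3 (a + d)%R.
Qed.

Lemma PSL_cent_up z t : z \in T -> t != 0%R -> commute z (up t) ->
  exists s, z = up s.
Proof.
case/psl2P=> a [b [c [d [D ->]]]] nt; rewrite /commute !psl2M ?det_up //.
move/psl2_inj; rewrite !detM ?det_up // => /(_ erefl erefl) H.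
have [c0 ad] : c = 0%R /\ a = d.
  case: H => [[e1 e2 _ _] | [e1 e2 e3 e4]].
    split; apply: (GRing.mulfI nt).
      by apply/esym/(eq_of_sub e1); ring.
    by apply: (eq_of_sub e2); ring.
  have c0 : c = 0%R by apply: eqN_eq0; apply: (eq_of_sub e3); ring.
  have a0 : a = 0%R by apply: eqN_eq0; apply: (eq_of_sub e1); rewrite c0; ring.
  by have /eqP := D; rewrite a0 c0 GRing.mul0r GRing.mulr0 GRing.subrr eq_sym GRing.oner_eq0.
rewrite c0 -ad in D *; have : (a ^+ 2 == 1)%R by rewrite -D; apply/eqP; ring.
rewrite GRing.sqrf_eq1 => /orP[] /eqP a1; first by exists b; rewrite a1.
exists (- b)%R; rewrite -(psl2N D) a1; apply: eq_psl2; ring.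
Qed.

(** Up to conjugacy an element of order 17 is some [up t], whose centraliser consists of elements
    [up s], of exponent 17. *)
Lemma nadj_PSL_17 q : prime q -> q != 17 -> nadj T 17 q.
Proof.
move=> pr_q nq; apply/negPn/nadjPn => -[x Tx ox].
have oy : #[x ^+ q] = 17 by rewrite orderXdiv ox ?dvdn_mull // mulnK ?prime_gt0.
have oz : #[x ^+ 17] = q by rewrite orderXdiv ox ?dvdn_mulr // mulKn.
have sylU : 17.-Sylow(T) <[up 1]>.
  rewrite pHallE cycle_subG up_in -orderE order_up ?GRing.oner_eq0 //= card_PSL.
  by rewrite p_part (_ : logn 17 2448 = 1%N) //; vm_compute.
have sxT : <[x ^+ q]> \subset T by rewrite cycle_subG groupX.
have px : 17.-group <[x ^+ q]> by rewrite /pgroup -orderE oy.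
have [g Tg] := Sylow_Jsub sylU sxT px.
rewrite -cycleJ cycle_subG => /cycleP[n]; rewrite upX => defxq.
have nt : (1 *+ n != 0 :> F)%R.
  apply/eqP=> n0; move: oy; rewrite -(orderJ _ g) defxq n0 up0 order1 //.
have com : commute ((x ^+ 17) ^ g) (up (1 *+ n)).
  rewrite -defxq /commute -!conjMg; congr (_ ^ _).
  by apply: commuteX; apply/commute_sym/commuteX.
have [|s defz] := PSL_cent_up _ nt com; first by rewrite groupJ ?groupX.
have : ((x ^+ 17) ^ g) ^+ 17 = 1 by rewrite defz upX -GRing.mulr_natr F17 GRing.mulr0 up0.
move/eqP; rewrite -order_dvdn orderJ oz dvdn_prime2 //.
by rewrite (negPf nq).
Qed.

(** * A module for PSL(2,17) on which, among elements of prime order, exactly those of order 17 have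
    no fixed point *)

Section Module.

Variable K : fieldType.
Hypothesis K17 : (17%:R != 0 :> K)%R.

(* By [zform_up] these are the sums of phi over the values of the form [zform]
   on the cosets of the subgroups of order 17. They give 16 linear
   equations in 17 unknowns. *)
Lemma zonal_function : exists2 phi : F -> K, exists t, phi t != 0%R &
  forall k, k != 0%R -> (\sum_(s : F) phi (k * s ^+ 2 + 3%:R * (k + k^-1)) = 0)%R.
Proof.
pose A : 'M[K]_(#|F|, #|{: {unit F}}|) := (\matrix_(i, j)
  \sum_(s : F) (enum_val i == val (enum_val j) * s ^+ 2 +
    3%:R * (val (enum_val j) + (val (enum_val j))^-1))%:R)%R.
have : (kermx A != 0)%R.
  rewrite kermx_eq0 /row_free; apply: contraTneq (rank_leq_col A) => ->.
  by rewrite cardF -ltnNge -cardsT card_finField_unit cardF.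
case/rowV0Pn=> u /sub_kermxP uA nzu.
exists (fun t => u 0%R (enum_rank t)).
  have /existsP[i ui] : [exists i, u 0%R i != 0%R].
    apply: contraR nzu; rewrite negb_exists => /forallP u0.
    by apply/eqP/rowP=> i; rewrite mxE; apply/eqP; have := u0 i; rewrite negbK.
  by exists (enum_val i); rewrite enum_valK.
move=> k nk; have Uk : k \is a GRing.unit by rewrite GRing.unitfE.
have := congr1 (fun M : 'rV__ => M 0%R (enum_rank (FinRing.unit F Uk))) uA.
rewrite /= !mxE => uAk; rewrite -[RHS]uAk.
under [RHS]eq_bigr do rewrite mxE enum_rankK /= GRing.mulr_sumr.
rewrite exchange_big /=; apply: eq_bigr => s _.
rewrite (bigD1 (enum_rank (k * s ^+ 2 + 3%:R * (k + k^-1))%R)) //= enum_rankK eqxx GRing.mulr1.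
rewrite big1 ?GRing.addr0 // => i ni; case: eqP => [ei|]; last by rewrite GRing.mulr0.
by rewrite -ei enum_valK eqxx in ni.
Qed.

(* 3 (a^2 + 3 c^2) + (b^2 + 3 d^2): a function of [zform] is left invariant under
   the isometries of x^2 + 3 y^2, which is anisotropic over F. *)
Definition zform a b c d : F :=
  (3%:R * a ^+ 2 + b ^+ 2 + 9%:R * c ^+ 2 + 3%:R * d ^+ 2)%R.

Arguments zform (a b c d)%_R.

Lemma natr_mod17 n : (n%:R = (n %% 17)%:R :> F)%R.
Proof. by rewrite {1}(divn_eq n 17) GRing.natrD GRing.natrM F17 GRing.mulr0 GRing.add0r. Qed.

Lemma F17_natr t : exists2 n, n < 17 & t = (n%:R)%R.
Proof.
have /(PSL_gen17 t)/cycleP[n] : (1 != 0 :> F)%R by rewrite GRing.oner_neq0.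
rewrite upX => /up_inj ->; exists (n %% 17); first by rewrite ltn_mod.
exact: natr_mod17.
Qed.

(** As -1 = 4^2 in F, -3 is a nonsquare together with 3. *)
Lemma nonsquare_N3 (x y : F) : (x ^+ 2 + 3%:R * y ^+ 2 = 0)%R -> x = 0%R /\ y = 0%R.
Proof.
move=> xy; have [y0 | ny] := eqVneq y 0%R.
  split=> //; move: xy; rewrite y0 GRing.expr0n GRing.mulr0 GRing.addr0 => /eqP.
  by rewrite GRing.expf_eq0 => /andP[_ /eqP].
have /eqP[] := nonsquare_3 (4%:R * (x / y))%R.
have x2 : (x ^+ 2 = - (3%:R * y ^+ 2))%R by apply: (eq_of_sub xy); ring.
rewrite GRing.exprMn GRing.expr_div_n x2.
transitivity (3%:R * (17%:R * -1 + 1) : F)%R; last by rewrite F17; ring.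
by field.
Qed.

Lemma zform_surj t : exists a b c d, det a b c d = 1%R /\ zform a b c d = t.
Proof.
(* Triples [(a, b, d)] with a d = 1, one for each value of the form on upper triangular matrices. *)
pose sols := [:: (2, 0, 9); (2, 1, 9); (1, 8, 1); (3, 2, 6); (1, 7, 1);
  (1, 4, 1); (1, 0, 1); (1, 1, 1); (1, 6, 1); (2, 3, 9); (1, 2, 1); (4, 0, 13);
  (3, 8, 6); (2, 8, 9); (1, 5, 1); (1, 3, 1); (2, 4, 9)]%N.
have [n ltn ->] := F17_natr t.
have /allP/(_ n) : all (fun n => has (fun z => (z.1.1 * z.2 %% 17 == 1) &&
    ((3 * z.1.1 ^ 2 + z.1.2 ^ 2 + 3 * z.2 ^ 2) %% 17 == n))%N sols) (iota 0 17).
  by vm_compute.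
rewrite mem_iota => /(_ ltn)/hasP[[[a b] d] _ /andP[/eqP /= ad /eqP zn]].
exists a%:R%R, b%:R%R, 0%R, d%:R%R; split.
  by rewrite GRing.mulr0 GRing.subr0 -GRing.natrM natr_mod17 ad.
by rewrite -{}zn -natr_mod17 /zform; ring.
Qed.

(** In [s] the form is quadratic with leading coefficient [al * be]. By [key], where both
    determinants enter, completing the square leaves the constant 3 (al^2 + be^2) / (al be), which
    depends on [al / be] only. *)
Lemma zform_up a b c d a' b' c' d' : det a b c d = 1%R -> det a' b' c' d' = 1%R ->
  exists al be m : F, [/\ al != 0%R, be != 0%R & forall s,
  zform (a * a' + (a * s + b) * c') (a * b' + (a * s + b) * d')
        (c * a' + (c * s + d) * c') (c * b' + (c * s + d) * d')
  = ((al / be) * (be * s + m) ^+ 2 + 3%:R * (al / be + (al / be)^-1))%R].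
Proof.
move=> D D'.
pose al := (a ^+ 2 + 3%:R * c ^+ 2)%R; pose be := (d' ^+ 2 + 3%:R * c' ^+ 2)%R.
have nal : al != 0%R.
  apply/eqP=> /nonsquare_N3[a0 c0]; have /eqP := D.
  by rewrite a0 c0 GRing.mul0r GRing.mulr0 GRing.subrr eq_sym GRing.oner_eq0.
have nbe : be != 0%R.
  apply/eqP=> /nonsquare_N3[d0 c0]; have /eqP := D'.
  by rewrite d0 c0 !GRing.mulr0 GRing.subrr eq_sym GRing.oner_eq0.
pose m0 := (3%:R * (a * a' + b * c') * a * c' + (a * b' + b * d') * a * d'
  + 9%:R * (c * a' + d * c') * c * c' + 3%:R * (c * b' + d * d') * c * d')%R.
exists al, be, (m0 / al)%R; split=> // s.
have key : (zform (a * a' + b * c') (a * b' + b * d') (c * a' + d * c') (c * b' + d * d')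
    * (al * be) = m0 ^+ 2 + 3%:R * (al ^+ 2 + be ^+ 2))%R.
  transitivity (m0 ^+ 2 + 3%:R * (al ^+ 2 * det a' b' c' d' ^+ 2 + be ^+ 2 * det a b c d ^+ 2))%R.
    by rewrite /zform /m0 /al /be; ring.
  by rewrite D D' GRing.expr1n !GRing.mulr1.
apply: (GRing.mulIf (GRing.mulf_neq0 nal nbe)).
transitivity (zform (a * a' + b * c') (a * b' + b * d') (c * a' + d * c') (c * b' + d * d')
    * (al * be) + 2%:R * s * m0 * (al * be) + s ^+ 2 * (al * be) ^+ 2)%R.
  by rewrite /zform /m0 /al /be; ring.
rewrite key; clear key; clearbody al be m0; field.
by rewrite nbe nal.
Qed.

(** The choice of a matrix representing [X] is harmless: it is determined up to sign, and [zform] is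
    even. *)
Definition zonal (phi : F -> K) (X : coset_of Z) : K :=
  if [pick t : F * F * F * F | (det t.1.1.1 t.1.1.2 t.1.2 t.2 == 1%R)
      && (X == psl2 t.1.1.1 t.1.1.2 t.1.2 t.2)] is Some t
  then phi (zform t.1.1.1 t.1.1.2 t.1.2 t.2) else 0%R.

Lemma zonalE phi a b c d : det a b c d = 1%R -> zonal phi (psl2 a b c d) = phi (zform a b c d).
Proof.
move=> D; rewrite /zonal; case: pickP => [[[[a' b'] c'] d'] /= | none].
  case/andP=> /eqP D' /eqP/(psl2_inj D D')[] [-> -> -> ->] //.
  by congr phi; rewrite /zform; ring.
by have := none (a, b, c, d); rewrite /= D !eqxx.
Qed.

Lemma PSL_order17 x : x \in T -> #[x] = 17 -> exists2 k, k \in T & exists2 t, t != 0%R & x = up t ^ k.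
Proof.
move=> Tx ox.
have sylU : 17.-Sylow(T) <[up 1]>.
  rewrite pHallE cycle_subG up_in -orderE order_up ?GRing.oner_eq0 //= card_PSL.
  by rewrite p_part (_ : logn 17 2448 = 1%N) //; vm_compute.
have sxT : <[x]> \subset T by rewrite cycle_subG.
have px : 17.-group <[x]> by rewrite /pgroup -orderE ox.
have [g Tg] := Sylow_Jsub sylU sxT px.
rewrite -cycleJ cycle_subG => /cycleP[n]; rewrite upX => defx.
exists g^-1; rewrite ?groupV //; exists (1 *+ n)%R; last by rewrite -defx conjgK.
apply/eqP=> n0; move: ox; rewrite -(orderJ _ g) defx n0 up0 order1 //.
Qed.

Lemma big_mulrn (t : F) (f : F -> K) : t != 0%R ->
  (\sum_(i < 17) f (t *+ i) = \sum_(s : F) f s)%R.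
Proof.
move=> nt; have inj : injective (fun i : 'I_17 => t *+ i)%R.
  move=> i j eqij; apply: val_inj; rewrite /= -(modn_small (ltn_ord i)) -(modn_small (ltn_ord j)).
  have : up t ^+ i == up t ^+ j by rewrite !upX eqij.
  by rewrite eq_expg_mod_order order_up // => /eqP.
have bij : bijective (fun i : 'I_17 => t *+ i)%R.
  by apply: inj_card_bij inj _; rewrite cardF card_ord.
by rewrite [RHS](reindex _ (onW_bij _ bij)).
Qed.

(** [x] is conjugate to some [up t], so [zform_up] turns the orbit sum into a sum of [phi] over an
    affine reparametrisation of F. *)
Lemma zonal_sum0 (phi : F -> K) :
  (forall k, k != 0%R -> (\sum_(s : F) phi (k * s ^+ 2 + 3%:R * (k + k^-1)) = 0)%R) ->
  orbit_sum0 T (pred1 17) (zonal phi).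
Proof.
move=> phi0 x g Tx Tg _ /eqP ox.
have [k Tk [t nt defx]] := PSL_order17 Tx ox.
have /psl2P[a [b [c [d [D defk]]]]] : k^-1 \in T by rewrite groupV.
have /psl2P[a' [b' [c' [d' [D' defg]]]]] : k * g \in T by rewrite groupM.
have [al [be [m [nal nbe zE]]]] := zform_up D D'.
pose f s := phi ((al / be) * (be * s + m) ^+ 2 + 3%:R * (al / be + (al / be)^-1))%R.
rewrite ox (eq_bigr (fun i : 'I_17 => f (t *+ i)%R)) => [|i _]; last first.
  have -> : x ^+ i * g = psl2 a b c d * up (t *+ i) * psl2 a' b' c' d'.
    by rewrite -defk -defg defx -conjXg upX conjgE !mulgA.
  rewrite [psl2 a b c d * _]psl2M ?det_up // psl2M //; last exact: detM (det_up _).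
  rewrite zonalE; last by apply: detM D'; apply: detM (det_up _).
  rewrite /f -zE; congr phi; rewrite /zform; ring.
rewrite (big_mulrn f nt) -[RHS](phi0 (al / be)%R); last by rewrite GRing.mulf_neq0 ?GRing.invr_eq0.
rewrite [RHS](reindex (fun s => be * s + m)%R) //.
exists (fun s => (s - m) / be)%R => s _; by field.
Qed.

Lemma PSL_module : has_fpf_module T (pred1 17) K.
Proof.
have [phi [t nt] phi0] := zonal_function.
have sum0 := zonal_sum0 phi0.
have nz : exists2 g, g \in T & zonal phi g != 0%R.
  have [a [b [c [d [D zt]]]]] := zform_surj t.
  by exists (psl2 a b c d); rewrite ?psl2_in // zonalE // zt.
split=> [|p pT np]; first by exists (zonal phi).
have : p \in psl_primes by rewrite psl_primesP -card_PSL; move: pT; rewrite mem_primes => /and3P[-> _].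
rewrite !inE => /or3P[]/eqP p_eq; rewrite {p pT}p_eq // in np *.
  have D4 : (4%:R * - 4%:R = 1 :> F)%R by apply/esym/(eq_of_sub F17); ring.
  have Dj : det 4%:R 0 0 (- 4%:R) = 1%R :> F by rewrite D4; ring.
  have jup s : up s * psl2 4%:R 0 0 (- 4%:R) = psl2 4%:R 0 0 (- 4%:R) * up (- s).
    by rewrite !psl2M ?det_up //; apply: eq_psl2; ring.
  have Tj := psl2_in Dj; have oj := PSL_order2 D4; set j := psl2 _ _ _ _ in jup Tj oj.
  have jj : j * j = 1 by rewrite -(expg_order j) oj expgS expg1.
  (* j inverts the group [up]. So if f (h j g) = - f (h g) for all h and g, then f
     is invariant under [up], on whose cosets its sum vanishes: f = 0. *)
  have [/exists_inP[h Th /exists_inP[g Tg fg]] | fN] :=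
      boolP [exists h in T, [exists g in T, zonal phi (h * g) + zonal phi (h * j * g) != 0]]%R.
    exists j, (fun g => zonal phi (h * g)%g + zonal phi (h * j * g)%g)%R; split=> //.
    - move=> x k Tx Tk pr_x Sx; rewrite big_split /=.
      by rewrite !(orbit_sum0_transl _ sum0) ?groupM // GRing.addr0.
    - move=> k Tk; have -> : h * j * (j * k) = h * k by rewrite mulgA -(mulgA h j j) jj mulg1.
      by rewrite (mulgA h j k) GRing.addrC.
    by exists g.
  have fj h g : h \in T -> g \in T -> zonal phi (h * j * g) = (- zonal phi (h * g)%g)%R.
    move=> Th Tg; apply/eqP; rewrite -GRing.addr_eq0 GRing.addrC; move: fN.
    by rewrite negb_exists_in => /forall_inP/(_ h Th); rewrite negb_exists_in => /forall_inP/(_ g Tg); rewrite negbK.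
  have fup g s : g \in T -> zonal phi (up s * g) = zonal phi (up (- s) * g).
    move=> Tg; have := fj 1 (up (- s) * g) (group1 _) (groupM (up_in _) Tg).
    by rewrite !mul1g mulgA -jup (fj _ _ (up_in s) Tg) => /GRing.oppr_inj.
  (* 9 is one half in F: [fup] at 9 compares [up 1 * g] with [g]. *)
  have fup1 g : g \in T -> zonal phi (up 1 * g) = zonal phi g.
    move=> Tg; have := fup (up 9%:R * g) 9%:R%R (groupM (up_in _) Tg).
    rewrite !mulgA !upD GRing.addNr up0 mul1g => <-; congr (zonal phi (up _ * g)).
    by apply/esym/(eq_of_sub F17); ring.
  have [g Tg /eqP[]] := nz.
  have := sum0 (up 1) g (up_in _) Tg; rewrite order_up ?GRing.oner_neq0 // => /(_ isT isT).
  rewrite (eq_bigr (fun=> zonal phi g)) => [|i _]; last first.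
    elim: (val i) => [|n IH]; first by rewrite mul1g.
    by rewrite expgS -mulgA fup1 ?groupM ?groupX ?up_in.
  rewrite GRing.sumr_const card_ord -GRing.mulr_natr => /eqP.
  by rewrite GRing.mulf_eq0 (negPf K17) orbF => /eqP.
have h2 : (2%:R * 9%:R = 1 :> F)%R by apply: (eq_of_sub F17); ring.
(* With 9 = 1/2 this is the matrix (-1/2, -3/2; 1/2, -1/2), an isometry of x^2 + 3 y^2 of trace -1,
   hence of order 3; left multiplication by it preserves [zform]. *)
have D : det (- 9%:R) (- 27%:R) 9%:R (- 9%:R) = 1%R :> F.
  by apply: (eq_of_sub (congr1 (fun z => 19%:R * z)%R F17)); ring.
exists (psl2 (- 9%:R) (- 27%:R) 9%:R (- 9%:R)), (zonal phi); split=> //.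
- exact: psl2_in.
- by apply: order_tr1 => //; apply: esym; apply: (eq_of_sub F17); ring.
move=> _ /psl2P[a [b [c [d [Dg ->]]]]].
rewrite psl2M // (zonalE phi (detM D Dg)) (zonalE phi Dg); congr phi.
by apply: (eq_of_sub (congr1 (fun z => 19%:R * zform a b c d * z)%R F17)); rewrite /zform; ring.
Qed.

End Module.

End PSL17.

Lemma SL17P x : (x \in SL 2 17) = (\det (GLval x) == 1)%R.
Proof. exact: in_set. Qed.

Lemma card_F17 : #|{: 'F_17}| = 17.
Proof. exact: card_Fp. Qed.

Lemma PSL17_like : psl_like (PSL 2 17).
Proof. exact: (PSL_like SL17P card_F17). Qed.

Lemma nadj_PSL17 p q : p \in psl_primes -> q \in psl_primes -> p != q ->
  nadj (PSL 2 17) p q.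
Proof.
have n23 := nadj_PSL_2_3 SL17P card_F17.
have n17 := nadj_PSL_17 SL17P card_F17.
rewrite !inE => /or3P[]/eqP-> /or3P[]/eqP-> // _.
- by rewrite nadjC; apply: n17.
- by rewrite nadjC; apply: n17.
- exact: n17.
- exact: n17.
Qed.

Lemma PSL17_module (K : fieldType) : (17%:R != 0 :> K)%R ->
  has_fpf_module (PSL 2 17) (pred1 17) K.
Proof. exact: (PSL_module SL17P card_F17). Qed.

(** * Bipartite prime graphs *)

Lemma metacyclic_exists n Q w : 0 < n -> 0 < Q -> w ^ n = 1 %[mod Q] ->
  exists (gT : finGroupType) (z y : gT),
    [/\ #[z] = Q, #[y] = n, z ^ y = z ^+ w & <[z]> ><| <[y]> = [set: gT]].
Proof.
case: n Q => [|n] // [|Q] // _ _ wn.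
pose phi (x : 'I_Q.+1) (a : 'I_n.+1) : 'I_Q.+1 := x ^+ (w ^ a).
have abQ (x y : 'I_Q.+1) : commute x y by rewrite /commute !FinRing.zmodMgE GRing.addrC.
have expQ (x : 'I_Q.+1) m : x ^+ (w ^ (m %% n.+1)) = x ^+ (w ^ m).
  have dx : #[x] %| Q.+1.
    by rewrite -[Q.+1]card_ord -cardsT order_dvdG ?inE.
  apply/eqP; rewrite eq_expg_mod_order -(modn_dvdm _ dx) -[X in _ == X](modn_dvdm _ dx).
  apply/eqP; congr (_ %% _); rewrite [in RHS](divn_eq m n.+1) expnD (mulnC (m %/ _)) expnM.
  by apply/esym; rewrite -modnMml -modnXm wn modnXm exp1n modnMml mul1n.
have phi1 : phi^~ 1 =1 id by move=> x; rewrite /phi /= expg1.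
have phiM x a b : phi x (a * b) = phi (phi x a) b.
  by rewrite /phi /= expQ expnD expgM.
have phiD x y a : phi (x * y) a = phi x a * phi y a by apply: expgMn.
have [gT [f [g [injf injg defT fJ]]]] := sdprod_exists phi1 phiM phiD.
exists gT, (f Zp1), (g Zp1); split.
- by rewrite order_injm ?inE ?order_Zp1.
- by rewrite order_injm ?inE ?order_Zp1.
- by rewrite -fJ /phi /= expQ expn1 morphX ?inE.
by rewrite -!morphim_cycle ?inE // -!Zp_cycle.
Qed.

Lemma mem_normal_index (gT : finGroupType) (G L : {group gT}) (x : gT) s :
  L <| G -> prime s -> ~~ (s %| #|G : L|) -> x \in G -> #[x] = s -> x \in L.
Proof.
move=> nsLG pr_s ndvd Gx ox; have nLG := normal_norm nsLG.
apply: coset_idr; first exact: (subsetP nLG).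
apply/eqP; rewrite -order_eq1; apply: contraR ndvd => nt.
have : #[coset L x] %| s by rewrite -ox morph_order // (subsetP nLG).
case/primeP: (pr_s) => _ dv /dv; rewrite (negPf nt) /= => /eqP <-.
by rewrite -card_quotient // order_dvdG ?mem_quotient.
Qed.

Lemma order_expg_div (gT : finGroupType) (x : gT) m :
  m %| #[x] -> #[x ^+ (#[x] %/ m)] = m.
Proof.
move=> dm; rewrite orderXdiv ?dvdn_div //; case/dvdnP: dm (order_gt0 x) => k ->.
by rewrite muln_gt0 => /andP[k_gt0 m_gt0]; rewrite mulnK // mulKn.
Qed.

Section Metacyclic.

Variables (gT : finGroupType) (H : {group gT}) (z y : gT) (w : nat).
Hypotheses (defH : <[z]> ><| <[y]> = H) (zy : z ^ y = z ^+ w).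
Let Q := #[z].
Let n := #[y].
Hypothesis coQn : coprime Q n.
Hypothesis sqfreeQ : forall q, prime q -> q %| Q -> ~~ (q %| Q %/ q).
Hypothesis sqfreen : forall p, prime p -> p %| n -> ~~ (p %| n %/ p).

Lemma conj_metacyclic i k : (z ^+ i) ^ (y ^+ k) = z ^+ (i * w ^ k).
Proof.
elim: k => [|k IH]; first by rewrite conjg1 muln1.
by rewrite expgSr conjgM IH conjXg zy -expgM mulnCA -expnS.
Qed.

(** In the cyclic groups [<[z]>] and [<[y]>] the subgroups of orders [q] and [p] are unique, so only
    the commutation of [z ^+ (Q %/ q)] with [y ^+ (n %/ p)] matters. *)
Lemma nadj_metacyclic q p : prime q -> prime p -> q %| Q -> p %| n ->
  nadj H q p = (w ^ (n %/ p) != 1 %[mod q]).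
Proof.
move=> pr_q pr_p qQ pn.
have [oz oy] : #[z ^+ (Q %/ q)] = q /\ #[y ^+ (n %/ p)] = p by rewrite !order_expg_div.
have com : commute (z ^+ (Q %/ q)) (y ^+ (n %/ p)) <-> w ^ (n %/ p) = 1 %[mod q].
  have Qq_gt0 : 0 < Q %/ q by rewrite divn_gt0 ?prime_gt0 // dvdn_leq ?order_gt0.
  have aux m W : 0 < m -> W = 1 %[mod q] <-> m * W = m * 1 %[mod m * q].
    move=> m_gt0; rewrite -!muln_modr; split=> [-> // | /eqP].
    by rewrite eqn_pmul2l // => /eqP.
  have := aux _ (w ^ (n %/ p))%N Qq_gt0; rewrite muln1 divnK // => ->.
  rewrite /commute; split=> [/commgP/conjg_fixP | eqQ].
    by rewrite conj_metacyclic => /eqP; rewrite eq_expg_mod_order => /eqP.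
  apply/commgP/conjg_fixP; rewrite conj_metacyclic.
  by apply/eqP; rewrite eq_expg_mod_order eqQ.
have qz : q \in \pi(<[z]>) by rewrite mem_primes pr_q cardG_gt0.
have py : p \in \pi(<[y]>) by rewrite mem_primes pr_p cardG_gt0.
have kerP := nadj_sdprod_kernel defH coQn (cycle_abelian z) pr_q pr_p qz py.
apply/idP/idP => [nH | neq].
  apply/eqP=> eq1; by apply: (kerP.1 nH) oz oy _; rewrite ?mem_cycle //; apply/com.
apply/kerP=> a b za yb oa ob cab; apply: (negP neq); apply/eqP/com.
have /cycleP[i ->] : z ^+ (Q %/ q) \in <[a]>.
  apply: (cyclic_order_prime_sub (cycle_cyclic z)) (mem_cycle _ _) oz.
  - by rewrite cycle_subG.
  - by rewrite /pgroup -orderE oa pnat_id.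
  by rewrite cycle_eq1 (order_prime_neq1 pr_q).
have /cycleP[j ->] : y ^+ (n %/ p) \in <[b]>.
  apply: (cyclic_order_prime_sub (cycle_cyclic y)) (mem_cycle _ _) oy.
  - by rewrite cycle_subG.
  - by rewrite /pgroup -orderE ob pnat_id.
  by rewrite cycle_eq1 (order_prime_neq1 pr_p).
exact: commuteX2.
Qed.

Lemma sdprod_subr (A B : {group gT}) : A \subset <[z]> -> B \subset <[y]> ->
  A \char <[z]> -> A <*> B = A * B /\ #|A <*> B| = (#|A| * #|B|)%N.
Proof.
have [_ _ nzy tizy] := sdprodP defH => sAz sBy chA.
have nAB : B \subset 'N(A).
  by apply: subset_trans sBy _; apply: char_norm_trans chA _.
rewrite norm_joinEr //; split=> //; rewrite TI_cardMg //.
by apply/trivgP; rewrite -tizy setISS.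
Qed.

(** For a prime [r] dividing [Q * n] this is a Hall [r']-subgroup, because [Q] and [n] are
    squarefree and coprime. *)
Definition index_subgroup r : {group gT} :=
  if r %| Q then (<[z ^+ r]> <*> <[y]>)%G else (<[z]> <*> <[y ^+ r]>)%G.

Lemma metacyclic_module (rs : seq nat) (K : fieldType) :
  uniq rs -> all prime rs -> {in rs, forall r, r %| Q * n} ->
  (forall q p, q \in rs -> p \in rs -> q %| Q -> p %| n -> w ^ (n %/ p) = 1 %[mod q]) ->
  has_fpf_module H (mem rs) K.
Proof.
move=> uniq_rs pr_rs rs_dvd nadj_rs.
have [nsZH sYH defZY nzy tizy] := sdprod_context defH; have sZH := normal_sub nsZH.
have Zz : z \in <[z]> := cycle_id z; have Yy : y \in <[y]> := cycle_id y.
have [Hz Hy] : z \in H /\ y \in H by rewrite -!cycle_subG.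
have oH : #|H| = (Q * n)%N by rewrite -(sdprod_card defH).
have n_dvd r : r \in rs -> ~~ (r %| Q) -> r %| n.
  move=> rs_r; have := rs_dvd r rs_r.
  by rewrite Euclid_dvdM ?(allP pr_rs) // => /orP[-> |].
have idxP r : r \in rs -> [/\ index_subgroup r \subset H,
    #|H : index_subgroup r| = r & ~~ (r %| #|index_subgroup r|)].
  move=> rs_r; have pr_r := allP pr_rs r rs_r; have := rs_dvd r rs_r.
  rewrite Euclid_dvdM // => dr; have r_gt0 := prime_gt0 pr_r.
  have [sM oM ndvd] : [/\ index_subgroup r \subset H,
      (#|index_subgroup r| * r = Q * n)%N & ~~ (r %| #|index_subgroup r|)].
    rewrite /index_subgroup; case: ifPn dr => [rQ _ | nrQ /= rn].
      have [_ ->] := sdprod_subr (cycleX z r) (subxx _) (cycle_subgroup_char (cycleX z r)).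
      rewrite join_subG sYH cycle_subG groupX // -!orderE orderXdiv //.
      rewrite mulnAC divnK // Euclid_dvdM // negb_or sqfreeQ //; split=> //.
      by rewrite -prime_coprime // (coprime_dvdl rQ).
    have [_ ->] := sdprod_subr (subxx _) (cycleX y r) (char_refl <[z]>%G).
    rewrite join_subG sZH cycle_subG groupX // -!orderE orderXdiv //.
    by rewrite -mulnA divnK // Euclid_dvdM // negb_or (negPf nrQ) sqfreen.
  split=> //; apply/eqP; rewrite -(eqn_pmul2l (cardG_gt0 (index_subgroup r))).
  by rewrite Lagrange // oM oH.
have normH (L : {group gT}) : L \subset H -> z \in 'N(L) -> y \in 'N(L) -> L <| H.
  move=> sLH nLz nLy; rewrite /normal sLH -(sdprodWY defH) join_subG !cycle_subG.
  by rewrite nLz.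
have zzX i : (z ^+ i) ^ z = z ^+ i by rewrite conjXg conjgE mulKg.
have nyX i : y \in 'N(<[y ^+ i]>).
  by rewrite -cycle_subG sub_abelian_norm ?cycle_abelian ?cycleX.
have nyZ i : y \in 'N(<[z ^+ i]>).
  rewrite -cycle_subG; apply: char_norm_trans nzy; exact: cycle_subgroup_char (cycleX z i).
apply: (index_family_module (M := index_subgroup)) => //.
- move=> x r Hx rs_x rs_r neq; have [s ox] : exists s, #[x] = s by exists #[x].
  rewrite ox in rs_x neq; have pr_s := allP pr_rs s rs_x; have pr_r := allP pr_rs r rs_r.
  have coprime_sr : coprime s r by rewrite prime_coprime // dvdn_prime2 // eq_sym.
  have iZ : #|H : <[z]>| = n by rewrite -divgS // oH mulKn ?order_gt0.
  rewrite /index_subgroup; have [sQ | nsQ] := boolP (s %| Q).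
    have Zx : x \in <[z]>.
      apply: (mem_normal_index nsZH pr_s _ Hx ox).
      by rewrite iZ -prime_coprime // (coprime_dvdl sQ).
    case: ifPn => [rQ | nrQ]; last exact: (subsetP (joing_subl _ _)).
    apply: (subsetP (joing_subl _ _)); case/cycleP: Zx ox => i -> ox.
    have : (z ^+ i) ^+ s = 1 by rewrite -ox expg_order.
    move/eqP; rewrite -expgM -order_dvdn => /(dvdn_trans rQ).
    by rewrite mulnC Gauss_dvdr 1?coprime_sym // => /dvdnP[j ->]; rewrite mulnC expgM mem_cycle.
  have sn := n_dvd s rs_x nsQ; case: ifPn => [rQ | nrQ].
    (* By [nadj_rs], [y ^+ (n %/ s)] centralises [<[z]>] modulo [<[z ^+ r]>], so [L] is normal. Its
       index [r * (n %/ s)] is prime to [s], hence [x] lies in it. *)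
    pose L := (<[z ^+ r]> <*> <[y ^+ (n %/ s)]>)%G.
    have nsLH : L <| H.
      apply: normH; first by rewrite join_subG !cycle_subG !groupX.
        rewrite inE /= -genJ conjUg -!cycleJ gen_subG subUset !cycle_subG.
        rewrite zzX mem_gen ?inE ?cycle_id //=.
        have eq1 := nadj_rs r s rs_r rs_x rQ sn; set k := n %/ s in eq1 *.
        have -> : (y ^+ k) ^ z = y ^+ k * ((z ^+ (w ^ k))^-1 * z).
          by have := conj_metacyclic 1 k; rewrite mul1n expg1 => <-; rewrite !conjgE !invMg !invgK !mulgA mulgV mul1g.
        apply: groupM; first by rewrite mem_gen // inE cycle_id orbT.
        apply: (subsetP (joing_subl _ _)).
        rewrite (divn_eq (w ^ k) r) eq1 modn_small ?prime_gt1 // expgD expg1 invMg.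
        rewrite -mulgA -conjgE conjVg zzX groupV.
        by rewrite mulnC expgM mem_cycle.
      rewrite -cycle_subG normsY // cycle_subG; [exact: nyZ | exact: nyX].
    apply: (subsetP (_ : L \subset _)).
      by rewrite genS // setUS // cycleX.
    apply: (mem_normal_index nsLH pr_s _ Hx ox).
    have [_ oL] := sdprod_subr (cycleX z r) (cycleX y (n %/ s)) (cycle_subgroup_char (cycleX z r)).
    rewrite -!orderE order_expg_div // orderXdiv // in oL.
    have -> : #|H : L| = (r * (n %/ s))%N.
      apply/eqP; rewrite -(eqn_pmul2l (cardG_gt0 L)) Lagrange ?(normal_sub nsLH) //.
      by rewrite oH oL mulnACA divnK // (mulnC s) divnK.
    by rewrite Euclid_dvdM // negb_or sqfreen // -prime_coprime // coprime_sr.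
  have rn := n_dvd r rs_r nrQ.
  have [sMH iMH _] := idxP r rs_r; rewrite /index_subgroup (negPf nrQ) in sMH iMH.
  apply: (mem_normal_index _ pr_s _ Hx ox).
    apply: normH => //; first by rewrite (subsetP (normG _)) // (subsetP (joing_subl _ _)).
    by rewrite -cycle_subG normsY // cycle_subG; apply: nyX.
  by rewrite iMH -prime_coprime.
(* Each [index_subgroup r] contains [y] or [z]; if it contained [z * y], it would be all of [H]. *)
- exists (z * y) => [|r rs_r]; first exact: groupM.
  have [sMH iMH _] := idxP r rs_r; apply: contraTN (allP pr_rs r rs_r) => Mzy.
  suffices sHM : H \subset index_subgroup r by rewrite -iMH -indexgI (setIidPl sHM) indexgg.
  rewrite -(sdprodWY defH) join_subG !cycle_subG.
  move: Mzy; rewrite /index_subgroup; case: ifP => _ Mzy.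
    have My : y \in <[z ^+ r]> <*> <[y]> by rewrite mem_gen // inE cycle_id orbT.
    by move: Mzy; rewrite groupMr // My => ->.
  have Mz : z \in <[z]> <*> <[y ^+ r]> by rewrite mem_gen // inE cycle_id.
  by move: Mzy; rewrite groupMl // Mz => ->.
move=> p pH nrs; have [pr_p pd] : prime p /\ p %| Q * n.
  by move: pH; rewrite mem_primes -oH => /and3P[].
have co_pr r m : r \in rs -> r %| m -> p %| m -> r %| m %/ p.
  move=> rs_r rm pm; have pr_r := allP pr_rs r rs_r.
  rewrite -(Gauss_dvdl _ (_ : coprime r p)) ?divnK //.
  rewrite prime_coprime // dvdn_prime2 //.
  by apply: contraNneq nrs => <-.
have [pQ | npQ] := boolP (p %| Q).
  exists (z ^+ (Q %/ p)); rewrite ?groupX // order_expg_div //; split=> // r rs_r.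
  rewrite /index_subgroup; case: ifPn => rQ; apply: (subsetP (joing_subl _ _)).
    have /dvdnP[j ->] := co_pr r Q rs_r rQ pQ.
    by rewrite mulnC expgM mem_cycle.
  exact: mem_cycle.
have pn : p %| n by move: pd; rewrite Euclid_dvdM // (negPf npQ).
exists (y ^+ (n %/ p)); rewrite ?groupX // order_expg_div //; split=> // r rs_r.
rewrite /index_subgroup; case: ifPn => nrQ; apply: (subsetP (joing_subr _ _)).
  exact: mem_cycle.
have /dvdnP[j ->] := co_pr r n rs_r (n_dvd r rs_r nrQ) pn.
by rewrite mulnC expgM mem_cycle.
Qed.

End Metacyclic.

(** * Primes modulo which some number has a given order *)

Section PrimesOfOrder.

Local Open Scope ring_scope.

(** A nonconstant polynomial takes the values 0, 1, -1 only at the roots of [B], which has fewer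
    than [size B] of them, the number of multiples of [L] that are tried. *)
Lemma Cyclotomic_large_value n L : (0 < n)%N -> (0 < L)%N ->
  exists2 i, (0 < i)%N & (1 < `|('Phi_n).[(L * i)%N%:R]|)%N.
Proof.
move=> n_gt0 L_gt0; set P := 'Phi_n.
have sP : (1 < size P)%N by rewrite size_Cyclotomic ltnS totient_gt0.
have nzc (c : int) : P - c%:P != 0.
  apply: contraTneq sP => /eqP; rewrite GRing.subr_eq0 => /eqP->.
  by rewrite -leqNgt size_polyC_leq1.
pose B := (P - 0%:P) * (P - 1%:P) * (P - (-1)%:P).
have nzB : B != 0 by rewrite !GRing.mulf_neq0.
pose rs := [seq ((L * i.+1)%N%:R : int) | i <- iota 0 (size B)].
have uniq_rs : uniq rs.
  rewrite map_inj_uniq ?iota_uniq // => i j /eqP; rewrite !natz eqz_nat eqn_pmul2l //.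
  by move/eqP=> [].
have : ~~ all (root B) rs.
  apply/negP=> roots_rs; have := max_poly_roots nzB roots_rs uniq_rs.
  by rewrite size_map size_iota ltnn.
case/allPn=> _ /mapP[i _ ->] nroot; exists i.+1 => //.
move: nroot; rewrite /root !hornerE; set v := P.[_].
rewrite !GRing.mulf_eq0 !negb_or => /andP[/andP[v0 v1] vN1].
by case: v v0 v1 vN1 => [[|[|m]]|[|m]].
Qed.

(** At a common root of [A] and [B] the derivative n x^(n-1) of ['X^n - 1] vanishes. *)
Lemma double_root_unity (F : fieldType) n (A B : {poly F}) (x : F) :
  A * B = 'X^n - 1 -> A.[x] = 0 -> B.[x] = 0 -> x != 0 -> n%:R = 0 :> F.
Proof.
move=> AB A0 B0 nx; have := congr1 (fun p => (deriv p).[x]) AB.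
rewrite derivM derivB derivXn derivC GRing.subr0 !hornerE A0 B0.
rewrite GRing.mul0r GRing.mulr0 GRing.addr0 => /esym/eqP.
by rewrite hornerMn hornerXn -GRing.mulr_natr GRing.mulf_eq0 GRing.expf_eq0 (negPf nx) andbF => /eqP.
Qed.

(* q divides the n-th cyclotomic polynomial at a multiple M of n N!. *)
Lemma prime_order_exists n N : (0 < n)%N ->
  exists q M, [/\ prime q, (N < q)%N & forall k, (M ^ k == 1 %[mod q])%N = (n %| k)%N].
Proof.
move=> n_gt0; have L_gt0 : (0 < n * N`!)%N by rewrite muln_gt0 n_gt0 fact_gt0.
have [i i_gt0 big_v] := Cyclotomic_large_value n_gt0 L_gt0.
set M := (n * N`! * i)%N in big_v; set v := ('Phi_n).[_] in big_v.
pose q := pdiv `|v|%N; have pr_q : prime q := pdiv_prime big_v.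
have qv : (q %| `|v|)%N := pdiv_dvd _.
pose x : 'F_q := M%:R.
pose Pq d := map_poly (intr : int -> 'F_q) 'Phi_d.
have prodPq m : (0 < m)%N -> \prod_(d <- divisors m) Pq d = 'X^m - 1.
  move=> m_gt0; rewrite -GRing.rmorph_prod prod_Cyclotomic //.
  by rewrite GRing.rmorphB GRing.rmorph1 /= map_polyXn.
have root_n : (Pq n).[x] = 0.
  rewrite /x -(GRing.rmorph_nat (intr : {rmorphism int -> 'F_q})) horner_map /= -/v.
  rewrite (intEsign v) GRing.rmorphM /=.
  suffices -> : (`|v|%N%:~R : 'F_q) = 0 by rewrite GRing.mulr0.
  by apply/eqP; rewrite -(GRing.dvdn_pcharf (pchar_Fp pr_q)).
have xm_prod m : (0 < m)%N -> x ^+ m - 1 = \prod_(d <- divisors m) (Pq d).[x].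
  by move=> m_gt0; rewrite -horner_prod prodPq // !hornerE.
have xn1 : x ^+ n = 1.
  apply/eqP; rewrite -GRing.subr_eq0 xm_prod //.
  by rewrite (big_rem n) ?divisors_id //= root_n GRing.mul0r.
have nx : x != 0.
  by apply: contra_eq_neq xn1 => ->; rewrite GRing.expr0n eqn0Ngt n_gt0 eq_sym GRing.oner_neq0.
(* As n and N! divide [M], this yields both that [q] does not divide [n] and that [N < q]. *)
have q'M : ~~ (q %| M)%N by rewrite (GRing.dvdn_pcharf (pchar_Fp pr_q)).
have q'n : ~~ (q %| n)%N by apply: contra q'M => qn; rewrite /M -mulnA dvdn_mulr.
have Nq : (N < q)%N.
  rewrite ltnNge; apply: contra q'M => leqN.
  by rewrite /M dvdn_mulr // dvdn_mull // dvdn_fact // prime_gt0.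
exists q, M; split=> // k.
have -> : (M ^ k == 1 %[mod q])%N = (x ^+ k == 1).
  have valE m : val (m%:R : 'F_q) = (m %% q)%N := val_Fp_nat pr_q m.
  by rewrite /x -GRing.natrX -[X in _ = (_ == X)](GRing.mulr1n 1) -val_eqE !valE.
apply/eqP/idP => [xk1 | /dvdnP[j ->]]; last by rewrite mulnC GRing.exprM xn1 GRing.expr1n.
have [-> // | k_gt0] := posnP k.
have [km kn defg _] := egcdnP n k_gt0; set g := gcdn k n in defg.
have xg1 : x ^+ g = 1.
  have := congr1 (fun m => x ^+ m) defg; rewrite GRing.exprD mulnC GRing.exprM xk1.
  by rewrite GRing.expr1n mulnC GRing.exprM xn1 GRing.expr1n GRing.mul1r.
have g_gt0 : (0 < g)%N by rewrite gcdn_gt0 k_gt0.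
have gn : (g %| n)%N := dvdn_gcdr k n.
have [<- | neq] := eqVneq g n; first exact: dvdn_gcdl.
(* If [x ^+ g = 1] for the proper divisor [g] of [n], then [x] is a root of a cyclotomic polynomial
   of index dividing [g] besides that of index [n]. It is then a double root of ['X^n - 1], and [q]
   divides [n]. *)
case/negP: q'n; rewrite (GRing.dvdn_pcharf (pchar_Fp pr_q)).
have : \prod_(d <- divisors g) (Pq d).[x] == 0 by rewrite -xm_prod // xg1 GRing.subrr.
rewrite GRing.prodf_seq_eq0 => /hasP[d /=]; rewrite -dvdn_divisors // => dg /eqP d0.
apply/eqP; apply: (double_root_unity (A := Pq n)
  (B := \prod_(d <- rem n (divisors n)) Pq d) _ root_n _ nx).
  by rewrite -prodPq // [RHS](big_rem n) //= divisors_id.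
rewrite horner_prod; apply/eqP; rewrite GRing.prodf_seq_eq0; apply/hasP; exists d.
  rewrite mem_rem_uniq ?divisors_uniq // !inE -dvdn_divisors // (dvdn_trans dg gn) andbT.
  by apply: contra_neq neq => dn; apply/eqP; rewrite eqn_dvd gn -dn.
by rewrite d0.
Qed.

End PrimesOfOrder.

(** The values are chosen one by one, each above the sum of those already chosen. *)
Lemma injective_choice (T : finType) (P : T -> nat -> Prop) N :
  (forall x m, exists2 q, m < q & P x q) ->
  exists2 v : T -> nat, injective v & forall x, N < v x /\ P x (v x).
Proof.
move=> exP; suff [v injv vP] : exists2 v : T -> nat, {in enum T &, injective v} &
    {in enum T, forall x, N < v x /\ P x (v x)}.
  exists v => [x y | x]; last by apply: vP; rewrite mem_enum.
  by apply: injv; rewrite mem_enum.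
elim: (enum T) => [|x s [v injv vP]]; first by exists (fun=> 0).
have [sx | nsx] := boolP (x \in s).
  have eqs y : (y \in x :: s) = (y \in s).
    by rewrite inE; case: eqP => [->|].
  exists v => [y z | y]; rewrite !eqs; [exact: injv | exact: vP].
have [q ltq Pq] := exP x (N + \sum_(y <- s) v y).
have vq y : y \in s -> v y < q.
  move=> sy; apply: leq_ltn_trans ltq; rewrite (big_rem y) //=.
  by rewrite addnCA leq_addr.
exists (fun y => if y == x then q else v y) => [y z | y].
  rewrite !inE; case: eqP => [-> | _] /=; case: eqP => [-> | _] //= sy sz.
  - by move=> eqv; have := vq z sz; rewrite -eqv ltnn.
  - by move=> eqv; have := vq y sy; rewrite eqv ltnn.
  exact: injv.
rewrite inE; case: eqP => [-> _ | _ /= /vP //].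
by split=> //; apply: leq_ltn_trans ltq; apply: leq_addr.
Qed.

Lemma coprime_prodr_seq (T : eqType) (s : seq T) (q : T -> nat) m :
  {in s, forall x, coprime m (q x)} -> coprime m (\prod_(x <- s) q x).
Proof.
move=> co; rewrite big_seq; elim/big_ind: _ => [|u v cu cv|x sx]; first exact: coprimen1.
  by rewrite coprimeMr cu.
exact: co.
Qed.

Lemma eqn_mod_prod (T : eqType) (s : seq T) (q : T -> nat) a b :
  {in s &, forall x y, x != y -> coprime (q x) (q y)} -> uniq s ->
  {in s, forall x, a = b %[mod q x]} -> a = b %[mod \prod_(x <- s) q x].
Proof.
elim: s => [|x s IH] co; first by rewrite big_nil !modn1.
case/andP=> nsx uniq_s ab; rewrite big_cons; apply/eqP; rewrite chinese_remainder.
  apply/andP; split; apply/eqP; first by apply: ab; rewrite mem_head.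
  apply: IH => // [y z sy sz|y sy]; [apply: co|apply: ab];
    by rewrite inE ?sy ?sz orbT.
apply: coprime_prodr_seq => y sy; apply: co; rewrite ?mem_head ?inE ?sy ?orbT //.
by apply: contraNneq nsx => ->.
Qed.

Lemma chinese_seq (T : eqType) (s : seq T) (q M : T -> nat) :
  {in s &, forall x y, x != y -> coprime (q x) (q y)} -> uniq s ->
  exists w, {in s, forall x, w = M x %[mod q x]}.
Proof.
elim: s => [|x s IH] co; first by exists 0.
case/andP=> nsx uniq_s; have [|w wM] := IH _ uniq_s.
  by move=> y z sy sz; apply: co; rewrite inE ?sy ?sz orbT.
have cox : coprime (q x) (\prod_(y <- s) q y).
  apply: coprime_prodr_seq => y sy; apply: co; rewrite ?mem_head ?inE ?sy ?orbT //.
  by apply: contraNneq nsx => ->.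
exists (chinese (q x) (\prod_(y <- s) q y) (M x) w) => y.
case/predU1P=> [-> | sy]; first exact: chinese_modl.
have dy : q y %| \prod_(y <- s) q y by rewrite (big_rem y) //= dvdn_mulr.
rewrite -(wM y sy) -(modn_dvdm _ dy) chinese_modr //.
by rewrite modn_dvdm.
Qed.

Lemma dvdn_prod_sub (T : finType) (P R : pred T) (f : T -> nat) :
  subpred P R -> \prod_(x | P x) f x %| \prod_(x | R x) f x.
Proof.
move=> sPR; rewrite [X in _ %| X](bigID P) /= dvdn_mulr //.
rewrite (eq_bigl P) // => x; rewrite andbC.
by case Px: (P x); rewrite ?(sPR x Px).
Qed.

Lemma nadj_cyclic (gT : finGroupType) (G : {group gT}) (y : gT) p q :
  prime p -> prime q -> p != q -> y \in G -> p %| #[y] -> q %| #[y] -> ~~ nadj G p q.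
Proof.
move=> pr_p pr_q neq Gy py qy; apply/nadjPn; exists (y ^+ (#[y] %/ (p * q))).
  exact: groupX.
by rewrite order_expg_div // Gauss_dvd ?py // prime_coprime // dvdn_prime2.
Qed.

Section BaseGroup.

Variables (T : finType) (A B : pred T) (c : rel T).
Hypothesis disjAB : forall x, A x -> ~~ B x.

(** The primes for [A] come first, since the order prescribed modulo [v b] is a product of them; the
    primes for [B] exceed their sum, which keeps the two families apart. *)
Lemma base_primes N : exists v M : T -> nat,
  [/\ injective v, forall x, N < v x, forall x, prime (v x) &
      forall b k, B b -> (M b ^ k == 1 %[mod v b]) = ((\prod_(a | A a && c a b) v a)%N %| k)].
Proof.
have [|vA injA vAP] := @injective_choice T (fun=> prime) N.
  by move=> _ m; have [q ltq pr_q] := prime_above m; exists q.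
pose nb b := (\prod_(a | A a && c a b) vA a)%N.
pose P b q := prime q /\ exists M, forall k, (M ^ k == 1 %[mod q]) = (nb b %| k).
have [|vB injB vBP] := @injective_choice T P (N + \sum_(a : T) vA a).
  move=> b m; have nb_gt0 : 0 < nb b.
    by rewrite prodn_cond_gt0 // => a _; rewrite prime_gt0; case: (vAP a).
  have [q [M [pr_q ltq ord]]] := prime_order_exists m nb_gt0.
  by exists q => //; split=> //; exists M.
have vAB a b : vA a < vB b.
  have [ltb _] := vBP b; apply: leq_ltn_trans ltb.
  by rewrite (bigD1 a) //= addnCA leq_addr.
have [M MP] := fin_all_exists (fun b => proj2 (proj2 (vBP b))).
exists (fun x => if A x then vA x else vB x), M; split.
- move=> x y; case: ifP => _; case: ifP => _ eqv; [exact: injA| | |exact: injB].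
    by have := vAB x y; rewrite eqv ltnn.
  by have := vAB y x; rewrite eqv ltnn.
- move=> x; case: ifP => _; first by case: (vAP x).
  by have [ltb _] := vBP x; apply: leq_ltn_trans ltb; apply: leq_addr.
- by move=> x; case: ifP => _; [case: (vAP x) | case: (vBP x) => _ []].
move=> b k Bb; have nAb : A b = false by apply/negP=> /disjAB; rewrite Bb.
rewrite nAb MP /nb; congr (_ %| _).
by apply: eq_bigr => a /andP[->].
Qed.

(* H is the split extension of a cyclic group of order \prod_(b | B b) v b by a
   cyclic group of order \prod_(a | A a) v a. *)
Lemma base_group N : exists (gT : finGroupType) (H : {group gT}) (v : T -> nat),
  [/\ solvable H, injective v /\ (forall x, N < v x /\ prime (v x)),
      forall p, p \in \pi(H) <-> exists2 x, A x || B x & p = v x,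
      forall x y, A x || B x -> A y || B y -> x != y ->
        nadj H (v x) (v y) = (A x && B y && c x y) || (B x && A y && c y x)
    & forall (D : pred T) (K : fieldType), (forall x, D x -> A x || B x) ->
        (forall a b, D a -> D b -> A a -> B b -> ~~ c a b) ->
        has_fpf_module H [pred p | [exists x, D x && (v x == p)]] K].
Proof.
have [v [M [injv vN pr_v ordM]]] := base_primes N.
have cov x y : x != y -> coprime (v x) (v y).
  by move=> neq; rewrite prime_coprime // dvdn_prime2 // (inj_eq injv).
pose n := (\prod_(a | A a) v a)%N; pose Q := (\prod_(b | B b) v b)%N.
have n_gt0 : 0 < n by rewrite prodn_cond_gt0 // => a _; rewrite prime_gt0.
have Q_gt0 : 0 < Q by rewrite prodn_cond_gt0 // => a _; rewrite prime_gt0.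
have [w wM] : exists w, forall b, B b -> w = M b %[mod v b].
  have [|w wM] := @chinese_seq T (enum B) v M _ (enum_uniq _).
    by move=> x y _ _; apply: cov.
  by exists w => b Bb; apply: wM; rewrite mem_enum.
pose nb b := (\prod_(a | A a && c a b) v a)%N.
have wk b k : B b -> (w ^ k == 1 %[mod v b]) = (nb b %| k).
  by move=> Bb; rewrite -modnXm (wM b Bb) modnXm ordM.
have prime_prod (P : pred T) p : prime p -> p %| \prod_(x | P x) v x ->
    exists2 x, P x & p = v x.
  move=> pr_p; rewrite Euclid_dvd_prod // big_orE => /existsP[x /andP[Px]].
  by rewrite dvdn_prime2 // => /eqP; exists x.
have prod_dvd (P : pred T) x : P x -> v x %| \prod_(y | P y) v y.
  by move=> Px; rewrite (bigD1 x) //= dvdn_mulr.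
have prod_div (P : pred T) x : P x ->
    (\prod_(y | P y) v y)%N %/ v x = (\prod_(y | P y && (y != x)) v y)%N.
  by move=> Px; rewrite (bigD1 x) //= mulKn // prime_gt0.
have sqfree (P : pred T) p : prime p -> p %| \prod_(x | P x) v x ->
    ~~ (p %| (\prod_(x | P x) v x)%N %/ p).
  move=> pr_p /(prime_prod P p pr_p)[x Px ->]; rewrite prod_div //.
  apply/negP=> /(prime_prod _ _ (pr_v x))[y /andP[_ neq] /injv eqxy].
  by rewrite eqxy eqxx in neq.
(* [n %/ v a] is the product over the other vertices of [A], so [nb b] divides it unless [a] is a
   neighbor of [b]. Through [wk] this decides whether elements of order [v a] act trivially modulo
   [v b]. *)
have nb_div a b : A a -> (nb b %| n %/ v a) = ~~ c a b.
  move=> Aa; rewrite /n prod_div //; apply/idP/idP => [d | ncab].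
    apply/negP=> cab; have : v a %| nb b by apply: prod_dvd; rewrite Aa.
    move/dvdn_trans/(_ d)/(prime_prod _ _ (pr_v a))=> [y /andP[_ neq] /injv eqay].
    by rewrite eqay eqxx in neq.
  apply: dvdn_prod_sub => x /andP[Ax cxb]; rewrite Ax.
  by apply: contraNneq ncab => <-.
have coQn : coprime Q n.
  rewrite /Q /n -!big_enum; apply: coprime_prodr_seq => a; rewrite mem_enum => Aa.
  rewrite coprime_sym; apply: coprime_prodr_seq => b; rewrite mem_enum => Bb.
  by apply: cov; apply: contraTneq Bb => <-; apply: disjAB.
have wn : w ^ n = 1 %[mod Q].
  rewrite /Q -big_enum; apply: eqn_mod_prod (enum_uniq _) _ => [x y _ _|b].
    exact: cov.
  rewrite mem_enum => Bb; apply/eqP; rewrite wk //.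
  by apply: dvdn_prod_sub => a /andP[].
have [gT [z [y [oz oy zy defH]]]] := metacyclic_exists n_gt0 Q_gt0 wn.
have oH : #|[set: gT]| = (Q * n)%N by rewrite -(sdprod_card defH) -!orderE oz oy.
have co_zy : coprime #[z] #[y] by rewrite oz oy.
have sqz q : prime q -> q %| #[z] -> ~~ (q %| #[z] %/ q) by rewrite oz; apply: sqfree.
have sqy p : prime p -> p %| #[y] -> ~~ (p %| #[y] %/ p) by rewrite oy; apply: sqfree.
have dvdA a : A a -> v a %| #[y] by rewrite oy; apply: (prod_dvd A).
have dvdB b : B b -> v b %| #[z] by rewrite oz; apply: (prod_dvd B).
have nadjBA b a : B b -> A a -> nadj [set: gT] (v b) (v a) = c a b.
  move=> Bb Aa; rewrite (nadj_metacyclic defH zy co_zy) ?dvdB ?dvdA //.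
  by rewrite oy wk // nb_div // negbK.
exists gT, [set: gT]%G, v; split=> //.
- have [nsZ _ _ _ _] := sdprod_context defH.
  rewrite (series_sol nsZ) abelian_sol ?cycle_abelian //=.
  by rewrite -(isog_sol (sdprod_isog defH)) abelian_sol ?cycle_abelian.
- move=> p; rewrite /= oH primesM // orbC; split=> [/orP[] | [x ABx ->]].
  + by rewrite mem_primes => /and3P[pr_p _ /(prime_prod _ _ pr_p)[x Ax ->]]; exists x; rewrite ?Ax.
  + by rewrite mem_primes => /and3P[pr_p _ /(prime_prod _ _ pr_p)[x Bx ->]]; exists x; rewrite ?Bx ?orbT.
  rewrite !mem_primes pr_v n_gt0 Q_gt0 /=.
  by case/orP: ABx => [/(prod_dvd A) | /(prod_dvd B)]; rewrite -/n -/Q => ->; rewrite ?orbT.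
- move=> x x' ABx ABx' neq; have neqv : v x != v x' by rewrite (inj_eq injv).
  case/orP: ABx => [Ax | Bx]; case/orP: ABx' => [Ax' | Bx'].
  + rewrite Ax Ax' (negPf (disjAB Ax)) (negPf (disjAB Ax')).
    by apply/negbTE/(nadj_cyclic (y := y)); rewrite ?inE ?dvdA.
  + rewrite Ax Bx' (negPf (disjAB Ax)) orbF nadjC nadjBA //.
  + have nA u : B u -> A u = false by move=> Bu; apply/negP=> /disjAB; rewrite Bu.
    by rewrite Ax' Bx nA //= nadjBA.
  have nA u : B u -> A u = false by move=> Bu; apply/negP=> /disjAB; rewrite Bu.
  rewrite !nA //= andbF.
  by apply/negbTE/(nadj_cyclic (y := z)); rewrite ?inE ?dvdB.
move=> D K sD nadjD; pose rs := [seq v x | x <- enum D].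
have rsP p : reflect (exists2 x, D x & p = v x) (p \in rs).
  apply: (iffP mapP) => [[x] | [x Dx ->]]; last by exists x; rewrite ?mem_enum.
  by rewrite mem_enum => Dx ->; exists x.
apply: (@has_fpf_module_eq _ _ (mem rs)) => [p _ | ].
  apply/rsP/existsP => [[x Dx ->] | [x /andP[Dx /eqP <-]]]; exists x => //.
  by rewrite Dx eqxx.
apply: (metacyclic_module defH zy co_zy) => //.
- by rewrite map_inj_uniq ?enum_uniq.
- by apply/allP=> p /rsP[x _ ->].
- move=> p /rsP[x Dx ->]; case/orP: (sD x Dx) => [Ax | Bx].
    by rewrite dvdn_mull ?dvdA.
  by rewrite dvdn_mulr ?dvdB.
move=> q p /rsP[b Db ->] /rsP[a Da ->]; rewrite oz oy.
case/(prime_prod _ _ (pr_v b)) => b' Bb' /injv eqb; case/(prime_prod _ _ (pr_v a)) => a' Aa' /injv eqa.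
by subst b' a'; apply/eqP; rewrite wk // nb_div // nadjD.
Qed.

End BaseGroup.

(** * Realization of graphs *)

Lemma graph_isomorphic_primes (T : finType) (e : rel T) (gT : finGroupType)
    (G : {group gT}) (v : T -> nat) :
  simple_graph e -> injective v ->
  (forall p, p \in \pi(G) <-> exists x, p = v x) ->
  (forall x y, x != y -> nadj G (v x) (v y) = compl_graph e x y) ->
  graph_isomorphic e (@prime_graph gT G).
Proof.
move=> [sym_e irr_e] injv vG nadjG.
have vin x : v x \in primes #|G| by apply/vG; exists x.
pose f x : prime_vertex G := SeqSub (vin x).
have injf : injective f by move=> x y /(congr1 val) /injv.
exists f; split.
  apply: inj_card_bij => //; rewrite -(card_codom injf); apply: subset_leq_card.
  apply/subsetP=> p _; have [x defp] := (vG (val p)).1 (valP p).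
  by apply/codomP; exists x; apply: val_inj.
move=> x y; rewrite /prime_graph (inj_eq injf) /=.
have [-> | neq] := eqVneq x y; first by rewrite irr_e.
have := nadjG x y neq; rewrite /compl_graph neq /= => /(congr1 negb).
by rewrite negbK => <-; rewrite negb_forall_in; apply: eq_existsb => g; rewrite negbK.
Qed.

Section DirectProduct.

Variables (aT rT : finGroupType) (A : {group aT}) (B : {group rT}).
Hypothesis coAB : coprime #|A| #|B|.

Lemma pi_setX : \pi(setX A B) =i predU (mem \pi(A)) (mem \pi(B)).
Proof. by move=> p; rewrite /= cardsX primesM. Qed.

Lemma nadj_setXl p q : p \in \pi(A) -> q \in \pi(A) ->
  nadj (setX A B) p q = nadj A p q.
Proof.
have co : coprime #|setX [1 aT] B| #|setX A [1 rT]|.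
  by rewrite !cardsX !cards1 mul1n muln1 coprime_sym.
have isoA := isog_setX1 rT A; move=> pA qA.
rewrite (nadj_sdprod_complement (dprodWsdC (setX_dprod A B)) co) /= -?(card_isog isoA) //.
by rewrite -(nadj_isog _ _ isoA).
Qed.

Lemma nadj_setXr p q : p \in \pi(B) -> q \in \pi(B) ->
  nadj (setX A B) p q = nadj B p q.
Proof.
have co : coprime #|setX A [1 rT]| #|setX [1 aT] B|.
  by rewrite !cardsX !cards1 mul1n muln1.
have isoB := isog_set1X aT B; move=> pB qB.
rewrite (nadj_sdprod_complement (dprodWsd (setX_dprod A B)) co) /= -?(card_isog isoB) //.
by rewrite -(nadj_isog _ _ isoB).
Qed.

Lemma nadj_setX p q : p \in \pi(A) -> q \in \pi(B) -> ~~ nadj (setX A B) p q.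
Proof.
rewrite !mem_primes => /and3P[pr_p _ pA] /and3P[pr_q _ qB].
have [x Ax ox] := Cauchy pr_p pA; have [y By oy] := Cauchy pr_q qB.
have co : coprime p q by apply: coprime_dvdl pA (coprime_dvdr qB coAB).
apply/nadjPn; exists (x, y); first by rewrite inE Ax.
have ox1 : #[(x, 1) : aT * rT] = p.
  by rewrite -ox -(order_injm (injm_pairg1 aT rT)) ?inE.
have oy1 : #[(1, y) : aT * rT] = q.
  by rewrite -oy -(order_injm (injm_pair1g aT rT)) ?inE.
have -> : (x, y) = ((x, 1) : aT * rT) * ((1, y) : aT * rT).
  by congr pair; rewrite /= ?mulg1 ?mul1g.
rewrite orderM ?ox1 ?oy1 // /commute.
by congr pair; rewrite /= ?mulg1 ?mul1g.
Qed.

End DirectProduct.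

Lemma pseudo_solvable_setX (aT rT gT : finGroupType) (H : {group aT})
    (S : {group rT}) (Q : {group gT}) :
  solvable H -> simple S -> setX H S \isog Q -> pseudo_solvable S Q.
Proof.
move=> solH simS /isogP[f injf defQ].
have defX := dprodWsd (setX_dprod H S).
have [nsH sSX _ _ _] := sdprod_context defX.
have defQ' := injm_sdprod (subxx _) injf defX.
rewrite defQ in defQ'.
have isoS : S \isog (Q / (f @* setX H 1))%G.
  apply: isog_trans (isog_set1X aT S) _.
  by apply: isog_trans (sub_isog sSX injf) (sdprod_isog defQ').
have nsN : f @* setX H 1 <| Q by have [] := sdprod_context defQ'.
apply/(pseudo_solvable_quotient _ nsN); split.
  apply/simple_pseudo; first by rewrite -(isog_simple isoS).
  by rewrite isog_sym isoS orbT.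
apply: solvable_pseudo; apply: morphim_sol.
by rewrite -(isog_sol (isog_setX1 rT H)).
Qed.

Section Assembly.

Variables (T : finType) (e : rel T).
Hypothesis simple_e : simple_graph e.
Local Notation c := (compl_graph e).

Lemma compl_sym x y : c x y = c y x.
Proof. by rewrite /compl_graph eq_sym simple_e.1. Qed.

(** The vertices outside [U] become the primes of an abelian normal subgroup and are thus pairwise
    adjacent in the prime graph, in agreement with [indep]. *)
Lemma prime_graph_extension (hT : finGroupType) (H : {group hT}) (v : T -> nat) (U : pred T) :
  injective v -> (forall x, prime (v x)) ->
  (forall p, p \in \pi(H) <-> exists2 x, U x & p = v x) ->
  (forall x y, U x -> U y -> x != y -> nadj H (v x) (v y) = c x y) ->
  (forall x y, ~~ U x -> ~~ U y -> ~~ c x y) ->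
  (forall z, ~~ U z ->
     has_fpf_module H [pred p | [exists x, [&& U x, c z x & v x == p]]] 'F_(v z)) ->
  exists (gT : finGroupType) (G M : {group gT}),
    [/\ M <| G, solvable M, H \isog (G / M) & graph_isomorphic e (@prime_graph gT G)].
Proof.
move=> injv pr_v piH nadjH indep modH.
pose s := [seq v z | z <- enum (predC U)].
pose Sig r := [pred p | [exists z, [exists x, [&& ~~ U z, v z == r, U x, c z x & v x == p]]]].
have sP r : reflect (exists2 z, ~~ U z & r = v z) (r \in s).
  apply: (iffP mapP) => [[z] | [z Uz ->]]; last by exists z; rewrite ?mem_enum.
  by rewrite mem_enum => Uz ->; exists z.
have SigE z x : ~~ U z -> U x -> (v x \in Sig (v z)) = c z x.
  move=> Uz Ux; apply/existsP/idP => [[z' /existsP[x']] | czx].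
    by case/and5P=> _ /eqP/injv-> _ czx /eqP/injv <-.
  by exists z; apply/existsP; exists x; rewrite Uz Ux czx !eqxx.
have s_dvd r : r \in s -> ~~ (r %| #|H|).
  case/sP=> z Uz ->; apply/negP=> rH; have : v z \in \pi(H).
    by rewrite mem_primes pr_v cardG_gt0.
  by case/piH=> x Ux /injv eqzx; rewrite eqzx Ux in Uz.
have [|||| gT [G [M [H1 [defG abM isoH piM nadjG]]]]] :=
    @module_extension hT H s Sig.
- by rewrite map_inj_uniq ?enum_uniq.
- by apply/allP=> r /sP[z _ ->].
- exact: s_dvd.
- move=> r /sP[z Uz ->]; apply: has_fpf_module_eq (modH z Uz) => p /piH[x Ux ->].
  rewrite -[Sig _ _]/(v x \in Sig (v z)) SigE //.
  apply/existsP/idP => [[x' /and3P[_ czx /eqP/injv <-]] // | czx].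
  by exists x; rewrite Ux czx eqxx.
have [nsMG _ _ _ _] := sdprod_context defG.
have piH1 p : (p \in \pi(H1)) = (p \in \pi(H)) by rewrite /= -(card_isog isoH).
have coMH : coprime #|M| #|H1|.
  apply: pnat_coprime (pnat_pi (cardG_gt0 M)) _; apply/pgroupP=> q pr_q qH.
  rewrite inE /= -[_ \in _]/(q \in \pi(M)) piM; apply: contraL qH.
  by rewrite -(card_isog isoH); apply: s_dvd.
exists gT, G, M; split=> //.
- exact: abelian_sol.
- by apply: isog_trans isoH _; apply: sdprod_isog defG.
apply: (graph_isomorphic_primes (v := v)) => // [p | x y neq].
  rewrite (pi_sdprod defG) inE /= piM piH1; split=> [/orP[/sP[z _ ->] | /piH[x _ ->]] | [x ->]].
  - by exists z.
  - by exists x.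
  case Ux: (U x); apply/orP; [right | left]; first by apply/piH; exists x.
  by apply/sP; exists x; rewrite ?Ux.
have memH x' : U x' -> v x' \in \pi(H) by move=> Ux'; apply/piH; exists x'.
have mems x' : ~~ U x' -> v x' \in s by move=> Ux'; apply/sP; exists x'.
have [Ux | Ux] := boolP (U x); have [Uy | Uy] := boolP (U y).
- rewrite (nadj_sdprod_complement defG coMH) ?piH1 ?memH //.
  by rewrite -(nadj_isog _ _ isoH) nadjH.
- by rewrite nadjC nadjG ?mems ?memH // SigE // compl_sym.
- by rewrite nadjG ?mems ?memH // SigE.
rewrite (negPf (indep x y Ux Uy)); apply/negbTE/(nadj_abelian defG abM);
  by rewrite ?piM ?mems // (inj_eq injv).
Qed.

(** Colors 0 and 1 are realized by [base_group], color 2 by modules. The neighbors of a vertex of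
    color 2 are pairwise unrelated, for want of triangles, which is the condition in [modH]. *)
Lemma prime_graph_triangle_free : triangle_free c -> three_colorable c ->
  exists (gT : finGroupType) (G : {group gT}),
    solvable G /\ graph_isomorphic e (@prime_graph gT G).
Proof.
move=> tf [col colP].
pose A := [pred x | val (col x) == 0]; pose B := [pred x | val (col x) == 1%N].
have disjAB x : A x -> ~~ B x by rewrite /A /B /= => /eqP->.
have [hT [H [v [solH [injv vP] piH nadjH modH]]]] := base_group c disjAB 0.
have sameF x y : val (col x) = val (col y) -> c x y = false.
  by move/val_inj=> eqc; apply/negP=> /colP; rewrite eqc eqxx.
have [| | | | |gT [G [M [nsM solM iso isoG]]]] :=
  @prime_graph_extension hT H v [pred x | A x || B x] injv.
- by move=> x; case: (vP x).
- exact: piH.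
- move=> x y ABx ABy neq; rewrite nadjH //; move: ABx ABy; rewrite /A /B /=.
  rewrite (compl_sym y).
  by case/orP=> /eqP cx /orP[] /eqP cy; rewrite cx cy //= ?orbF // sameF //= cx cy.
- move=> x y; rewrite /A /B /= => nx ny; rewrite sameF //.
  by move: (col x) (col y) nx ny => [[|[|[|?]]] ?] [[|[|[|?]]] ?].
- move=> z nz.
  have := modH [pred x | (A x || B x) && c z x] _ _ _.
  move/(_ 'F_(v z)); case=> [x /andP[] // | a b /andP[_ cza] /andP[_ czb] _ _ | g1 g2].
    by have := tf z a b; rewrite /triangle cza czb andbT.
  apply: has_fpf_module_eq (conj g1 g2) => p _ /=.
  by apply: eq_existsb => x; rewrite andbA.
exists gT, G; split=> //.
by rewrite (series_sol nsM) solM -(isog_sol iso).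
Qed.

(** Let [k] be the common color of the outside neighbors of [d]. Outside vertices of the other two
    colors are unrelated to the triangle, so the direct product of their base group with PSL(2,17)
    fits; those of color [k] are added by modules. *)
Lemma prime_graph_one_triangle (a b d : T) (col : T -> 'I_3) :
  unique_triangle c a b d ->
  (forall x, x \notin [set a; b; d] -> ~~ c a x /\ ~~ c b x) ->
  proper_3coloring c col ->
  (forall x y, c d x -> x \notin [set a; b] -> c d y -> y \notin [set a; b] ->
     col x = col y) ->
  exists (gT : finGroupType) (G : {group gT}),
    pseudo_solvable (PSL 2 17) G /\ graph_isomorphic e (@prime_graph gT G).
Proof.
move=> [tri utri] isol colP cold.
move: (PSL 2 17) PSL17_like nadj_PSL17 PSL17_module => S pslS nadjS modS.
pose t x := x \in [set a; b; d].
have [neq_ab neq_bd neq_ad] : [/\ a != b, b != d & a != d].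
  by case/and3P: tri => /andP[-> _] /andP[-> _] /andP[-> _].
have ct x y : t x -> t y -> x != y -> c x y.
  case/and3P: tri => cab cbd cad; rewrite /t !inE -!orbA.
  by case/or3P=> /eqP-> /or3P[] /eqP->; rewrite ?eqxx // compl_sym.
have [k colk] : exists k, forall x, ~~ t x -> c d x -> col x = k.
  have t_ab x : ~~ t x -> x \notin [set a; b].
    by apply: contra; rewrite /t !inE => /orP[] ->; rewrite ?orbT.
  have [x /andP[/t_ab nx cx] | none] := pickP [pred x | ~~ t x && c d x].
    by exists (col x) => y /t_ab ny cy; apply: cold.
  (* Any color serves when [d] has no outside neighbor. *)
  by exists ord0 => x nx cx; have /= := none x; rewrite nx cx.
have cout x y : t x -> ~~ t y -> c x y -> x = d /\ col y = k.
  move=> tx ny cxy; have [nca ncb] := isol y ny; move: tx cxy; rewrite /t !inE -orbA.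
  case/or3P=> /eqP->; rewrite ?(negPf nca) ?(negPf ncb) // => cdy.
  by split=> //; apply: colk.
have [i [j [neq_ij neq_ik neq_jk colE]]] : exists i j : 'I_3,
    [/\ i != j, i != k, j != k & forall l, [|| l == i, l == j | l == k]].
  case: k {colk cout} => [[|[|[|]]] // lt_k].
  - by exists (Ordinal (isT : 1 < 3)), (Ordinal (isT : 2 < 3)); split=> // -[[|[|[|]]]].
  - by exists (Ordinal (isT : 0 < 3)), (Ordinal (isT : 2 < 3)); split=> // -[[|[|[|]]]].
  - by exists (Ordinal (isT : 0 < 3)), (Ordinal (isT : 1 < 3)); split=> // -[[|[|[|]]]].
pose A := [pred x | ~~ t x && (col x == i)]; pose B := [pred x | ~~ t x && (col x == j)].
have disjAB x : A x -> ~~ B x by case/andP=> /= -> /eqP->.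
(* The bound 17 keeps the new primes away from 2, 3 and 17. *)
have [hT [H [v0 [solH [injv0 v0P piH nadjH modH]]]]] := base_group c disjAB 17.
have nt x : A x || B x -> ~~ t x by case/orP=> /andP[].
have tAB x : t x -> (A x || B x) = false by move=> tx; apply: contraTF tx => /nt.
pose v x := if x == a then 2 else if x == b then 3 else if x == d then 17 else v0 x.
have [va vb vd] : [/\ v a = 2, v b = 3 & v d = 17].
  by rewrite /v !eqxx ![_ == a]eq_sym ![d == b]eq_sym (negPf neq_ab) (negPf neq_bd) (negPf neq_ad).
have vt x : t x -> v x \in psl_primes.
  by rewrite /t !inE -orbA; case/or3P=> /eqP->; rewrite ?va ?vb ?vd.
have vn x : ~~ t x -> v x = v0 x.
  by rewrite /t /v !inE !negb_or -andbA => /and3P[/negPf-> /negPf-> /negPf->].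
have sameF x y : col x = col y -> c x y = false.
  by move=> eqc; apply/negP=> /colP; rewrite eqc eqxx.
have vt_inv p : p \in psl_primes -> exists2 x, t x & p = v x.
  case/or3P=> /eqP->; first by exists a; rewrite ?va // /t !inE eqxx.
    by exists b; rewrite ?vb // /t !inE eqxx orbT.
  by exists d; rewrite ?vd // /t !inE eqxx orbT.
have big x : v0 x \notin psl_primes.
  by have [big _] := v0P x; apply/or3P=> -[] /eqP eq17; rewrite eq17 in big.
have injv : injective v.
  move=> x y; have [tx | nx] := boolP (t x); have [ty | ny] := boolP (t y).
  - move: tx ty; rewrite /t !inE -!orbA.
    by case/or3P=> /eqP-> /or3P[] /eqP->; rewrite ?va ?vb ?vd.
  - by move=> eqv; case/negP: (big y); rewrite -vn // -eqv vt.
  - by move=> eqv; case/negP: (big x); rewrite -vn // eqv vt.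
  by rewrite !vn // => /injv0.
have pr_v x : prime (v x).
  have [/vt | /vn->] := boolP (t x); last by have [] := v0P x.
  by rewrite psl_primesP => /andP[].
have [simS oS _ _] := pslS.
have piS p : (p \in \pi(S)) = (p \in psl_primes).
  by rewrite mem_primes /= oS psl_primesP.
have coHS : coprime #|H| #|S|.
  apply: pnat_coprime (pnat_pi (cardG_gt0 H)) _; apply/pgroupP=> q pr_q qS.
  apply/negP=> qH; have /piH[x _ defq] : q \in \pi(H) by [].
  by case/negP: (big x); rewrite -defq -piS mem_primes pr_q cardG_gt0.
pose U := [pred x | t x || (A x || B x)].
have memS x : t x -> v x \in \pi(S) by rewrite piS; apply: vt.
have memH x : A x || B x -> v x \in \pi(H).
  by move=> ABx; apply/piH; exists x; rewrite ?vn ?nt.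
have cAB x y : t x -> A y || B y -> c x y = false.
  move=> tx ABy; apply/negP=> /(cout x y tx (nt y ABy))[_ coly].
  by case/orP: ABy => /andP[_] /=; rewrite coly eq_sym (negPf neq_ik, negPf neq_jk).
have [| | | |gT [G [M [nsM solM iso isoG]]]] :=
  @prime_graph_extension _ (setX_group H S) v U injv pr_v.
- move=> p; rewrite pi_setX inE /= piS.
  split=> [/orP[/piH[x ABx ->] | /vt_inv[x tx ->]] | [x Ux ->]].
  + by exists x; rewrite ?ABx ?orbT // vn ?nt.
  + by exists x; rewrite ?tx.
  by case/orP: Ux => [/vt-> | /memH->]; rewrite ?orbT.
- move=> x y /orP[tx | ABx] /orP[ty | ABy] neq.
  + rewrite (nadj_setXr coHS) ?memS // nadjS ?vt ?(inj_eq injv) //.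
    by rewrite ct.
  + by rewrite nadjC cAB //; apply/negbTE/(nadj_setX coHS); rewrite ?memS ?memH.
  + by rewrite compl_sym cAB //; apply/negbTE/(nadj_setX coHS); rewrite ?memS ?memH.
  rewrite (nadj_setXl coHS) ?memH // !vn ?nt // nadjH // (compl_sym y).
  case/orP: (ABx) => /andP[/= -> /eqP cx]; case/orP: (ABy) => /andP[/= -> /eqP cy];
    by rewrite cx cy !eqxx ?(negPf neq_ij) ?[j == i]eq_sym ?(negPf neq_ij) //= ?orbF // sameF // cx cy.
- have colU x : ~~ U x -> col x = k.
    rewrite /= !negb_or => /and3P[/= -> /= ni nj].
    by have /or3P[] := colE (col x); rewrite ?(negPf ni) ?(negPf nj) // => /eqP.
  by move=> x y nx ny; rewrite sameF // !colU.
- move=> z; rewrite /= negb_or => /andP[nz _].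
  apply: has_fpf_module_setX => //.
    have := modH [pred x | (A x || B x) && c z x] _ _ _.
    move/(_ 'F_(v z)); case=> [x /andP[] // | x y /andP[ABx czx] /andP[_ czy] _ _ | g1 g2].
      (* Two related neighbors of [z] would form with it a second triangle, as [z] lies outside the
         given one. *)
      apply: contra nz => cxy; have := utri z x y.
      by rewrite /triangle czx czy cxy /t => <- //; rewrite !inE eqxx.
    apply: has_fpf_module_eq (conj g1 g2) => _ /piH[x ABx ->] /=.
    apply/existsP/existsP=> [] [y].
      case/andP=> /andP[ABy czy] /eqP eqv; exists y.
      by rewrite ABy orbT czy vn ?nt // eqv eqxx.
    case/and3P=> Uy czy /eqP eqv; move: eqv; rewrite -(vn x) ?nt // => /injv eqx.
    rewrite eqx in czy; exists x; rewrite (vn x (nt x ABx)) eqxx czy !andbT; exact: ABx.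
  have SigS x : t x -> [exists y, [&& U y, c z y & v y == v x]] = c z x.
    move=> tx; apply/existsP/idP => [[y /and3P[_ czy /eqP/injv <-]] // | czx].
    by exists x; rewrite /= tx czx eqxx.
  (* Of the three triangle vertices only [d] can be related to [z]; the module for [S] is the one
     that is fixed point free at 17 if it is, and a trivial one if not. *)
  have [czd | nczd] := boolP (c z d); last first.
    apply: trivial_fpf_module => p; rewrite piS => /vt_inv[x tx ->].
    rewrite inE /= SigS // compl_sym; apply: contra nczd => cxz.
    by have [<- _] := cout x z tx nz cxz; rewrite compl_sym.
  apply: (@has_fpf_module_eq _ _ (pred1 17)).
    move=> p; rewrite piS => /vt_inv[x tx ->] /=; rewrite SigS // -vd (inj_eq injv).
    apply/eqP/idP => [-> // | czx]; rewrite compl_sym in czx.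
    by have [] := cout x z tx nz czx.
  apply: modS; rewrite -(GRing.dvdn_pcharf (pchar_Fp (pr_v z))).
  rewrite dvdn_prime2 // -vd (inj_eq injv); apply: contraNneq nz => ->.
  by rewrite /t !inE eqxx !orbT.
exists gT, G; split=> //.
apply/(pseudo_solvable_quotient _ nsM); split; last exact: solvable_pseudo.
exact: pseudo_solvable_setX iso.
Qed.

End Assembly.

Theorem theorem7p12 (T : finType) (e : rel T) (he : simple_graph e) :
  (exists (gT : finGroupType) (G : {group gT}),
      pseudo_solvable (PSL 2 17) G /\ graph_isomorphic e (@prime_graph gT G))
  <->
  ((triangle_free (compl_graph e) /\ three_colorable (compl_graph e))
   \/
   (exists a b c : T,
       unique_triangle (compl_graph e) a b c /\
       (forall x : T, x \notin [set a; b; c] ->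
          ~~ compl_graph e a x /\ ~~ compl_graph e b x) /\
       (exists col : T -> 'I_3,
          proper_3coloring (compl_graph e) col /\
          forall x y : T,
            compl_graph e c x -> x \notin [set a; b] ->
            compl_graph e c y -> y \notin [set a; b] ->
            col x = col y))).
Proof.
split=> [[gT [G [psG isoG]]] | [[tf col3] | [a [b [d [utri [isol [col [colP cold]]]]]]]]].
- exact: prime_graph_condition PSL17_like psG isoG.
- have [gT [G [solG isoG]]] := prime_graph_triangle_free he tf col3.
  by exists gT, G; split; first exact: solvable_pseudo.
exact (prime_graph_one_triangle he utri isol colP cold).
Qed.
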